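(* For $n\ge 2$ let $W^h_n\colon\mathcal{C}_n\to \mathrm{Inv}(sl_2^{\otimes n})$ be the restriction of the $sl_2$ weight system to the space $\mathcal{C}_n$ of connected trees with $n$ univalent vertices labeled by distinct elements of $\{1,\ldots,n\}$. (i) The map $W^h_n$ is injective if and only if $n\le 5$. (ii) For $n$ odd and for $n=2$, the map $W^h_n$ is surjective. (iii) For $n\ge 4$ even, $W^h_n$ has a $1$-dimensional cokernel, spanned by the class of $c^{\otimes n/2}\in \mathrm{Inv}(sl_2^{\otimes n})$, where $c=\frac12 h\otimes h+e\otimes f+f\otimes e\in \mathrm{Inv}(sl_2^{\otimes 2})$.
   Context: The Lie algebra $sl_2$ over $\mathbb{Q}$ has basis $h,e,f$ with $[h,e]=2e$, $[h,f]=-2f$, $[e,f]=h$. $\mathrm{Inv}(sl_2^{\otimes n})$ is the space of tensors in the $n$-fold tensor power of the adjoint representation that are mapped to zero by $h,e,f$. A Jacobi diagram is a finite unitrivalent graph (vertices of valence 1 or 3), each trivalent vertex being equipped with a cyclic ordering of its three incident half-edges, and each connected component having at least one univalent vertex. A tree is a Jacobi diagram without cycles; a strut is a tree with a single edge. An internal edge is an edge connecting two trivalent vertices. $\mathcal{C}_n$ is the $\mathbb{Q}$-space spanned by connected trees with exactly $n$ univalent vertices, in which each of the labels $1,\ldots,n$ appears exactly once, modulo the AS relation (reversing the cyclic order at one trivalent vertex multiplies the diagram by $-1$) and the IHX relation (the diagrammatic Jacobi identity). Let $\kappa\colon sl_2\otimes sl_2\to\mathbb{Q}$ be the symmetric bilinear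 form with $\kappa(h,h)=2$, $\kappa(e,f)=1$, $\kappa(h,e)=\kappa(h,f)=\kappa(e,e)=\kappa(f,f)=0$, and let $b=h\otimes e\otimes f+e\otimes f\otimes h+f\otimes h\otimes e-h\otimes f\otimes e-f\otimes e\otimes h-e\otimes h\otimes f\in\mathrm{Inv}(sl_2^{\otimes 3})$. The map $W^h_n$ is the linear map defined on a connected tree $T$ as follows: for $n=2$ ($T$ a strut), $W^h_2(T)=c$. For $n\ge3$, attach a copy of $b$ to each trivalent vertex of $T$, its three tensor factors being associated to the three half-edges following the cyclic order, and contract by $\kappa$ the two factors on each internal edge; the result is a tensor with one factor for each univalent vertex, and $W^h_n(T)$ is this tensor with the factor of the $j$-labeled vertex put in position $j$. (This is well-defined modulo AS and IHX.) *)

(* Defs.v *)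
From HB Require Import structures.
From mathcomp Require Import all_boot all_order all_algebra perm.
From mathcomp Require Import boolp.
From mathcomp Require Import monalg.

Set Implicit Arguments.
Unset Strict Implicit.
Unset Printing Implicit Defensive.

Import GRing.Theory.
Local Open Scope ring_scope.
Local Open Scope quotient_scope.

Inductive span (R : pzRingType) (V : lmodType R) (G : V -> Prop) : V -> Prop :=
| span0 : span G 0
| spanD a g v of G g & span G v : span G (a *: g + v).

(* V modulo the submodule spanned by an arbitrary set G of vectors. *)
Section QuotientModule.
Variables (R : pzRingType) (V : lmodType R) (G : V -> Prop).

Lemma spanZD a u v : span G u -> span G v -> span G (a *: u + v).
Proof.
move=> Gu Gv; elim: Gu => [|b g w Gg _ IH]; first by rewrite scaler0 add0r.
by rewrite scalerDr scalerA -addrA; apply: spanD.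
Qed.

Definition span_pred : pred V := fun v => `[< span G v >].

Fact span_pred_submod : submod_closed span_pred.
Proof.
split=> [|a u v]; first by apply/asboolP; apply: span0.
by move=> /asboolP Gu /asboolP Gv; apply/asboolP/spanZD.
Qed.

HB.instance Definition _ := GRing.isSubmodClosed.Build R V span_pred
  span_pred_submod.

Definition quotmod := Quotient.quot (GRing.ZmodClosed.clone V span_pred _).
HB.instance Definition _ := GRing.Zmodule.on quotmod.

Definition quotmod_pi (v : V) : quotmod := \pi v.

Lemma quotmod_eq u v : (quotmod_pi u = quotmod_pi v) <-> span G (u - v).
Proof.
split=> [/eqP|/asboolP Guv]; last by apply/eqP; rewrite -Quotient.idealrBE.
by rewrite -Quotient.idealrBE => /asboolP.
Qed.

Lemma quotmod_repr q : quotmod_pi (repr q) = q.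
Proof. exact: reprK. Qed.

Lemma quotmod_piD : {morph quotmod_pi : u v / u + v}.
Proof. exact: (raddfD (\pi_quotmod)). Qed.

Definition quotmod_scale (a : R) (q : quotmod) := quotmod_pi (a *: repr q).

Lemma quotmod_scaleE a v :
  quotmod_scale a (quotmod_pi v) = quotmod_pi (a *: v).
Proof.
apply/quotmod_eq; rewrite -scalerBr -[_ *: _]addr0.
by apply: spanZD; [apply/quotmod_eq/quotmod_repr | apply: span0].
Qed.

Fact quotmod_scaleA a b q :
  quotmod_scale a (quotmod_scale b q) = quotmod_scale (a * b) q.
Proof. by rewrite -[q]quotmod_repr !quotmod_scaleE scalerA. Qed.

Fact quotmod_scale1 : left_id 1 quotmod_scale.
Proof. by move=> q; rewrite -[q]quotmod_repr quotmod_scaleE scale1r. Qed.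

Fact quotmod_scaleDr : right_distributive quotmod_scale +%R.
Proof.
move=> a p q; rewrite -[p]quotmod_repr -[q]quotmod_repr.
by rewrite -quotmod_piD !quotmod_scaleE scalerDr quotmod_piD.
Qed.

Fact quotmod_scaleDl q : {morph quotmod_scale^~ q : a b / a + b}.
Proof.
move=> a b; rewrite -[q]quotmod_repr !quotmod_scaleE.
by rewrite scalerDl quotmod_piD.
Qed.

HB.instance Definition _ := GRing.Zmodule_isLmodule.Build R quotmod
  quotmod_scaleA quotmod_scale1 quotmod_scaleDr quotmod_scaleDl.

Fact quotmod_pi_linear : linear quotmod_pi.
Proof.
move=> a u v; rewrite quotmod_piD; congr (_ + _).
by rewrite -quotmod_scaleE.
Qed.

HB.instance Definition _ := GRing.isLinear.Build R V quotmod *:%R quotmod_pi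
  quotmod_pi_linear.

End QuotientModule.

Inductive sl2_basis := Bh | Be | Bf.

Definition ord_of_sl2_basis (a : sl2_basis) : 'I_3 :=
  match a with Bh => @Ordinal 3 0 isT | Be => @Ordinal 3 1 isT
  | Bf => @Ordinal 3 2 isT end.
Definition sl2_basis_of_ord (i : 'I_3) : sl2_basis :=
  match val i with 0 => Bh | 1 => Be | _ => Bf end.
Fact ord_of_sl2_basisK : cancel ord_of_sl2_basis sl2_basis_of_ord.
Proof. by case. Qed.

HB.instance Definition _ := Finite.copy sl2_basis (can_type ord_of_sl2_basisK).

(* Coordinates in the basis (h, e, f). *)
Definition sl2 := {ffun sl2_basis -> rat^o}.

Definition sl2_vec (a : sl2_basis) : sl2 := [ffun x => (x == a)%:R].
Local Notation h := (sl2_vec Bh).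
Local Notation e := (sl2_vec Be).
Local Notation f := (sl2_vec Bf).

Definition bracket (a x : sl2_basis) : sl2 :=
  match a, x with
  | Bh, Be => 2 *: e     | Be, Bh => - (2 *: e)
  | Bh, Bf => - (2 *: f) | Bf, Bh => 2 *: f
  | Be, Bf => h          | Bf, Be => - h
  | _, _ => 0
  end.

Definition kappa (a b : sl2_basis) : rat :=
  match a, b with
  | Bh, Bh => 2
  | Be, Bf | Bf, Be => 1
  | _, _ => 0
  end.

(* The n-fold tensor power of sl2, in coordinates: t x is the coefficient of
   the basis tensor x_0 (x) ... (x) x_{n-1}. *)
Definition tens n := {ffun n.-tuple sl2_basis -> rat^o}.

Definition tprod n (v : n.-tuple sl2) : tens n :=
  [ffun x => \prod_(j < n) tnth v j (tnth x j)].

(* x_0 (x) ... (x) x_{n-1} |-> sum_j x_0 (x) ... [a, x_j] ... (x) x_{n-1} *)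
Definition act n (a : sl2_basis) (t : tens n) : tens n :=
  \sum_(x : n.-tuple sl2_basis) t x *: \sum_(j < n)
    tprod [tuple if i == j then bracket a (tnth x i) else sl2_vec (tnth x i)
          | i < n].

Fact act_linear n a : linear (@act n a).
Proof.
move=> k t u; rewrite /act scaler_sumr -big_split /=; apply: eq_bigr => x _.
by rewrite !ffunE scalerDl scalerA.
Qed.
HB.instance Definition _ n a :=
  GRing.isLinear.Build rat (tens n) (tens n) *:%R (@act n a) (@act_linear n a).

Definition Inv n : {vspace tens n} :=
  (lker (linfun (@act n Bh)) :&: lker (linfun (@act n Be))
    :&: lker (linfun (@act n Bf)))%VS.

Lemma mem_Inv n (t : tens n) : (t \in Inv n) = [forall a, act a t == 0].
Proof.
rewrite !memv_cap !memv_ker !lfunE /=.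
apply/idP/forallP => [/andP[/andP[th te] tf] []//|t0].
by rewrite !t0.
Qed.

Definition c_tens : tens 2 :=
  2^-1 *: tprod [tuple h; h] + tprod [tuple e; f] + tprod [tuple f; e].

Definition b_tens : tens 3 :=
  tprod [tuple h; e; f] + tprod [tuple e; f; h] + tprod [tuple f; h; e]
  - tprod [tuple h; f; e] - tprod [tuple f; e; h] - tprod [tuple e; h; f].

(* The tensor power c (x) ... (x) c with n./2 factors; meant for even n. *)
Definition cpow n : tens n :=
  [ffun x : n.-tuple sl2_basis =>
    \prod_(i < n./2) c_tens [tuple nth Bh x i.*2; nth Bh x i.*2.+1]].


Definition subst n (x : n.-tuple sl2_basis) (j : 'I_n) (z : sl2_basis) :
    n.-tuple sl2_basis :=
  [tuple if i == j then z else tnth x i | i < n].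

Lemma act_coord n a (t : tens n) x :
  act a t x = \sum_(j < n) \sum_z t (subst x j z) * bracket a z (tnth x j).
Proof.
rewrite /act sum_ffunE.
under eq_bigr => y _ do rewrite ffunE sum_ffunE scaler_sumr.
rewrite exchange_big /=; apply: eq_bigr => j _.
rewrite (partition_big (fun y => tnth y j) xpredT) //=; apply: eq_bigr => z _.
rewrite (bigD1 (subst x j z)) /=; last by rewrite tnth_mktuple eqxx.
rewrite big1 ?addr0 => [|y /andP[/eqP yz yx]].
  rewrite ffunE (bigD1 j) //= tnth_mktuple eqxx tnth_mktuple eqxx.
  rewrite big1 ?mulr1 // => i ij.
  by rewrite tnth_mktuple (negPf ij) tnth_mktuple (negPf ij) ffunE eqxx.
have [i ij yxi] : exists2 i, i != j & tnth y i != tnth x i.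
  apply/exists_inP; apply: contraNT yx.
  rewrite negb_exists_in => /forall_inP yx.
  apply/eqP/eq_from_tnth => i; rewrite tnth_mktuple.
  by case: (eqVneq i j) => [->//|/yx]; rewrite negbK => /eqP.
rewrite ffunE (bigD1 i) //= tnth_mktuple (negPf ij) ffunE eq_sym (negPf yxi).
by rewrite mul0r scaler0.
Qed.

Lemma big_sl2 (F : sl2_basis -> rat) : \sum_z F z = F Bh + F Be + F Bf.
Proof.
rewrite (bigD1 Bh) // (bigD1 Be) // (bigD1 Bf) //= big1 ?addr0 ?addrA //.
by case.
Qed.

Lemma c_tensE x y :
  c_tens [tuple x; y] = match x, y with
    | Bh, Bh => 2^-1 | Be, Bf | Bf, Be => 1 | _, _ => 0 end.
Proof.
by rewrite !ffunE !big_ord_recl !big_ord0 !(tnth_nth 0) !(tnth_nth Bh) /=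
  !ffunE; case: x; case: y.
Qed.

Lemma c_tens_inv a x y :
  \sum_z c_tens [tuple z; y] * bracket a z x
  + \sum_z c_tens [tuple x; z] * bracket a z y = 0.
Proof.
rewrite !big_sl2 !c_tensE.
by case: a; case: x; case: y; rewrite /= !ffunE /=; apply/eqP.
Qed.

Lemma sum_double (F : nat -> rat) m :
  \sum_(k < m.*2) F k = \sum_(i < m) (F i.*2 + F i.*2.+1).
Proof.
elim: m => [|m IH]; first by rewrite !big_ord0.
by rewrite doubleS !big_ord_recr /= IH addrA.
Qed.

Lemma cpow_Inv n : ~~ odd n -> cpow n \in Inv n.
Proof.
move=> n_even; have n2 : n = n./2.*2.
  by rewrite -[LHS]odd_double_half (negPf n_even).
rewrite mem_Inv; apply/forallP => a; apply/eqP/ffunP => x.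
rewrite act_coord ffunE.
pose X := nth Bh x.
pose Y k z i := if i == k then z else X i.
pose T k := \sum_z (\prod_(i < n./2) c_tens [tuple Y k z i.*2; Y k z i.*2.+1])
  * bracket a z (X k).
transitivity (\sum_(k < n) T k).
  apply: eq_bigr => k _; apply: eq_bigr => z _.
  rewrite ffunE (tnth_nth Bh); congr (_ * _); apply: eq_bigr => i _.
  have Yi j : (j < n)%N -> nth Bh (subst x k z) j = Y k z j.
    move=> jn; rewrite -(tnth_nth Bh (subst x k z) (Ordinal jn)).
    by rewrite tnth_mktuple (tnth_nth Bh).
  have i2 : (i.*2.+1 < n)%N by rewrite [ltnRHS]n2 ltn_Sdouble.
  by congr (c_tens _); apply/val_inj; rewrite /= !Yi // ltnW.
rewrite n2 sum_double big1 // => i _; rewrite /T.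
under eq_bigr => z _ do rewrite (bigD1 i) //=.
under [X in _ + X]eq_bigr => z _ do rewrite (bigD1 i) //=.
pose P := \prod_(j < n./2 | j != i) c_tens [tuple X j.*2; X j.*2.+1].
transitivity (P * (\sum_z c_tens [tuple z; X i.*2.+1] * bracket a z (X i.*2)
   + \sum_z c_tens [tuple X i.*2; z] * bracket a z (X i.*2.+1)));
  last by rewrite c_tens_inv mulr0.
have D (j : 'I_(n./2)) : (j.*2.+1 == i.*2) = false.
  by apply/eqP => /(congr1 odd); rewrite /= !odd_double.
have D' (j : 'I_(n./2)) : (j.*2 == i.*2.+1) = false.
  by apply/eqP => /(congr1 odd); rewrite /= !odd_double.
rewrite mulrDr !mulr_sumr; congr (_ + _); apply: eq_bigr => z _.
  rewrite /Y eqxx D -mulrA mulrCA; congr (_ * _).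
  apply: eq_bigr => j ji; rewrite D -(inj_eq val_inj) in ji *.
  by rewrite (inj_eq double_inj) (negPf ji).
rewrite /Y eqxx D' -mulrA mulrCA; congr (_ * _).
apply: eq_bigr => j ji; rewrite D' eqSS (inj_eq double_inj).
by rewrite -(inj_eq val_inj) in ji; rewrite (negPf ji).
Qed.

(* A unitrivalent graph with univalent vertices labelled bijectively by 'I_n and
   with k trivalent vertices is a set of half-edges, namely inl i at the i-th
   univalent vertex and inr (v, 0), inr (v, 1), inr (v, 2), in this cyclic
   order, at the trivalent vertex v, with a fixed-point-free involution p on the
   half-edges whose orbits are the edges. *)
Definition half n k := ('I_n + 'I_k * 'I_3)%type.

Definition vert n k (x : half n k) : 'I_n + 'I_k :=
  match x with inl i => inl i | inr (v, _) => inr v end.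

Definition next n k (x : half n k) : half n k :=
  match x with inl i => inl i | inr (v, i) => inr (v, ordS i) end.

Definition adj n k (p : half n k -> half n k) : rel ('I_n + 'I_k) :=
  fun u v => [exists x, (vert x == u) && (vert (p x) == v)].

(* x leaves vert x along its edge; consecutive edges of s are distinct, so that
   loops and double edges count as circuits. *)
Definition circuit n k (p : half n k -> half n k) (s : seq (half n k)) : Prop :=
  [/\ s != [::], uniq (map (@vert n k) s)
    & cycle (fun x y => (vert (p x) == vert y) && (y != p x)) s].

Definition is_tree n k (p : {ffun half n k -> half n k}) : Prop :=
  [/\ forall x, p (p x) = x, forall x, p x != x,
      forall u v, connect (adj p) u v & forall s, ~ circuit p s].

Definition tree_on n k := {p : {ffun half n k -> half n k} | `[< is_tree p >]}.
Definition tree n := {k : nat & tree_on n k}.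
Definition mktree n k (p : tree_on n k) : tree n := Tagged (tree_on n) p.

(* q is p with every half-edge x renamed to s x. *)
Definition relabels n k (s : half n k -> half n k) (p q : tree_on n k) : Prop :=
  forall x, val q (s x) = s (val p x).

Definition is_iso n k (s : half n k -> half n k) : Prop :=
  [/\ bijective s, forall i, s (inl i) = inl i
    & forall x, s (next x) = next (s x)].

(* Exchanging two half-edges at a trivalent vertex reverses its cyclic order. *)
Definition reverse n k (x : half n k) : half n k -> half n k :=
  tperm (next x) (next (next x)).

(* For an edge {x, y} between trivalent vertices, with other half-edges
   x1, x2 at the vertex of x and y1, y2 at that of y (in cyclic order),
   rotate is the 3-cycle x1 -> y1 -> x2 -> x1. *)
Definition rotate n k (x y : half n k) : half n k -> half n k :=
  tperm (next (next x)) (next y) \o tperm (next x) (next (next x)).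

(* rel_iso identifies isomorphic diagrams. rel_IHX is IHX up to AS: with the
   edge {x, y} and the leg y2 kept fixed, the sum over the cyclic permutations
   of the other three legs around the edge vanishes (Jacobi identity). *)
Inductive relator n : {malg rat[tree n]} -> Prop :=
| rel_iso k (p q : tree_on n k) s of is_iso s & relabels s p q :
    relator (<< mktree p >> - << mktree q >>)
| rel_AS k (p q : tree_on n k) v of relabels (reverse (inr v)) p q :
    relator (<< mktree p >> + << mktree q >>)
| rel_IHX k (p q r : tree_on n k) u v of
    val p (inr u) = inr v &
    relabels (rotate (inr u) (inr v)) p q &
    relabels (rotate (inr u) (inr v)) q r :
    relator (<< mktree p >> + << mktree q >> + << mktree r >>).

Definition C n := quotmod (@relator n).
Definition cls n (T : tree n) : C n := quotmod_pi (@relator n) << T >>.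

Definition internal n k (p : {ffun half n k -> half n k}) (x : half n k) :=
  if (x, p x) is (inr _, inr _) then true else false.

(* State sum over the colourings of the half-edges by basis vectors. The colour
   of inl j only copies that of the half-edge at the other end of its edge,
   which is the j-th free factor; hence the result is the intended contraction
   when no edge joins two univalent vertices. The order on enum_rank picks one
   half-edge of each internal edge (kappa is symmetric). *)
Definition W_contract n (T : tree n) : tens n :=
  let: existT k (exist p _) := T in
  [ffun x : n.-tuple sl2_basis =>
    \sum_(col : {ffun half n k -> sl2_basis} |
        [forall j, (col (inl j) == tnth x j) && (col (p (inl j)) == tnth x j)])
      (\prod_(v < k) b_tens [tuple col (inr (v, i)) | i < 3]) *
      (\prod_(y | internal p y && (enum_rank y < enum_rank (p y))%N)
         kappa (col y) (col (p y)))].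

Definition W n : tree n -> tens n :=
  match n return tree n -> tens n with
  | 2 => fun=> c_tens
  | m => @W_contract m
  end.

(* Main.v *)
From HB Require Import structures.
From mathcomp Require Import fingroup perm all_boot all_order all_algebra.
From mathcomp Require Import boolp zify ring lra finmap monalg.
Require Import Defs.

(** Why the theorem holds.  Everything is compared with combs: trees all of
    whose trivalent vertices lie on the path from leaf 0 to the last leaf.

    Combs span [C n] ([comb_span]).  Call the path from leaf 0 to the last leaf
    the spine of a tree.  If a trivalent vertex lies off the spine, then some
    edge joins a vertex of the spine to such a vertex, and IHX at this edge
    expresses the tree by two trees whose spines are longer by one vertex
    ([spine_step]).  If all trivalent vertices lie on the spine, then the tree
    is, up to sign, a comb with its middle leaves permuted ([cls_full_spine]).
    Combs are grown by replacing the last leaf by a trivalent vertex with two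
    leaves; on weights this applies the cobracket to the last slot ([W_graft]).
    So the tensor of a comb is explicit, and it is invariant.

    Cokernel.  Let [J n] be the span of the tensors of trees.  Half the bracket
    of the last two slots followed by the cobracket is [1] minus the exchange
    of these slots ([Ins_Con]), because the exterior square of sl2 is a copy
    of sl2.  As [J] is stable under inserting cobrackets, an induction on [n]
    shows that all invariants are symmetric modulo [J n]
    ([Inv_sym_mod_trees]); hence they agree modulo [J n] with multiples of
    their averages over all permutations.  A symmetric invariant is determined
    by its coordinate at h, ..., h ([sym_even]), and it is zero in odd degree
    ([sym_odd]).  For even [n] this leaves at most the line of the power of
    [c], and this line survives: the coordinate at h, ..., h is nonzero for the
    power of [c] and zero for all trees ([L_all_h]).

    Injectivity.  For at most five leaves there is a functional on tensors that
    is 1 on the comb and 0 on the comb with middle leaves permuted nontrivially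
    ([inj_le5]), so the permuted combs have independent tensors.  From six
    leaves on, antisymmetrize the comb in its middle leaves.  There are at
    least four of them and sl2 has dimension three, so the weight vanishes; but
    the weight system of gl_n, with leaf i coloured by the matrix unit
    E_(i,i+1), is 1 on the comb and 0 on its other permutations
    ([word_functional]), so the antisymmetrized comb is not zero. *)

Set Implicit Arguments.
Unset Strict Implicit.
Unset Printing Implicit Defensive.

Import GRing.Theory Num.Theory.
Local Open Scope ring_scope.

(** * Counting the half-edges of a tree *)

Section Walks.
Local Open Scope nat_scope.
Variables (n k : nat) (p : half n k -> half n k).
Hypotheses (pK : involutive p) (pN : forall x, p x != x).

(** The successor relation of [circuit]: walk without turning back. *)
Definition step : rel (half n k) :=
  fun x y => (vert (p x) == vert y) && (y != p x).

(** A walk that returns to its first vertex is a circuit, unless it arrives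
    along the edge by which it left; then its second half-edge would be the
    other end of the first, that is, the walk would turn back. *)
Lemma walk_closes x s : (forall c, ~ circuit p c) ->
  path step x s -> uniq (map (@vert n k) (x :: s)) ->
  vert (p (last x s)) != vert x.
Proof.
move=> noc xs us; apply/eqP => cl.
have [xe|xe] := eqVneq x (p (last x s)); last first.
  apply: (noc (x :: s)); split=> //.
  by rewrite /= rcons_path xs /= cl eqxx.
case: s xs us cl xe => [|y s] /=; first by move=> _ _ _ xe; case/eqP: (pN x).
case/andP=> /andP[/eqP xy yx] _ /andP[_ /andP[uy _]] cl xe.
have lp : p x = last y s by rewrite [in p x]xe pK.
case: (lastP s) uy lp xe => [|t z] uy lp xe.
  by rewrite lp eqxx in yx.
move: lp uy; rewrite last_rcons => pz.
by rewrite -xy pz map_rcons mem_rcons inE eqxx.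
Qed.

(** The first repetition of a vertex closes up a part of the walk, which
    [walk_closes] forbids. *)
Lemma walk_uniq x s : (forall c, ~ circuit p c) -> path step x s ->
  uniq (map (@vert n k) (x :: s)) /\
  vert (p (last x s)) \notin map (@vert n k) (x :: s).
Proof.
move=> noc; elim: s x => [|y s IH] x xs.
  by split=> //; rewrite inE; apply: (walk_closes (s := [::])).
have [us ls] := IH y (proj2 (andP xs)).
have nx : vert x \notin map (@vert n k) (y :: s).
  apply/mapP => -[z zs vz].
  have hz : has (fun z => vert z == vert x) (y :: s).
    by apply/hasP; exists z => //; rewrite vz.
  case: (split_find hz) xs us => w a b /eqP vw na xs us.
  move: xs; rewrite cat_path rcons_path => /andP[/andP[xa /andP[/eqP aw _]] _].
  suff: vert (p (last x a)) != vert x by rewrite aw vw eqxx.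
  apply: walk_closes => //=; apply/andP; split.
    apply: contra na => /mapP[q qa ->]; apply/hasP; exists q => //.
  by move: us; rewrite cat_rcons map_cat cat_uniq => /andP[].
have uxs : uniq (map (@vert n k) (x :: y :: s)) by rewrite /= nx.
split=> //; rewrite map_cons inE negb_or; apply/andP; split=> //.
exact: walk_closes.
Qed.

Lemma step_rev a b : step (p b) (p a) = step a b.
Proof. by rewrite /step !pK [vert b == _]eq_sym [p a == _]eq_sym. Qed.

Lemma walk_rev x s : path step x s ->
  path step (p (last x s)) (map p (rev (belast x s))).
Proof.
rewrite path_map => xs; rewrite rev_path.
by apply: sub_path xs => a b; rewrite /= step_rev.
Qed.

(** A breadth-first spanning tree with root the leaf [r]: [ups] and [downs] are
    the two orientations of its edges, and there is no circuit exactly when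
    they exhaust the half-edges. *)
Section Parent.
Variable r : 'I_n.
Hypothesis conn : forall u, connect (adj p) u (inl r).

Let reach u m := [exists s : m.-tuple ('I_n + 'I_k),
  path (adj p) u s && (last u s == inl r)].

Fact reach_ex u : exists m, reach u m.
Proof.
have /connectP[s us ls] := conn u; exists (size s).
by apply/existsP; exists (in_tuple s); rewrite us -ls /=.
Qed.

Definition depth u := ex_minn (reach_ex u).

Definition parent u : half n k := odflt (inl r)
  [pick x | (vert x == u) && (depth (vert (p x)) < depth u)].

Lemma parentP u : u != inl r ->
  vert (parent u) = u /\ depth (vert (p (parent u))) < depth u.
Proof.
move=> ur; rewrite /parent; case: pickP => [x /andP[/eqP]//|/= no].
have: reach u (depth u) by rewrite /depth; case: ex_minnP.
case/existsP => -[[|v s] sz] /=; first by rewrite (negPf ur).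
case/andP => /andP[/existsP[x /andP[/eqP xu /eqP pxv]] vs] /eqP ls.
have:= no x; rewrite xu eqxx pxv /= => /negbT; rewrite -leqNgt => le.
have: depth v <= size s.
  rewrite /depth; case: ex_minnP => m _; apply.
  by apply/existsP; exists (in_tuple s); rewrite vs -ls /=.
by move: sz; rewrite /= => /eqP; lia.
Qed.

Definition ups : {set half n k} := [set parent u | u in predC1 (inl r)].
Definition downs : {set half n k} := p @: ups.

Lemma upP x : reflect (exists2 u, u != inl r & x = parent u) (x \in ups).
Proof. by apply: (iffP imsetP) => -[u ur ->]; exists u. Qed.

Lemma mem_downs x : (x \in downs) = (p x \in ups).
Proof. by rewrite -{1}[x]pK mem_imset //; apply: can_inj pK. Qed.

Lemma up_eq x y : x \in ups -> y \in ups -> vert x = vert y -> x = y.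
Proof.
by move=> /upP[u ur ->] /upP[v vr ->]; rewrite (parentP ur).1 (parentP vr).1 => ->.
Qed.

Lemma up_depth x : x \in ups -> depth (vert (p x)) < depth (vert x).
Proof. by move=> /upP[u ur ->]; rewrite (parentP ur).1 (parentP ur).2. Qed.

Lemma ups_disjoint : [disjoint ups & downs].
Proof.
rewrite disjoint_subset; apply/subsetP => x xu; rewrite inE /= mem_downs.
by apply/negP => /up_depth; have:= up_depth xu; rewrite pK; lia.
Qed.

Lemma card_ups : #|ups :|: downs| = (n + k).-1.*2.
Proof.
rewrite cardsU (eqP (_ : ups :&: downs == set0)) ?setI_eq0 ?ups_disjoint //.
rewrite cards0 subn0 (card_imset _ (can_inj pK)).
rewrite card_in_imset => [|u v ur vr]; last first.
  by move=> /(congr1 (@vert n k)); rewrite (parentP ur).1 (parentP vr).1.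
by rewrite cardC1 card_sum !card_ord addnn.
Qed.

(** At a vertex of a circuit that is farthest from the root, both half-edges of
    the circuit lead to the parent, so the circuit turns back there. *)
Lemma covered_no_circuit : (forall x, x \in ups :|: downs) ->
  forall c, ~ circuit p c.
Proof.
move=> cov c [c0 _ cyc].
have [x0 x0c] : exists x, x \in c by case: c c0 {cyc} => // x *; exists x; rewrite inE eqxx.
have cyc' : cycle step c by [].
pose x := [arg max_(x > x0 in c) depth (vert x)].
have [xc xmax] : x \in c /\ forall y, y \in c -> depth (vert y) <= depth (vert x).
  by rewrite /x; case: arg_maxnP.
have /andP[/eqP xy _] := next_cycle cyc' xc.
have /andP[/eqP wx nwx] := prev_cycle cyc' xc.
have:= xmax (path.next c x); rewrite mem_next xc -xy => /(_ isT) dx.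
have:= xmax (path.prev c x); rewrite mem_prev xc => /(_ isT) dw.
have xu : x \in ups.
  have:= cov x; rewrite inE mem_downs => /orP[//|/up_depth]; rewrite pK; lia.
have wu : p (path.prev c x) \in ups.
  have:= cov (p (path.prev c x)); rewrite inE mem_downs pK => /orP[//|/up_depth].
  by rewrite wx; lia.
by move: nwx; rewrite (up_eq wu xu wx) eqxx.
Qed.

(** Following parents leads to the root without turning back. *)
Lemma walk_up x : x \notin downs ->
  exists2 s, path step x s & vert (p (last x s)) = inl r.
Proof.
have [m] := ubnP (depth (vert (p x))); elim: m x => // m IH x lem xd.
have [xr|xr] := eqVneq (vert (p x)) (inl r); first by exists [::].
have [py dy] := parentP xr.
have yu : parent (vert (p x)) \in ups by apply/upP; exists (vert (p x)).
have [||s ps ls] := IH (parent (vert (p x))); first by lia.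
  by apply: contraL yu => yd; rewrite (disjointFl ups_disjoint).
exists (parent (vert (p x)) :: s) => //=; rewrite ps andbT /step py eqxx /=.
by apply: contraNneq xd => e; rewrite mem_downs -e.
Qed.

(** An edge outside the spanning tree extends at both ends to walks up to the
    root; together they form a closed walk without turning back, which
    [walk_uniq] excludes. *)
Lemma no_circuit_covered : (forall c, ~ circuit p c) ->
  forall x, x \in ups :|: downs.
Proof.
move=> noc x; apply: contraT; rewrite inE mem_downs negb_or => /andP[xu xd].
have [|s xs ls] := @walk_up x; first by rewrite mem_downs.
have [|t xt lt] := @walk_up (p x); first by rewrite mem_downs pK.
have rt := walk_rev xt.
pose y := p (last (p x) t); pose w := map p (rev (belast (p x) t)) ++ s.
have lw : last y (map p (rev (belast (p x) t))) = x.
  rewrite -[RHS]pK /y; case/lastP: (t) => [|t' z] /=; first by rewrite pK.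
  by rewrite belast_rcons last_rcons rev_cons map_rcons last_rcons pK.
have yw : path step y w by rewrite cat_path rt lw.
have [_] := walk_uniq noc yw.
by rewrite last_cat lw ls map_cons inE /y lt eqxx.
Qed.

End Parent.
End Walks.

(** There are [n + 3 * k] half-edges, and twice as many as the edges of a
    spanning tree on [n + k] vertices. *)
Lemma tree_order n k (p : {ffun half n k -> half n k}) :
  is_tree p -> (0 < n)%N -> (k + 2 = n)%N.
Proof.
case=> pK pN conn noc n0; pose r := Ordinal n0.
have cr u : connect (adj p) u (inl r) by [].
have cov := no_circuit_covered pK pN cr noc.
have:= card_ups pK cr; rewrite (_ : _ :|: _ = setT); last by apply/setP => x; rewrite cov inE.
rewrite cardsT card_sum card_prod !card_ord; lia.
Qed.

(** By the same count a connected diagram with few enough edges coincides with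
    its spanning tree.  This makes connectivity the only thing to check when
    trees are modified. *)
Lemma connected_tree n k (p : {ffun half n k -> half n k}) : (k + 2 = n)%N ->
  involutive p -> (forall x, p x != x) -> (forall u v, connect (adj p) u v) ->
  is_tree p.
Proof.
move=> kn pK pN conn; have n0 : (0 < n)%N by lia.
split=> //; pose r := Ordinal n0.
have cr u : connect (adj p) u (inl r) by [].
have cH : #|{: half n k}| = (n + k).-1.*2.
  by rewrite card_sum card_prod !card_ord; lia.
suff cov : ups (p := p) cr :|: downs (p := p) cr = setT.
  by apply: (covered_no_circuit pK (r := r) (conn := cr)) => x; rewrite cov inE.
by apply/eqP; rewrite eqEcard subsetT cardsT cH (card_ups pK cr) leqnn.
Qed.

Definition Tree n k (p : {ffun half n k -> half n k}) (tp : is_tree p) : tree_on n k :=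
  exist (fun p : {ffun half n k -> half n k} => `[< is_tree p >]) p (asboolT tp).

Lemma tree_onP n k (T : tree_on n k) : is_tree (val T).
Proof. exact: asboolW (valP T). Qed.

Lemma tree_noloop n k (p : {ffun half n k -> half n k}) x : is_tree p ->
  vert (p x) != vert x.
Proof.
case=> pK pN _ noc; apply/eqP => e; apply: (noc [:: x]); split=> //=.
by rewrite e eqxx eq_sym pN.
Qed.

(** * State sums and the defining relations *)

(** Choosing the other half-edge of some of the edges changes nothing, since [f]
    takes the same value on both. *)
Lemma edge_orient (H : finType) (p : H -> H) (P o1 o2 : pred H) (f : H -> rat) :
    involutive p -> (forall y, P (p y) = P y) -> (forall y, f (p y) = f y) ->
    (forall y, P y -> o1 (p y) = ~~ o1 y) ->
    (forall y, P y -> o2 (p y) = ~~ o2 y) ->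
  \prod_(y | P y && o1 y) f y = \prod_(y | P y && o2 y) f y.
Proof.
move=> pK Pp fp o1p o2p; rewrite (bigID o2) [RHS](bigID o1) /=; congr (_ * _).
  by apply: eq_bigl => y; rewrite andbAC.
rewrite (reindex_inj (can_inj pK)) /=; apply: eq_big => // y.
by rewrite Pp; case Py: (P y) => //=; rewrite o1p ?o2p // negbK andbC.
Qed.

Definition recolor (H X : finType) (col : {ffun H -> X}) x a y a' :=
  [ffun z => if z == x then a else if z == y then a' else col z].

(** A sum over colourings vanishes if it does so whenever the colours of all
    half-edges but two are fixed. *)
Lemma sum_two_points (H X : finType) (x y : H) (F : {ffun H -> X} -> rat) :
    x != y ->
    (forall col : {ffun H -> X}, \sum_a \sum_a' F (recolor col x a y a') = 0) ->
  \sum_col F col = 0.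
Proof.
move=> xy F0; pose key (col : {ffun H -> X}) :=
  [ffun z => if (z == x) || (z == y) then None else Some (col z)].
rewrite (partition_big key xpredT) //=; apply: big1 => K _.
have [col /eqP colK|noK] := pickP (fun col => key col == K); last first.
  by rewrite big_pred0.
have keyE c z : key c = K -> z != x -> z != y -> c z = col z.
  move=> cK zx zy; have:= congr1 (fun g : {ffun H -> option X} => g z) (etrans cK (esym colK)).
  by rewrite !ffunE (negPf zx) (negPf zy) => -[].
rewrite -[RHS](F0 col) pair_big /=.
pose h (ab : X * X) := recolor col x ab.1 y ab.2.
rewrite (reindex_onto h (fun c => (c x, c y))) /=.
  apply: eq_bigl => -[a b]; rewrite !ffunE !eqxx [y == x]eq_sym (negPf xy) eqxx andbT.
  rewrite -colK; apply/eqP/ffunP => z; rewrite !ffunE.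
  by case: (z == x); case: (z == y).
move=> c /eqP cK; apply/ffunP => z; rewrite !ffunE /=.
by case: eqP => [->|/eqP zx] //; case: eqP => [->|/eqP zy] //; rewrite -(keyE c).
Qed.

Notation o0 := (@Ordinal 3 0 isT).
Notation o1 := (@Ordinal 3 1 isT).
Notation o2 := (@Ordinal 3 2 isT).

Lemma ordS0 : ordS o0 = o1. Proof. exact: val_inj. Qed.
Lemma ordS1 : ordS o1 = o2. Proof. exact: val_inj. Qed.
Lemma ordS2 : ordS o2 = o0. Proof. exact: val_inj. Qed.
Definition ordSE := (ordS0, ordS1, ordS2).

Lemma ord3P (P : 'I_3 -> Prop) : P o0 -> P o1 -> P o2 -> forall i, P i.
Proof.
move=> P0 P1 P2 [[|[|[|//]]] i3].
- by rewrite (_ : Ordinal i3 = o0) //; apply: val_inj.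
- by rewrite (_ : Ordinal i3 = o1) //; apply: val_inj.
- by rewrite (_ : Ordinal i3 = o2) //; apply: val_inj.
Qed.

Lemma next3 n k (x : half n k) : next (next (next x)) = x.
Proof. by case: x => [//|[v]]; elim/ord3P; rewrite /= !ordSE. Qed.

Lemma next_inj n k : injective (@next n k).
Proof. by move=> x y /(congr1 (@next n k))/(congr1 (@next n k)); rewrite !next3. Qed.

Lemma vert_next n k (x : half n k) : vert (next x) = vert x.
Proof. by case: x => [|[]]. Qed.

Lemma next_neq n k v (i : 'I_3) : next (inr (v, i) : half n k) != inr (v, i).
Proof. by elim/ord3P: i; rewrite /= !ordSE; apply/eqP => -[]. Qed.

Lemma next2_neq n k v (i : 'I_3) :
  next (next (inr (v, i) : half n k)) != inr (v, i).
Proof. by elim/ord3P: i; rewrite /= !ordSE; apply/eqP => -[]. Qed.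

Lemma vertE n k (x y : half n k) : vert x = vert y ->
  [\/ y = x, y = next x | y = next (next x)].
Proof.
case: x y => [i|[v i]] [j|[w j]] //= [] <-; first by constructor 1.
by elim/ord3P: i; elim/ord3P: j; rewrite /= ?ordSE;
  solve [constructor 1 => // | constructor 2 => // | constructor 3 => //].
Qed.

Section StateSum.
Variables (X : finType) (b : X -> X -> X -> rat) (kap : X -> X -> rat).
Hypotheses (bC : forall x y z, b y z x = b x y z)
  (bN : forall x y z, b x z y = - b x y z)
  (kapC : forall x y, kap x y = kap y x)
  (jacobi : forall c1 c2 d1 d2, \sum_a \sum_a' kap a a' *
     (b a c1 c2 * b a' d1 d2 + b a c2 d1 * b a' c1 d2 + b a d1 c1 * b a' c2 d2)
     = 0).

Section Fixed.
Variables n k : nat.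
Implicit Types (p q r : {ffun half n k -> half n k}) (col : {ffun half n k -> X}).
Local Notation hf := (half n k).

Definition fits p (x : 'I_n -> X) : pred {ffun hf -> X} :=
  fun col => [forall j, (col (inl j) == x j) && (col (p (inl j)) == x j)].

Definition verts col := \prod_(v < k) b (col (inr (v, o0))) (col (inr (v, o1)))
  (col (inr (v, o2))).

Definition edges p col :=
  \prod_(y | internal p y && (enum_rank y < enum_rank (p y))%N)
     kap (col y) (col (p y)).

(** The weight system of a Lie algebra with invariant metric [kap], where [b] is
    the bracket as a cyclic 3-tensor.  The weight [beta] of the vertices is
    arbitrary, because renaming half-edges turns one diagram with weight
    [verts] into another diagram with a different weight. *)
Definition state p (beta : {ffun hf -> X} -> rat) (x : 'I_n -> X) :=
  \sum_(col | fits p x col) beta col * edges p col.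

Lemma internal_p p y : involutive p -> internal p (p y) = internal p y.
Proof. by move=> pK; rewrite /internal pK; case: y (p y) => [?|?] [?|?]. Qed.

Lemma edges_orient p col (o : pred hf) : involutive p ->
    (forall y, p y != y) -> (forall y, internal p y -> o (p y) = ~~ o y) ->
  edges p col = \prod_(y | internal p y && o y) kap (col y) (col (p y)).
Proof.
move=> pK pN op; apply: (edge_orient (p := p)) => // y.
- exact: internal_p.
- by rewrite pK kapC.
move=> _; rewrite pK -leqNgt [RHS]leq_eqVlt; case: eqP => // /val_inj/enum_rank_inj/eqP.
by rewrite (negPf (pN y)).
Qed.

(** Colourings are renamed together with the half-edges, and edges keep their
    weights; so only the vertex weight and the labels of the leaves change.
    Invariance under isomorphism, AS and IHX are all read off from this. *)
Lemma state_conj p q (s s' : hf -> hf) (sg : {perm 'I_n}) beta x :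
    involutive p -> (forall y, p y != y) ->
    cancel s s' -> cancel s' s -> (forall i, s (inl i) = inl (sg i)) ->
    (forall y, q (s y) = s (p y)) ->
  state q beta x = state p (fun col => beta [ffun y => col (s' y)]) (x \o sg).
Proof.
move=> pK pN sK s'K sl qs; rewrite /state.
pose h (col : {ffun hf -> X}) := [ffun y => col (s' y)].
pose h' (col : {ffun hf -> X}) := [ffun y => col (s y)].
have hK : cancel h' h by move=> c; apply/ffunP => y; rewrite !ffunE s'K.
have h'K : cancel h h' by move=> c; apply/ffunP => y; rewrite !ffunE sK.
rewrite (reindex h) /=; last by exists h' => c _.
apply: eq_big => [col|col _].
  apply/forallP/forallP => H i.
    by have:= H (sg i); rewrite !ffunE -sl qs !sK.
  have ei : inl i = s (inl ((sg^-1)%g i)) by rewrite sl permKV.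
  by have:= H ((sg^-1)%g i); rewrite /= permKV ei qs !ffunE !sK.
congr (_ * _); rewrite /edges.
have internal_s y : internal q (s y) = internal p y.
  rewrite /internal qs.
  have isl z : (if s z is inl _ then true else false) = (if z is inl _ then true else false).
    case: z => [i|u]; first by rewrite sl.
    case su: (s (inr u)) => [j|//].
    by have:= congr1 s' su; rewrite sK -(permKV sg j) -sl sK.
  have:= isl y; have:= isl (p y).
  by case: y (p y) (s y) (s (p y)) => [?|?] [?|?] [?|?] [?|?].
rewrite (reindex s) /=; last by exists s' => y _.
have -> : \prod_(y | internal q (s y) && (enum_rank (s y) < enum_rank (q (s y)))%N)
     kap (h col (s y)) (h col (q (s y)))
  = \prod_(y | internal p y && (enum_rank (s y) < enum_rank (s (p y)))%N)
     kap (col y) (col (p y)).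
  by apply: eq_big => y; rewrite internal_s qs // !ffunE !sK.
symmetry; apply: edges_orient => // y _.
rewrite pK -leqNgt [RHS]leq_eqVlt; case: eqP => // /val_inj/enum_rank_inj/(can_inj sK)/eqP.
by rewrite (negPf (pN y)).
Qed.

Lemma verts_at col (x : hf) v : vert x = inr v ->
  b (col (inr (v, o0))) (col (inr (v, o1))) (col (inr (v, o2)))
  = b (col x) (col (next x)) (col (next (next x))).
Proof. by case: x => [//|[w]] i [->]; elim/ord3P: i; rewrite /= !ordSE // bC. Qed.

Lemma state_ext p beta beta' x : beta =1 beta' ->
  state p beta x = state p beta' x.
Proof. by move=> e; apply: eq_bigr => col _; rewrite e. Qed.

Lemma state_iso p q s x : involutive p -> (forall y, p y != y) ->
    is_iso s -> (forall y, q (s y) = s (p y)) ->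
  state q verts x = state p verts x.
Proof.
move=> pK pN [[s' sK s'K] sl sn] qs.
rewrite (state_conj (sg := 1%g) _ _ pK pN sK s'K) //; last first.
  by move=> i; rewrite perm1.
have -> : x \o (1%g : {perm 'I_n}) = x by apply/funext => i; rewrite /= perm1.
apply: state_ext => col.
have sr u : exists w, s' (inr u) = inr w.
  case su: (s' (inr u)) => [i|w]; last by exists w.
  by have:= congr1 s su; rewrite s'K sl.
have s'n y : s' (next y) = next (s' y) by apply: (can_inj sK); rewrite s'K sn s'K.
pose pi (v : 'I_k) := if s' (inr (v, o0)) is inr (w, _) then w else v.
have piE v : vert (s' (inr (v, o0))) = inr (pi v).
  by rewrite /pi; have [[w i] ->] := sr (v, o0).
have pi_inj : injective pi.
  move=> v v' e; have:= piE v; rewrite e -piE => /esym/vertE.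
  rewrite -!s'n => -[] /(congr1 s); rewrite !s'K /= ?ordSE => -[]//.
rewrite /verts [RHS](reindex_inj pi_inj) /=; apply: eq_bigr => v _.
rewrite (verts_at _ (piE v)) !ffunE -!s'n /= !ordSE //.
Qed.

Lemma reverse_inl (u : 'I_k * 'I_3) i : reverse (inr u : hf) (inl i) = inl i.
Proof. by rewrite /reverse tpermD //; case: u. Qed.

(** The reversal exchanges two arguments of [b] at a single vertex. *)
Lemma state_AS p q u x : involutive p -> (forall y, p y != y) ->
    (forall y, q (reverse (inr u) y) = reverse (inr u) (p y)) ->
  state q verts x = - state p verts x.
Proof.
move=> pK pN qs; pose s := reverse (inr u : hf).
have sK : cancel s s by apply: tpermK.
rewrite (state_conj (sg := 1%g) _ _ pK pN sK sK) //; last first.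
  by move=> i; rewrite perm1 /s reverse_inl.
have -> : x \o (1%g : {perm 'I_n}) = x by apply/funext => i; rewrite /= perm1.
rewrite /state -sumrN; apply: eq_bigr => col _; rewrite -mulNr; congr (_ * _).
case: u @s qs sK => v i s qs sK.
rewrite /verts (bigD1 v) //= [in RHS](bigD1 v) //= -mulNr; congr (_ * _).
  rewrite !(verts_at _ (x := inr (v, i)) (v := v)) // !ffunE.
  rewrite /s /reverse tpermL tpermR tpermD 1?bN //; first exact: next_neq.
  exact: next2_neq.
apply: eq_bigr => w wv; rewrite !ffunE /s /reverse.
by rewrite !tpermD //=; apply: contraNneq wv => -[] ->.
Qed.

(** By [state_conj] the three sums are sums over the same diagram [p], with
    vertex weights that differ only at the ends of the edge; summed over the
    colours of this edge they are the terms of the Jacobi identity. *)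
Lemma state_IHX p q r u v x : involutive p -> (forall y, p y != y) ->
    vert (inr u : hf) != vert (inr v : hf) -> p (inr u) = inr v ->
    (forall y, q (rotate (inr u) (inr v) y) = rotate (inr u) (inr v) (p y)) ->
    (forall y, r (rotate (inr u) (inr v) y) = rotate (inr u) (inr v) (q y)) ->
  state p verts x + state q verts x + state r verts x = 0.
Proof.
case: u v => u i [v j]; set xu := inr (u, i) : hf; set xv := inr (v, j) : hf.
move=> pK pN uv puv qs rs.
pose s := rotate (xu) xv.
pose s' : hf -> hf := tperm (next xu) (next (next xu))
  \o tperm (next (next xu)) (next xv).
have sK : cancel s s' by move=> y; rewrite /s /s' /rotate /= !tpermK.
have s'K : cancel s' s by move=> y; rewrite /s /s' /rotate /= !tpermK.
have sl i0 : s (inl i0) = inl ((1%g : {perm 'I_n}) i0).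
  by rewrite perm1 /s /rotate /= !tpermD //; case: (u) => ? ?; case: (v) => ? ?.
have qK : involutive q.
  by move=> y; rewrite -[y]s'K !qs pK.
have qN y : q y != y.
  by rewrite -[y]s'K qs (inj_eq (can_inj sK)).
have x1 : x \o (1%g : {perm 'I_n}) = x by apply/funext => i0; rewrite /= perm1.
rewrite (state_conj _ _ qK qN sK s'K sl rs) !(state_conj _ _ pK pN sK s'K sl qs) !x1.
rewrite /state -!big_split /= big_mkcond /=.
have uvi : (xu) != xv by apply: contraNneq uv => ->.
apply: (sum_two_points uvi) => col.
pose upd a a' := recolor col xu a xv a'.
change (\sum_a \sum_a' (if fits p x (upd a a') then verts (upd a a') * edges p (upd a a')
  + verts [ffun y => upd a a' (s' y)] * edges p (upd a a')
  + verts [ffun y => [ffun z => upd a a' (s' z)] (s' y)] * edges p (upd a a') else 0) = 0).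
have fitsE a a' : fits p x (upd a a') = fits p x col.
  apply: eq_forallb => j0; rewrite !ffunE /=.
  have -> : (p (inl j0) == xu) = false.
    by apply/eqP => /(congr1 p); rewrite pK puv.
  have -> : (p (inl j0) == xv) = false.
    by apply/eqP => /(congr1 p); rewrite pK -puv pK.
  by [].
case fc: (fits p x col); last first.
  by rewrite big1 // => a _; rewrite big1 // => a' _; rewrite fitsE fc.
(* Represent the edge by x, so that its weight can be split off. *)
pose o : pred hf := fun y => if y == xu then true else
  if y == xv then false else (enum_rank y < enum_rank (p y))%N.
have op y : internal p y -> o (p y) = ~~ o y.
  move=> _; rewrite /o.
  have e1 : (p y == xu) = (y == xv).
    by rewrite -puv (inv_eq pK).
  have e2 : (p y == xv) = (y == xu).
    by rewrite -puv (inj_eq (can_inj pK)).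
  rewrite e1 e2; have [->|yu] := eqVneq y xu; first by rewrite (negPf uvi).
  have [//|yv] := eqVneq y xv.
  rewrite pK -leqNgt [RHS]leq_eqVlt; case: eqP => // /val_inj/enum_rank_inj/eqP.
  by rewrite (negPf (pN y)).
pose R := \prod_(y | (internal p y && o y) && (y != xu)) kap (col y) (col (p y)).
have edgesE a a' : edges p (upd a a') = kap a a' * R.
  rewrite (edges_orient _ pK pN op) (bigD1 xu) /=; last first.
    by rewrite /internal puv /o eqxx /xu /xv.
  rewrite puv !ffunE eqxx eq_sym (negPf uvi) eqxx; congr (_ * _).
  apply: eq_bigr => y /andP[/andP[_ oy] yu].
  have yv : y != xv by apply: contraTneq oy => ->; rewrite /o eq_sym (negPf uvi) eqxx.
  rewrite !ffunE (negPf yu) (negPf yv).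
  have -> : (p y == xu) = false by rewrite (inv_eq pK) puv (negPf yv).
  by have -> : (p y == xv) = false by rewrite -puv (inj_eq (can_inj pK)) (negPf yu).
have uv' : u != v by apply: contraNneq uv => e; rewrite /= e.
pose S := \prod_(w | (w != u) && (w != v)) b (col (inr (w, o0)))
   (col (inr (w, o1))) (col (inr (w, o2))).
have vertsE (c : {ffun hf -> X}) :
    (forall w t, w != u -> w != v -> c (inr (w, t)) = col (inr (w, t))) ->
    verts c = b (c xu) (c (next xu)) (c (next (next xu)))
      * b (c xv) (c (next xv)) (c (next (next xv))) * S.
  move=> ce; rewrite /verts (bigD1 u) //= (bigD1 v) 1?eq_sym //= mulrA.
  rewrite -(verts_at c (x := xu) (v := u)) // -(verts_at c (x := xv) (v := v)) //; congr (_ * _).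
  by apply: eq_bigr => w /andP[wu wv]; rewrite !ce.
have ne (A B : 'I_3) : (inr (u, A) == inr (v, B) :> hf) = false.
  by apply/eqP => -[e]; rewrite e eqxx in uv'.
have ne' (A B : 'I_3) : (inr (v, A) == inr (u, B) :> hf) = false.
  by rewrite eq_sym ne.
have s'o w t : w != u -> w != v -> s' (inr (w, t)) = inr (w, t).
  move=> wu wv; rewrite /s' /= !tpermD //;
  by [apply/eqP => -[e]; rewrite e eqxx in wu | apply/eqP => -[e]; rewrite e eqxx in wv].
have ii : (ordS i == i) = false by elim/ord3P: (i).
have iii : (ordS (ordS i) == i) = false by elim/ord3P: (i).
have iiii : (ordS (ordS i) == ordS i) = false by elim/ord3P: (i).
have jj : (ordS j == j) = false by elim/ord3P: (j).
have jjj : (ordS (ordS j) == j) = false by elim/ord3P: (j).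
have jjjj : (ordS (ordS j) == ordS j) = false by elim/ord3P: (j).
have inrE (A B : 'I_k * 'I_3) : (inr A == inr B :> hf) = (A == B) by [].
have su : s' xu = xu.
  by rewrite /s' /= !tpermD // ?ne' // inrE xpair_eqE ?ii ?iii andbF.
have sv : s' xv = xv.
  by rewrite /s' /= !tpermD // ?ne // inrE xpair_eqE ?jj ?jjj andbF.
have s1 : s' (next xu) = next (next xu).
  rewrite /s' /= (tpermD (z := inr (u, ordS i))) ?tpermL // ?ne' //.
  by rewrite inrE xpair_eqE iiii andbF.
have s2 : s' (next (next xu)) = next xv.
  by rewrite /s' /= tpermL tpermD // ne.
have s3 : s' (next xv) = next xu by rewrite /s' /= tpermR tpermR.
have s4 : s' (next (next xv)) = next (next xv).
  by rewrite /s' /= !tpermD // ?ne // inrE xpair_eqE eq_sym jjjj andbF.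
have J := jacobi (col (next xu)) (col (next (next xu))) (col (next xv))
  (col (next (next xv))).
apply: etrans (etrans (congr1 (fun t => R * S * t) J) (mulr0 _)).
rewrite mulr_sumr.
apply: eq_bigr => a _; rewrite mulr_sumr; apply: eq_bigr => a' _.
rewrite fitsE fc edgesE.
rewrite !vertsE; try by move=> w t wu wv;
  rewrite !ffunE ?s'o // !inrE !xpair_eqE (negPf wu) (negPf wv).
rewrite !(ffunE, su, sv, s1, s2, s3, s4) /=.
rewrite !inrE !xpair_eqE !eqxx /= ?ii ?iii ?iiii ?jj ?jjj ?jjjj.
rewrite [v == u]eq_sym (negPf uv') /=.
ring.
Qed.

End Fixed.
End StateSum.
Arguments verts {X} b {n k} col.

Section StateLift.
Variables (X : finType) (b : X -> X -> X -> rat) (kap : X -> X -> rat).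
Hypotheses (bC : forall x y z, b y z x = b x y z)
  (bN : forall x y z, b x z y = - b x y z)
  (kapC : forall x y, kap x y = kap y x)
  (jacobi : forall c1 c2 d1 d2, \sum_a \sum_a' kap a a' *
     (b a c1 c2 * b a' d1 d2 + b a c2 d1 * b a' c1 d2 + b a d1 c1 * b a' c2 d2)
     = 0).
Variables (n k : nat).
Implicit Types p q r : tree_on n k.

Lemma state_rel_iso p q s x : is_iso s -> relabels s p q ->
  state kap (val p) (verts b) x = state kap (val q) (verts b) x.
Proof.
move=> si re; have [pK pN _ _] := tree_onP p.
by rewrite (state_iso bC kapC x pK pN si re).
Qed.

Lemma state_rel_AS p q v x : relabels (reverse (inr v)) p q ->
  state kap (val p) (verts b) x + state kap (val q) (verts b) x = 0.
Proof.
move=> re; have [pK pN _ _] := tree_onP p.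
by rewrite (state_AS bC bN kapC x pK pN re) subrr.
Qed.

Lemma state_rel_IHX p q r u v x : val p (inr u) = inr v ->
    relabels (rotate (inr u) (inr v)) p q ->
    relabels (rotate (inr u) (inr v)) q r ->
  state kap (val p) (verts b) x + state kap (val q) (verts b) x
    + state kap (val r) (verts b) x = 0.
Proof.
move=> puv pq qr; have [pK pN _ _] := tree_onP p.
apply: (state_IHX bC kapC jacobi x pK pN _ puv pq qr).
by rewrite -puv eq_sym tree_noloop //; apply: tree_onP.
Qed.

End StateLift.

(** * Renaming half-edges and grafting *)

Lemma inl_eqE (A B : eqType) (x y : A) : (inl x == inl y :> A + B) = (x == y).
Proof. by []. Qed.

Lemma inr_eqE (A B : eqType) (x y : B) : (inr x == inr y :> A + B) = (x == y).
Proof. by []. Qed.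

Section Connectivity.
Variables (n k : nat) (p : half n k -> half n k).

Lemma adj_edge x : adj p (vert x) (vert (p x)).
Proof. by apply/existsP; exists x; rewrite !eqxx. Qed.

Lemma connect_adj_sym : involutive p -> connect_sym (adj p).
Proof.
move=> pK; apply: symmetric_from_pre => u v /connectP[s us ->] {v}.
elim: s u us => [|v s IH] u /=; first by rewrite connect0.
case/andP=> /existsP[x /andP[/eqP <- /eqP <-]] /IH c.
apply: connect_trans c (connect1 _).
by have:= adj_edge (p x); rewrite pK.
Qed.

Lemma connect_map_adj (W : finType) (e : rel W) (f : 'I_n + 'I_k -> W) u v :
    (forall x, connect e (f (vert x)) (f (vert (p x)))) ->
  connect (adj p) u v -> connect e (f u) (f v).
Proof.
move=> ef /connectP[s us ->] {v}; elim: s u us => [|v s IH] u /=; first by rewrite connect0.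
by case/andP=> /existsP[x /andP[/eqP <- /eqP <-]] /IH; apply: connect_trans.
Qed.
End Connectivity.

Section Conjugate.
Variables (n k : nat).
Implicit Types p : {ffun half n k -> half n k}.

Definition conj (s : {perm half n k}) p : {ffun half n k -> half n k} :=
  [ffun x => s (p ((s^-1)%g x))].

Lemma conjE s p x : conj s p (s x) = s (p x).
Proof. by rewrite ffunE permK. Qed.

(** Renaming keeps the number of half-edges, so by [connected_tree] only
    connectivity matters.  The map [f] says which vertex replaces which; a
    renaming may tear vertices apart as long as the parts stay connected. *)
Lemma conj_tree s p (f : 'I_n + 'I_k -> 'I_n + 'I_k) : (0 < n)%N ->
    is_tree p -> (forall u, exists v, u = f v) ->
    (forall x, connect (adj (conj s p)) (f (vert x)) (vert (s x))) ->
  is_tree (conj s p).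
Proof.
move=> n0 tp fs fv; have kn := tree_order tp n0; case: tp => pK pN conn _.
have qK : involutive (conj s p).
  by move=> x; rewrite -[x](permKV s) !conjE pK.
apply: connected_tree => // [x|u v].
  by rewrite -[x](permKV s) conjE (inj_eq perm_inj).
have [u' ->] := fs u; have [v' ->] := fs v.
apply: (connect_map_adj (p := p)) => // x.
apply: connect_trans (fv x) _.
have := fv (p x); rewrite (connect_adj_sym qK) -conjE.
by apply: connect_trans; apply/connect1/adj_edge.
Qed.

Definition leaf_map (sg : {perm 'I_n}) (x : half n k) : half n k :=
  if x is inl i then inl (sg i) else x.

Fact leaf_map_inj sg : injective (leaf_map sg).
Proof. by move=> [i|u] [j|v] //= [] // /perm_inj ->. Qed.

Definition leaf_perm sg := perm (@leaf_map_inj sg).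

Lemma leaf_perm_tree sg p : (0 < n)%N -> is_tree p ->
  is_tree (conj (leaf_perm sg) p).
Proof.
move=> n0 tp.
apply: (@conj_tree _ _ (fun u => if u is inl i then inl (sg i) else u)) => //.
  by move=> [i|v]; [exists (inl ((sg^-1)%g i)); rewrite permKV | exists (inr v)].
by move=> x; rewrite permE; case: x => [i|[v i]] /=; apply: connect0.
Qed.

End Conjugate.

Definition relabel n k sg (T : tree_on n.+1 k) : tree_on n.+1 k :=
  Tree (leaf_perm_tree sg (ltn0Sn n) (tree_onP T)).

Section Graft.
Variables (n k : nat).
Local Notation hf := (half n.+1 k).
Local Notation hf' := (half n.+2 k.+1).

(** The new trivalent vertex takes the place of the last leaf, so that [emb]
    commutes with the edge involutions. *)
Definition emb (x : hf) : hf' :=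
  match x with
  | inl i => if i == ord_max then inr (ord_max, o0) else inl (lift ord_max i)
  | inr (v, i) => inr (lift ord_max v, i)
  end.

Definition unemb (x : hf') : option hf :=
  match x with
  | inl i => if unlift ord_max i is Some j then
      if j == ord_max then None else Some (inl j) else None
  | inr (v, i) => if unlift ord_max v is Some w then Some (inr (w, i)) else
      if i == o0 then Some (inl ord_max) else None
  end.

Definition newleaf1 : 'I_n.+2 := lift ord_max ord_max.
Definition newleaf2 : 'I_n.+2 := ord_max.

Definition graft_fun (p : hf -> hf) (x : hf') : hf' :=
  if unemb x is Some y then emb (p y) else
  match x with
  | inl i => if i == ord_max then inr (ord_max, o2) else inr (ord_max, o1)
  | inr (_, i) => if i == o1 then inl newleaf1 else inl newleaf2
  end.

Lemma embK y : unemb (emb y) = Some y.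
Proof.
case: y => [i|[v i]] /=; last by rewrite liftK.
by case: eqP => [->|ni] /=; rewrite ?unlift_none // liftK; case: eqP.
Qed.

Lemma emb_inj : injective emb.
Proof. by move=> x y /(congr1 unemb); rewrite !embK => -[]. Qed.

Lemma graft_ind (P : hf' -> Prop) : (forall y, P (emb y)) ->
    P (inl newleaf1) -> P (inl newleaf2) -> P (inr (ord_max, o1)) ->
    P (inr (ord_max, o2)) -> forall x, P x.
Proof.
move=> Pe P1 P2 P3 P4 [i|[v i]].
  case: (unliftP ord_max i) => [j ->|->] //.
  have [->//|jm] := eqVneq j ord_max.
  by have:= Pe (inl j); rewrite /= (negPf jm).
case: (unliftP ord_max v) => [w ->|->] //; first by have:= Pe (inr (w, i)).
by elim/ord3P: i => //; have:= Pe (inl ord_max); rewrite /= eqxx.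
Qed.

Variable p : {ffun hf -> hf}.
Definition graft_ffun : {ffun hf' -> hf'} := [ffun x => graft_fun p x].
Local Notation q := graft_ffun.

Lemma graft_emb y : q (emb y) = emb (p y).
Proof. by rewrite ffunE /graft_fun embK. Qed.
Lemma graft_leaf1 : q (inl newleaf1) = inr (ord_max, o1).
Proof. by rewrite ffunE /graft_fun /= liftK eqxx -(inj_eq val_inj) /= /bump ltnn; case: eqP => //; lia. Qed.
Lemma graft_leaf2 : q (inl newleaf2) = inr (ord_max, o2).
Proof. by rewrite ffunE /graft_fun /= unlift_none eqxx. Qed.
Lemma graft_vert1 : q (inr (ord_max, o1)) = inl newleaf1.
Proof. by rewrite ffunE /graft_fun /= unlift_none. Qed.
Lemma graft_vert2 : q (inr (ord_max, o2)) = inl newleaf2.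
Proof. by rewrite ffunE /graft_fun /= unlift_none. Qed.
Definition graftE := (graft_emb, graft_leaf1, graft_leaf2, graft_vert1, graft_vert2).

Lemma graft_involutive : involutive p -> involutive q.
Proof.
by move=> pK; elim/graft_ind => [y||||]; rewrite !graftE ?pK.
Qed.

Lemma graft_neq : (forall y, p y != y) -> forall y, q y != y.
Proof.
move=> pN; elim/graft_ind => [y||||]; rewrite !graftE //.
by rewrite (inj_eq emb_inj).
Qed.

Definition embv (u : 'I_n.+1 + 'I_k) : 'I_n.+2 + 'I_k.+1 :=
  match u with
  | inl i => if i == ord_max then inr ord_max else inl (lift ord_max i)
  | inr v => inr (lift ord_max v)
  end.

Lemma vert_emb y : vert (emb y) = embv (vert y).
Proof. by case: y => [i|[v i]] //=; case: eqP. Qed.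

Lemma graft_tree : is_tree p -> is_tree q.
Proof.
move=> tp; have kn := tree_order tp (ltn0Sn n); case: tp => pK pN conn _.
have qK := graft_involutive pK.
apply: connected_tree => //; [lia | exact: graft_neq |].
have ce u v : connect (adj q) (embv u) (embv v).
  apply: connect_map_adj (conn u v) => x.
  by apply: connect1; rewrite -!vert_emb -graft_emb adj_edge.
have cx x : connect (adj q) (inr ord_max) (vert x).
  elim/graft_ind: x => [y||||]; try exact: connect0.
  - by have:= ce (inl ord_max) (vert y); rewrite /= eqxx vert_emb.
  - by have:= adj_edge q (inr (ord_max, o1)); rewrite graftE => /connect1.
  - by have:= adj_edge q (inr (ord_max, o2)); rewrite graftE => /connect1.
have cm v : connect (adj q) (inr ord_max) v.
  by case: v => [i|w]; [have:= cx (inl i) | have:= cx (inr (w, o0))].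
move=> u v; apply: connect_trans (cm v).
rewrite (connect_adj_sym qK); exact: cm.
Qed.

Section GraftState.
Variables (X : finType) (b : X -> X -> X -> rat) (kap : X -> X -> rat).
Hypothesis kapC : forall x y, kap x y = kap y x.

Definition old_colours (x : 'I_n.+2 -> X) w : 'I_n.+1 -> X :=
  fun i => if i == ord_max then w else x (lift ord_max i).

(** The half-edge joined to the old last leaf keeps its colour [w']; across the
    new internal edge it meets a half-edge of the new vertex coloured [w]. *)
Lemma state_graft x : involutive p -> (forall y, p y != y) ->
    (if p (inl ord_max) is inr _ then true else false) ->
  state kap q (verts b) x = \sum_w' state kap p (verts b) (old_colours x w') *
    \sum_w kap w w' * b w (x newleaf1) (x newleaf2).
Proof.
move=> pK pN pm; pose m := inl ord_max : hf.
have qK := graft_involutive pK.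
pose F (col : {ffun hf -> X}) w := verts b col * edges kap p col *
   (kap w (col m) * b w (x newleaf1) (x newleaf2)).
pose fit (col : {ffun hf -> X}) := fits p (old_colours x (col m)) col.
transitivity (\sum_(cw : {ffun hf -> X} * X | fit cw.1) F cw.1 cw.2); last first.
  have -> : \sum_(cw : {ffun hf -> X} * X | fit cw.1) F cw.1 cw.2 =
      \sum_(col | fit col) \sum_w F col w.
    by rewrite pair_big; apply: eq_bigl => cw; rewrite andbT.
  rewrite (partition_big (fun col : {ffun hf -> X} => col m) xpredT) //=.
  apply: eq_bigr => w' _; rewrite big_distrl /=; apply: eq_big => [col|col].
    apply/andP/idP => [[fc /eqP <-]//|fc].
    suff e : col m = w' by rewrite /fit e eqxx.
    by have /forallP/(_ ord_max)/andP[/eqP -> _] := fc; rewrite /old_colours eqxx.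
  move=> /andP[_ /eqP <-]; rewrite mulr_sumr; apply: eq_bigr => w _.
  by rewrite /F.
(* Colourings of the graft amount to a colour for the root of the new vertex
   and a colouring of the old diagram, copied at the last leaf. *)
pose ext (cw : {ffun hf -> X} * X) : {ffun hf' -> X} := [ffun z =>
  if unemb z is Some y then (if y == m then cw.2 else cw.1 y) else
  match z with
  | inl i => x i
  | inr (_, i) => if i == o1 then x newleaf1 else x newleaf2
  end].
pose res (c : {ffun hf' -> X}) : {ffun hf -> X} * X :=
  ([ffun y => if y == m then c (emb (p m)) else c (emb y)], c (emb m)).
have ext_emb cw y : ext cw (emb y) = if y == m then cw.2 else cw.1 y.
  by rewrite ffunE embK.
have ext1 cw : ext cw (inl newleaf1) = x newleaf1.
  by rewrite ffunE /= liftK eqxx.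
have ext2 cw : ext cw (inl newleaf2) = x newleaf2.
  by rewrite ffunE /= unlift_none.
have ext3 cw : ext cw (inr (ord_max, o1)) = x newleaf1.
  by rewrite ffunE /= unlift_none.
have ext4 cw : ext cw (inr (ord_max, o2)) = x newleaf2.
  by rewrite ffunE /= unlift_none.
have extE := (ext_emb, ext1, ext2, ext3, ext4).
have pmm : (p m == m) = false by apply/negbTE.
rewrite /state (reindex_onto ext res) /=; last first.
  move=> c /forallP fc; apply/ffunP => z.
  have f1 := fc newleaf1; have f2 := fc newleaf2; rewrite !graftE in f1 f2.
  case/andP: f1 => /eqP f1 /eqP f1'; case/andP: f2 => /eqP f2 /eqP f2'.
  elim/graft_ind: z => [y||||]; rewrite !extE //= ffunE.
  by case: eqP => [->|].
apply: eq_big => [[col w]|[col w]] /=.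
  apply/andP/idP => [[/forallP fc /eqP ce]|/forallP fc].
    have cm : col m = col (p m).
      by have:= congr1 (fun cw : {ffun hf -> X} * X => cw.1 m) ce; rewrite /= ffunE eqxx extE pmm.
    apply/forallP => i; rewrite /old_colours; have [->|im] := eqVneq i ord_max.
      by rewrite -/m -cm eqxx.
    have:= fc (lift ord_max i).
    have -> : inl (lift ord_max i) = emb (inl i) by rewrite /= (negPf im).
    rewrite graftE !extE /m inl_eqE (negPf im).
    have -> : (p (inl i) == inl ord_max) = false.
      by apply/eqP => e; move: pm; rewrite -e pK.
    by [].
  have cm : col (p m) = col m.
    by have /andP[_ /eqP] := fc ord_max; rewrite /old_colours eqxx.
  split; last first.
    apply/eqP; congr (_, _); last by rewrite extE eqxx.
    by apply/ffunP => y; rewrite !(ffunE, extE) pmm; case: eqP => [->|].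
  apply/forallP => i; case: (unliftP ord_max i) => [j ->|->]; last first.
    by rewrite !graftE !extE !eqxx.
  have [->|jm] := eqVneq j ord_max; first by rewrite !graftE !extE !eqxx.
  have -> : inl (lift ord_max j) = emb (inl j) by rewrite /= (negPf jm).
  rewrite graftE !extE /m inl_eqE (negPf jm).
  have -> : (p (inl j) == inl ord_max) = false.
    by apply/eqP => e; move: pm; rewrite -e pK.
  by have:= fc j; rewrite /old_colours (negPf jm).
case/andP => /forallP fc /eqP ce.
have cm : col m = col (p m).
  by have:= congr1 (fun cw : {ffun hf -> X} * X => cw.1 m) ce; rewrite /= ffunE eqxx extE pmm.
have vertsE : verts b (ext (col, w)) = verts b col * b w (x newleaf1) (x newleaf2).
  rewrite /verts big_ord_recr /=; congr (_ * _).
    apply: eq_bigr => v _.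
    have -> : widen_ord (leqnSn k) v = lift ord_max v.
      by apply: val_inj; rewrite /= /bump leqNgt ltn_ord.
    have e t : inr (lift ord_max v, t) = emb (inr (v, t)) by [].
    by rewrite !e !extE.
  have -> : inr (ord_max, o0) = emb m by rewrite /= eqxx.
  by rewrite !extE eqxx.
have im y : internal q (emb y) = (if y == m then true else if y == p m then true else internal p y).
  rewrite /internal graftE.
  have [->|ym] := eqVneq y m.
    by rewrite /= eqxx; case: (p m) pm => // -[].
  have [->|ypm] := eqVneq y (p m).
    by rewrite pK /= eqxx; case: (p m) pm => // -[].
  have pym : p y != m by rewrite (inv_eq pK).
  case: y ym ypm pym => [i|[v i]] ym ypm; last first.
    case: (p (inr (v, i))) => [j|[w' j]] //=.
    by rewrite inl_eqE => /negPf ->.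
  move: ym; rewrite inl_eqE /= => /negPf -> //.
(* The new edge is represented by its end at the new vertex. *)
pose o : pred hf := fun y => if y == m then true else
  if y == p m then false else (enum_rank y < enum_rank (p y))%N.
have op y : o (p y) = ~~ o y.
  rewrite /o (inj_eq (can_inj pK)) (inv_eq pK).
  have [->|ym] := eqVneq y m; first by rewrite eq_sym pmm.
  have [//|ypm] := eqVneq y (p m).
  rewrite pK -leqNgt [RHS]leq_eqVlt; case: eqP => // /val_inj/enum_rank_inj/eqP.
  by rewrite (negPf (pN y)).
pose o' : pred hf' := fun z => if unemb z is Some y then o y else
  (enum_rank z < enum_rank (q z))%N.
have qN := graft_neq pN.
have op' z : internal q z -> o' (q z) = ~~ o' z.
  rewrite /o'; elim/graft_ind: z => [y _|||| ]; rewrite ?graftE ?embK ?op //;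
  rewrite /internal graftE //.
pose g z := odflt m (unemb z).
have embg z : internal q z && o' z -> emb (g z) = z.
  by elim/graft_ind: z => [y _|||| ]; rewrite /g ?embK // /internal graftE.
rewrite vertsE (edges_orient kapC _ qK qN op') (reindex_onto emb g) //=.
rewrite (bigD1 m); last by rewrite im /o' embK /g embK /o !eqxx.
rewrite graftE !extE eqxx pmm -cm /F /=.
suff -> : \prod_(y | (internal q (emb y) && o' (emb y) && (g (emb y) == y)) && (y != m))
    kap (ext (col, w) (emb y)) (ext (col, w) (q (emb y))) = edges kap p col by ring.
rewrite (edges_orient kapC col pK pN (o := o)) //.
apply: eq_big => [y|y].
  rewrite im /o' embK /g embK eqxx andbT /o.
  have [->|ym] := eqVneq y m; first by rewrite /internal.
  have [->|ypm] := eqVneq y (p m); rewrite ?andbF //= andbT //.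
rewrite graftE !extE im /o' embK /o => /andP[/andP[/andP[_ oy] _] ym].
move: oy; rewrite (negPf ym) (inv_eq pK).
by case: (y == p m).
Qed.

End GraftState.
End Graft.

(** * Linear maps out of the space of diagrams *)

Section Span.
Variables (R : pzRingType) (V : lmodType R) (G : V -> Prop).

Lemma span_gen v : G v -> span G v.
Proof. by move=> Gv; rewrite -[v]addr0 -[v]scale1r; apply: spanD => //; apply: span0. Qed.

Lemma span_add u v : span G u -> span G v -> span G (u + v).
Proof. by move=> Gu Gv; rewrite -[u]scale1r; apply: spanZD. Qed.

Lemma span_scale a u : span G u -> span G (a *: u).
Proof. by move=> Gu; rewrite -[_ *: _]addr0; apply: spanZD => //; apply: span0. Qed.

Lemma span_opp u : span G u -> span G (- u).
Proof. by move=> Gu; rewrite -scaleN1r; apply: span_scale. Qed.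

Lemma span_sub u v : span G u -> span G v -> span G (u - v).
Proof. by move=> Gu Gv; apply: span_add => //; apply: span_opp. Qed.

Lemma span_sum (I : Type) (r : seq I) (P : pred I) (F : I -> V) :
  (forall i, P i -> span G (F i)) -> span G (\sum_(i <- r | P i) F i).
Proof.
by move=> GF; elim/big_ind: _ => // [|u v]; [apply: span0 | apply: span_add].
Qed.

Lemma span_ind_closed (P : V -> Prop) : P 0 ->
  (forall a u v, P u -> P v -> P (a *: u + v)) -> (forall v, G v -> P v) ->
  forall v, span G v -> P v.
Proof. by move=> P0 PD PG v; elim=> // a g w /PG Pg _; apply: PD. Qed.

Lemma quotmod_pi_gen v : G v -> quotmod_pi G v = 0.
Proof.
move=> Gv; rewrite -(raddf0 (@quotmod_pi R V G)); apply/quotmod_eq.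
by rewrite subr0; apply: span_gen.
Qed.

End Span.

Section Lift.
Variables (n : nat) (V : lmodType rat) (f : tree n -> V).
Hypotheses
  (f_iso : forall k (p q : tree_on n k) s, is_iso s -> relabels s p q ->
    f (mktree p) = f (mktree q))
  (f_AS : forall k (p q : tree_on n k) v, relabels (reverse (inr v)) p q ->
    f (mktree p) + f (mktree q) = 0)
  (f_IHX : forall k (p q r : tree_on n k) u v, val p (inr u) = inr v ->
    relabels (rotate (inr u) (inr v)) p q ->
    relabels (rotate (inr u) (inr v)) q r ->
    f (mktree p) + f (mktree q) + f (mktree r) = 0).

Definition malg_lift (g : {malg rat[tree n]}) : V :=
  \sum_(T <- msupp g) mcoeff T g *: f T.

Lemma malg_liftEw g (D : {fset tree n}) : (msupp g `<=` D)%fset ->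
  malg_lift g = \sum_(T <- D) mcoeff T g *: f T.
Proof.
move=> gD; apply: big_fset_incl => // T _; rewrite -mcoeff_eq0 => /eqP ->.
by rewrite scale0r.
Qed.

Fact malg_lift_linear : linear malg_lift.
Proof.
move=> a g h; pose D := (msupp g `|` msupp h)%fset.
rewrite (@malg_liftEw g D) ?fsubsetUl // (@malg_liftEw h D) ?fsubsetUr //.
rewrite (@malg_liftEw _ D); last first.
  apply: fsubset_trans (msuppD_le _ _) _; apply: fsetUSS => //.
  exact: msuppZ_le.
rewrite scaler_sumr -big_split /=; apply: eq_bigr => T _.
by rewrite mcoeffD mcoeffZ scalerDl scalerA.
Qed.
HB.instance Definition _ := GRing.isLinear.Build rat {malg rat[tree n]} V *:%R
  malg_lift malg_lift_linear.

Lemma malg_liftU T : malg_lift << T >> = f T.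
Proof.
by rewrite /malg_lift msuppU oner_eq0 big_seq_fset1 mcoeffUU scale1r.
Qed.

Lemma malg_liftD g h : malg_lift (g + h) = malg_lift g + malg_lift h.
Proof. by rewrite -[g]scale1r malg_lift_linear !scale1r. Qed.

Lemma malg_liftN g : malg_lift (- g) = - malg_lift g.
Proof. exact: (raddfN malg_lift). Qed.

Lemma malg_lift_relator g : span (@relator n) g -> malg_lift g = 0.
Proof.
elim=> [|a {}g h rg _ IH]; first exact: linear0.
rewrite malg_lift_linear IH addr0; suff -> : malg_lift g = 0 by rewrite scaler0.
case: rg => [k p q s si re|k p q v re|k p q r u v puv pq qr].
- apply: etrans (malg_liftD _ _) _.
  rewrite malg_liftN; apply/eqP; rewrite subr_eq0; apply/eqP.
  exact: etrans (malg_liftU _) (etrans (f_iso si re) (esym (malg_liftU _))).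
- apply: etrans (malg_liftD _ _) (etrans _ (f_AS re)).
  by congr (_ + _); apply: malg_liftU.
- apply: etrans (malg_liftD _ _) (etrans _ (f_IHX puv pq qr)).
  congr (_ + _); last exact: malg_liftU.
  by apply: etrans (malg_liftD _ _) _; congr (_ + _); apply: malg_liftU.
Qed.

Definition C_lift_fun (x : C n) : V := malg_lift (repr x).

Lemma C_lift_pi g : C_lift_fun (quotmod_pi (@relator n) g) = malg_lift g.
Proof.
apply/eqP; rewrite /C_lift_fun -subr_eq0 -linearB; apply/eqP/malg_lift_relator.
by apply/quotmod_eq; rewrite quotmod_repr.
Qed.

Fact C_lift_linear : linear C_lift_fun.
Proof.
move=> a x y; rewrite -[x]quotmod_repr -[y]quotmod_repr -linearP !C_lift_pi.
exact: linearP.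
Qed.

(** The universal property of [C n]. *)
Lemma C_lift : exists L : {linear C n -> V}, forall T, L (cls T) = f T.
Proof.
pose m := GRing.isLinear.Build rat (C n) V *:%R C_lift_fun C_lift_linear.
pose L : {linear C n -> V} := HB.pack C_lift_fun m.
exists L => T; rewrite /= /cls C_lift_pi; exact: malg_liftU.
Qed.

End Lift.

Lemma span_cls n (x : C n) : span (fun y => exists T, y = cls T) x.
Proof.
rewrite -[x]quotmod_repr [repr x]monalgE linear_sum; apply: span_sum => T _.
have -> : << mcoeff T (repr x) *g T >> = mcoeff T (repr x) *: << T >>.
  by apply/malgP => U; rewrite mcoeffZ !mcoeffU mulrnAr mulr1.
rewrite linearZ /=; apply/span_scale/span_gen; by exists T.
Qed.

Section Classes.
Variables (n k : nat).
Implicit Types p q r : tree_on n k.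

Lemma cls_iso p q s : is_iso s -> relabels s p q -> cls (mktree p) = cls (mktree q).
Proof. by move=> si re; apply/quotmod_eq/span_gen/(rel_iso si). Qed.

Lemma cls_AS p q v : relabels (reverse (inr v)) p q ->
  cls (mktree q) = - cls (mktree p).
Proof.
move=> re; apply/esym/addr0_eq.
exact: etrans (esym (quotmod_piD _ _ _)) (quotmod_pi_gen (rel_AS re)).
Qed.

Lemma cls_IHX p q r u v : val p (inr u) = inr v ->
    relabels (rotate (inr u) (inr v)) p q ->
    relabels (rotate (inr u) (inr v)) q r ->
  cls (mktree p) = - cls (mktree q) - cls (mktree r).
Proof.
move=> puv pq qr; apply/eqP; rewrite -opprD -addr_eq0 addrA; apply/eqP.
apply: etrans (quotmod_pi_gen (rel_IHX puv pq qr)).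
apply: etrans (esym (quotmod_piD _ _ _)).
by congr (_ + _); apply: esym (quotmod_piD _ _ _).
Qed.

End Classes.

(** * Renamings that keep vertices together *)
Section FibrePreserving.
Variables (n k : nat).
Local Notation hf := (half n.+1 k).

Lemma vert_reverse (u : 'I_k * 'I_3) (x : hf) : vert (reverse (inr u) x) = vert x.
Proof. by rewrite /reverse; case: tpermP => [->|->|]; rewrite ?vert_next. Qed.

Lemma reverse_tree (v : 'I_k) p : is_tree p ->
  is_tree (conj (tperm (next (inr (v, o0) : hf)) (next (next (inr (v, o0))))) p).
Proof.
move=> tp; apply: (@conj_tree _ _ _ _ id) => //; first by move=> u; exists u.
by move=> x; rewrite (vert_reverse (v, o0) x); apply: connect0.
Qed.

Definition reverseT (v : 'I_k) (T : tree_on n.+1 k) : tree_on n.+1 k :=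
  Tree (reverse_tree v (tree_onP T)).

Lemma reverseT_relabels v T : relabels (reverse (inr (v, o0))) T (reverseT v T).
Proof. by move=> x; apply: conjE. Qed.

(** Such a renaming is an isomorphism except for the vertices at which it
    reverses the cyclic order; these are removed one at a time by AS. *)
Lemma cls_fibre_preserving (p q : tree_on n.+1 k) (s : hf -> hf) :
    injective s -> (forall i, s (inl i) = inl i) ->
    (forall x y, vert x = vert y -> vert (s x) = vert (s y)) ->
    relabels s p q ->
  cls (mktree q) = cls (mktree p) \/ cls (mktree q) = - cls (mktree p).
Proof.
(* The vertices at which s reverses the cyclic order. *)
pose odd_at (s : hf -> hf) : pred 'I_k := fun v => s (next (inr (v, o0))) != next (s (inr (v, o0))).
have [m] := ubnP #|odd_at s|; elim: m s p => // m IH s p lem si sl sv re.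
have sr u : exists w, s (inr u) = inr w.
  case su : (s (inr u)) => [i|w]; last by exists w.
  by have:= si _ _ (etrans su (esym (sl i))).
have s_at v : [\/ s (inr (v, o1)) = s (inr (v, o0)),
    s (inr (v, o1)) = next (s (inr (v, o0))) | s (inr (v, o1)) = next (next (s (inr (v, o0))))].
  by apply/vertE/sv.
have s_at2 v : [\/ s (inr (v, o2)) = s (inr (v, o0)),
    s (inr (v, o2)) = next (s (inr (v, o0))) | s (inr (v, o2)) = next (next (s (inr (v, o0))))].
  by apply/vertE/sv.
have n01 v : s (inr (v, o1)) <> s (inr (v, o0)) by move/si.
have n02 v : s (inr (v, o2)) <> s (inr (v, o0)) by move/si.
have n12 v : s (inr (v, o1)) <> s (inr (v, o2)) by move/si.
have [v ov|ev] := pickP (odd_at s); last first.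
  left; symmetry; apply: (cls_iso (s := s)) => //.
  split=> //; first exact: injF_bij.
  case=> [i|[v]]; first by rewrite /= sl.
  have e1 : s (inr (v, o1)) = next (s (inr (v, o0))).
    by have:= ev v; rewrite /odd_at /= ordSE => /negbFE/eqP.
  have e2 : s (inr (v, o2)) = next (next (s (inr (v, o0)))).
    have := n12 v; rewrite e1; case: (s_at2 v) => // [/n02|->] //.
  by elim/ord3P; rewrite /= ordSE ?e1 ?e2 ?next3.
have nr x : reverse (inr (v, o0)) x = [fun y : hf => y with inr (v, o1) |-> inr (v, o2),
    inr (v, o2) |-> inr (v, o1)] x.
  rewrite /reverse /= !ordSE; case: tpermP => [->|->|/eqP/negPf -> /eqP/negPf ->] //=.
  - by rewrite eqxx.
  - by rewrite (_ : (_ == inr (v, o1) :> hf) = false) ?eqxx // inr_eqE xpair_eqE andbF.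
have [|||||e|e] := IH (s \o reverse (inr (v, o0))) (reverseT v p).
- rewrite -ltnS; apply: leq_trans lem; rewrite ltnS; apply/proper_card/properP; split.
    apply/subsetP => w; rewrite !unfold_in /odd_at /= !ordSE !nr /=.
    have [->|wv] := eqVneq w v; first by move: ov; rewrite /odd_at /= ordSE.
    have ne t t' : (inr (w, t) == inr (v, t') :> hf) = false.
      by apply/eqP => -[e _]; rewrite e eqxx in wv.
    by rewrite !ne.
  exists v => //; rewrite !unfold_in /odd_at /= !ordSE !nr /= eqxx negbK.
  move: ov; rewrite /odd_at /= ordSE.
  case: (s_at v) => [/n01//|->|e1]; first by rewrite eqxx.
  move=> _; case: (s_at2 v) => [/n02//|e2|e2]; last by case: (n12 v); rewrite e1 e2.
  by rewrite !inr_eqE !xpair_eqE /= !andbF e2 eqxx.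
- by apply: inj_comp => //; apply: perm_inj.
- by move=> i; rewrite /= nr /= sl.
- by move=> x y xy; apply: sv; rewrite !vert_reverse.
- move=> x /=.
  have rK : involutive (reverse (inr (v, o0) : hf)) by apply: tpermK.
  rewrite -[x in LHS]rK -[in RHS](rK x) reverseT_relabels !rK; exact: re.
- by right; rewrite e (cls_AS (reverseT_relabels v p)).
- by left; rewrite e (cls_AS (reverseT_relabels v p)) opprK.
Qed.

End FibrePreserving.

(** * Combs *)

Definition graft n k (T : tree_on n.+1 k) : tree_on n.+2 k.+1 :=
  Tree (graft_tree (tree_onP T)).

Definition tripod_fun : {ffun half 3 1 -> half 3 1} :=
  [ffun x : half 3 1 => match x with inl i => inr (ord0, i) | inr (_, i) => inl i end].

Lemma tripod_tree : is_tree tripod_fun.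
Proof.
have pK : involutive tripod_fun.
  by move=> [i|[v i]]; rewrite !ffunE // [v]ord1.
apply: connected_tree => // [[i|[v i]]|u v]; rewrite ?ffunE //.
have c0 w : connect (adj tripod_fun) (inr ord0) w.
  case: w => [i|w]; last by rewrite [w]ord1 connect0.
  by have:= adj_edge tripod_fun (inr (ord0, i)); rewrite ffunE => /connect1.
apply: connect_trans (c0 v); by rewrite connect_adj_sym.
Qed.

Definition tripod : tree_on 3 1 := Tree tripod_tree.

Fixpoint comb k : tree_on k.+3 k.+1 :=
  if k is k'.+1 then graft (comb k') else tripod.

Lemma ord_lastP n (v : 'I_n.+1) : (exists w : 'I_n, v = lift ord_max w) \/ v = ord_max.
Proof. by case: (unliftP ord_max v) => [w ->|->]; [left; exists w | right]. Qed.

(** At each vertex of the comb, half-edge 0 points to leaf 0, half-edge 2 to the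
    last leaf, and half-edge 1 carries a middle leaf. *)
Lemma comb_spec k (p := val (comb k)) :
  [/\ p (inl ord0) = inr (ord0, o0), p (inl ord_max) = inr (ord_max, o2),
    forall (i : 'I_k.+3) (v : 'I_k.+1), i = v.+1 :> nat -> p (inl i) = inr (v, o1)
    & forall v w : 'I_k.+1, w = v.+1 :> nat -> p (inr (v, o2)) = inr (w, o0)].
Proof.
rewrite {}/p; elim: k => [|k [IH0 IHm IHl IHv]] /=.
  split=> [||i v iv|v w vw]; rewrite ?ffunE //.
  - by congr (inr (_, _)); apply: val_inj.
  - by congr (inr (_, _)); apply: val_inj.
  - by rewrite [v]ord1 in iv *; congr (inr (_, _)); apply: val_inj; rewrite /= iv.
  - by rewrite [v]ord1 [w]ord1 in vw.
have pK : involutive (val (comb k)) by case: (tree_onP (comb k)).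
split.
- have -> : inl ord0 = emb (inl ord0 : half k.+3 k.+1).
    by rewrite /=; congr inl; apply: val_inj.
  by rewrite graft_emb IH0; congr (inr (_, _)); apply: val_inj.
- exact: graft_leaf2.
- move=> i v iv; have [[w ve]|ve] := ord_lastP v.
    have wk : (w < k.+1)%N := ltn_ord w.
    have im : (w.+1 < k.+3)%N by lia.
    have -> : inl i = emb (inl (Ordinal im) : half k.+3 k.+1).
      rewrite /= ifF; last by apply/eqP => /(congr1 val) /=; lia.
      congr inl; apply: val_inj; rewrite /= iv ve /= /bump.
      lia.
    by rewrite graft_emb (IHl _ w) // ve.
  have -> : i = newleaf1 k.+2.
    by apply: val_inj; rewrite /= iv ve /= /bump; lia.
  by rewrite graft_leaf1 ve.
- move=> v w vw; have [[v' ve]|ve] := ord_lastP v; last first.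
    by have := ltn_ord w; rewrite vw ve /= ltnn.
  have -> : inr (v, o2) = emb (inr (v', o2)) by rewrite ve.
  have [[w' we]|we] := ord_lastP w.
    rewrite graft_emb (IHv _ w') ?we //; move: vw; rewrite ve we /= /bump.
    by have := ltn_ord w'; have := ltn_ord v'; lia.
  have -> : v' = ord_max.
    apply: val_inj; move: vw; rewrite ve we /= /bump.
    by have := ltn_ord v'; lia.
  by rewrite graft_emb -IHm pK /= eqxx we.
Qed.

Section CombValue.
Variables (X : finType) (b : X -> X -> X -> rat) (kap : X -> X -> rat).
Hypothesis kapC : forall x y, kap x y = kap y x.

Definition set_at (xi : nat -> X) i w j := if j == i then w else xi j.

(** The state sum of a comb, computed leaf by leaf according to [state_graft]. *)
Fixpoint comb_value k (xi : nat -> X) : rat :=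
  if k is k'.+1 then \sum_w' comb_value k' (set_at xi k.+1 w') *
    \sum_w kap w w' * b w (xi k.+1) (xi k.+2)
  else b (xi 0) (xi 1) (xi 2).

Lemma eq_comb_value k xi xi' : (forall i, i < k.+3 -> xi i = xi' i)%N ->
  comb_value k xi = comb_value k xi'.
Proof.
elim: k xi xi' => [|k IH] xi xi' e /=; first by rewrite !e.
apply: eq_bigr => w' _; rewrite !e //; congr (_ * _); apply: IH => i ik.
by rewrite /set_at; case: eqP => // _; apply: e; lia.
Qed.

Lemma state_comb k x (xi : nat -> X) : (forall i : 'I_k.+3, x i = xi i) ->
  state kap (val (comb k)) (verts b) x = comb_value k xi.
Proof.
elim: k x xi => [|k IH] x xi xE /=.
  pose col : {ffun half 3 1 -> X} := [ffun y : half 3 1 =>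
    match y with inl i => x i | inr (_, i) => x i end].
  rewrite /state (big_pred1 col) => [|c].
    rewrite /edges big1 ?mulr1 => [|[i|[v i]]]; rewrite ?/internal ?ffunE //.
    by rewrite /verts big_ord1 !ffunE !xE.
  rewrite /fits; apply/forallP/eqP => [H|-> i]; last by rewrite !ffunE eqxx.
  apply/ffunP => -[i|[v i]]; rewrite ffunE; have:= H i; rewrite ffunE => /andP[/eqP c1 /eqP c2] //.
  by rewrite [v]ord1.
have [pK pN _ _] := tree_onP (comb k).
rewrite state_graft //; last by have [_ -> _ _] := comb_spec k.
apply: eq_bigr => w' _; congr (_ * _).
  apply: IH => i; rewrite /old_colours /set_at -(inj_eq val_inj) /=.
  case: eqP => // ik; rewrite xE /= /bump; congr xi.
  by have:= ltn_ord i; lia.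
by apply: eq_bigr => w _; rewrite !xE /= /bump; congr (_ * b _ (xi _) _); lia.
Qed.

Lemma state_relabel n k (T : tree_on n.+1 k) sg x :
  state kap (val (relabel sg T)) (verts b) x = state kap (val T) (verts b) (x \o sg).
Proof.
have [pK pN _ _] := tree_onP T; pose s := leaf_perm k sg.
rewrite (@state_conj _ _ kapC _ _ (val T) _ s (s^-1)%g sg) //=.
- apply: state_ext => col; apply: eq_bigr => v _.
  have e t : (s^-1)%g (inr (v, t)) = inr (v, t).
    by apply: (canLR (permK s)); rewrite permE.
  by rewrite !ffunE !e.
- exact: permK.
- exact: permKV.
- by move=> i; rewrite permE.
- by move=> y; rewrite conjE.
Qed.

End CombValue.

(** * The spine of a tree *)

Section Spine.
Variables (n k : nat).
Local Notation hf := (half n k).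
Implicit Types p q : {ffun hf -> hf}.

(** [s] lists the half-edges by which the path from leaf [r] to leaf [l] leaves
    its trivalent vertices. *)
Definition spine p (r l : 'I_n) (s : seq hf) :=
  path (step p) (inl r) s /\ p (last (inl r) s) = inl l.

Lemma spine_exists p (r l : 'I_n) : is_tree p -> r != l -> exists s, spine p r l s.
Proof.
case=> pK pN conn noc rl; have cl u : connect (adj p) u (inl l) by [].
have rl' : (inl r : 'I_n + 'I_k) != inl l by [].
have ru : inl r \in ups cl.
  apply/upP; exists (inl r) => //.
  by have [] := parentP cl rl'; case: (parent _ _) => [i /= [->]|[]].
have [|s ps ls] := @walk_up _ _ _ pK l cl (inl r).
  by rewrite (disjointFr (ups_disjoint pK cl)).
by exists s; split=> //; case: (p _) ls => [i [->]|[]].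
Qed.

Lemma walk_inner p x s : path (step p) x s ->
  forall y, y \in s -> exists u, y = inr u.
Proof.
elim: s x => // z s IH x /= /andP[/andP[/eqP xz zx] zs] y.
rewrite inE => /orP[/eqP->|]; last exact: IH zs _.
case: z zx xz {zs} => [i|u _ _]; last by exists u.
by case: (p x) => [j|[v j]] //= ij [e]; rewrite e eqxx in ij.
Qed.

Lemma spine_uniq p r l s : is_tree p -> spine p r l s ->
  uniq (map (@vert n k) (inl r :: s)).
Proof. by case=> pK pN _ noc [ps _]; have [] := walk_uniq pK pN noc ps. Qed.

Lemma leaf_inr p i : is_tree p -> (0 < k)%N -> exists u, p (inl i) = inr u.
Proof.
case=> pK pN conn _ k0; case pi : (p (inl i)) => [j|u]; last by exists u.
have cl : closed (adj p) [pred u | (u == inl i) || (u == inl j)].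
  apply: intro_closed; first exact: connect_adj_sym.
  move=> u v /existsP[x /andP[/eqP <- /eqP <-]]; rewrite !inE.
  case: x => [a|[w a]] //=; rewrite !inl_eqE => /orP[]/eqP->.
    by rewrite pi /= eqxx orbT.
  by rewrite -pi pK /= eqxx.
by have:= closed_connect cl (conn (inl i) (inr (Ordinal k0))); rewrite !inE eqxx.
Qed.

Lemma spine_neq0 p r l s : is_tree p -> (0 < k)%N -> spine p r l s -> s != [::].
Proof.
move=> tp k0 [_ sl]; apply/eqP => s0.
by have [u] := leaf_inr r tp k0; move: sl; rewrite s0 /= => ->.
Qed.

(** Otherwise the vertices of the spine and the leaves attached to them would be
    closed under adjacency, although vertices are missing. *)
Lemma spine_grows p r l s : is_tree p -> (0 < k)%N -> spine p r l s ->
    (size s < k)%N ->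
  exists x u, [/\ vert x \in map (@vert n k) s, p x = inr u &
    vert (inr u : hf) \notin map (@vert n k) s].
Proof.
move=> tp k0 sp sk; have s0 := spine_neq0 tp k0 sp.
have us := spine_uniq tp sp; case: tp => pK pN conn noc.
pose vs := map (@vert n k) s.
have [u uvs] : exists u : 'I_k, inr u \notin vs.
  apply/existsP; rewrite -negb_forall; apply: contraTN sk => /forallP al.
  rewrite -leqNgt -(size_map (@vert n k)) -[X in (X <= _)%N]card_ord.
  rewrite -(card_imset _ (@inr_inj 'I_n 'I_k)) cardE; apply: uniq_leq_size; first exact: enum_uniq.
  by move=> v; rewrite mem_enum => /imsetP[w _ ->].
apply: contrapT => H.
have cl : closed (adj p) [pred u | (u \in vs) ||
    (if u is inl i then vert (p (inl i)) \in vs else false)].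
  apply: intro_closed; first exact: connect_adj_sym.
  move=> a c /existsP[x /andP[/eqP <- /eqP <-]]; rewrite !inE => /orP[xs|].
    case px : (p x) => [i|w]; first by rewrite /= -px pK xs orbT.
    by apply/orP; left; apply: contrapT => /negP nw; apply: H; exists x, w.
  by case: x => [i|[]] //= ->.
have [y ys] : exists y, y \in s by case: (s) s0 => // y t; exists y; rewrite inE eqxx.
have:= closed_connect cl (conn (vert y) (inr u)).
by rewrite !inE (map_f _ ys) (negPf uvs).
Qed.

(** The spine passes through the vertex of [x] by [a] and [c], and [x] leads off
    the spine.  If the renaming [f] moves exactly one of [a] and [c] to the
    vertex at the other end of [x], then in [q] the spine has to run along the
    edge of [x], and it is longer by one vertex. *)
Lemma spine_surgery p q (f : hf -> hf) r l s1 c s2 x :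
    is_tree p -> spine p r l (s1 ++ c :: s2) -> involutive p ->
    injective f ->
    (forall z, q (f z) = f (p z)) ->
    vert x = vert c -> (exists v, vert x = inr v) ->
    (forall z, vert z != vert x -> vert z != vert (p x) -> f z = z) ->
    f x = x -> f (p x) = p x ->
    vert (p x) \notin map (@vert n k) (inl r :: s1 ++ c :: s2) ->
    vert (p x) != inl l ->
    let a := p (last (inl r) s1) in
    x != a -> x != c ->
    (vert (f a) = vert x /\ vert (f c) = vert (p x)) \/
    (vert (f a) = vert (p x) /\ vert (f c) = vert x) ->
  exists d, spine q r l (s1 ++ d :: f c :: s2).
Proof.
move=> tp sp pK fi qf xc [v xv] fo fx fy yn yl a xa xnc fac.
have us := spine_uniq tp sp; case: sp => ps sl.
move: ps; rewrite cat_path /= => /and3P[p1 ac p2].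
have vc : vert c = inr v by rewrite -xc.
have vac : vert a = vert c by case/andP: ac => /eqP.
have wv : vert (p x) != vert x.
  apply: contraNneq yn => ->; rewrite xc map_cons inE map_cat mem_cat /= inE eqxx.
  by rewrite !orbT.
(* Away from both vertices f does nothing, and q agrees with p. *)
pose Q (z : hf) := (vert z != vert x) && (vert z != vert (p x)).
have fQ z : Q z -> f z = z by case/andP; apply: fo.
have Qs z : z \in inl r :: s1 ++ s2 -> Q z.
  move=> zs; apply/andP; split; last first.
    apply: contraNneq yn => <-; apply: map_f; move: zs.
    by rewrite !inE !mem_cat inE => /or3P[] ->; rewrite ?orbT.
  rewrite xc; apply: contraTneq us => zc.
  suff : ~~ uniq (map (@vert n k) (c :: inl r :: s1 ++ s2)).
    apply: contra; rewrite -(perm_uniq (s1 := map (@vert n k) (inl r :: s1 ++ c :: s2))) //.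
    by apply/perm_map/permEl/(perm_catCA (inl r :: s1) [:: c] s2).
  by rewrite map_cons /= -zc negb_and negbK (map_f (@vert n k) zs).
have stepQ : {in Q &, forall y z, step p y z -> step q y z}.
  move=> y z Qy Qz /andP[/eqP yz zy]; have Qpy : Q (p y) by rewrite /Q yz.
  have -> : step q y z = step p y z.
    by rewrite /step -[in q y](fQ y Qy) qf fQ.
  by rewrite /step yz eqxx zy.
have lastQ y : Q y -> Q (p y) -> q y = p y.
  by move=> Qy Qpy; rewrite -[in q y](fQ y Qy) qf fQ.
have Qpc : Q (p c).
  have pcn : vert (p c) = if s2 is z :: _ then vert z else inl l.
    case: (s2) sl p2 => [|z t]; first by rewrite last_cat /= => ->.
    by move=> _ /= /andP[/andP[/eqP]].
  rewrite /Q {}pcn; case: (s2) Qs => [_|z t Qs]; last first.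
    by have:= Qs z; rewrite !inE mem_cat inE eqxx !orbT; apply.
  by rewrite xv eq_sym [inl l == _]eq_sym yl.
have qc : q (f c) = p c by rewrite qf fQ.
have Ql : Q (last (inl r) s1).
  by apply: Qs; rewrite -cat_cons mem_cat mem_last.
have q1 : q (last (inl r) s1) = f a by rewrite -[in LHS](fQ _ Ql) qf.
have P1 : path (step q) (inl r) s1.
  apply: (sub_in_path (P := Q) _ _ p1); first exact: stepQ.
  apply/allP => z zs; apply: Qs.
  by rewrite -cat_cons mem_cat zs.
have P2 : path (step q) (f c) s2.
  case: (s2) p2 qc Qs => // z t /= /andP[cz zt] qc Qs.
  rewrite {1}/step qc; move: cz; rewrite /step => -> /=.
  apply: (sub_in_path (P := Q) _ _ zt); first exact: stepQ.
  apply/allP => w wt; apply: Qs.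
  by rewrite -cat_cons mem_cat wt orbT.
have sl' : q (last (f c) s2) = inl l.
  move: sl; rewrite last_cat /=; case: (s2) qc Qs => [|z t] /= qc Qs; first by rewrite qc.
  move=> e; rewrite lastQ //.
    by apply: Qs; rewrite -cat_cons mem_cat mem_last orbT.
  by rewrite e /Q /= xv eq_sym [inl l == _]eq_sym yl.
have qx : q x = p x by rewrite -[in LHS]fx qf fy.
have qpx : q (p x) = x by rewrite -[in LHS]fy qf pK fx.
case: fac => -[fa fc].
- exists x; split; last by rewrite last_cat.
  rewrite cat_path P1 /= P2 andbT /step q1 fa eqxx qx fc eqxx /=.
  rewrite -[in x != _]fx (inj_eq fi) xa -fy (inj_eq fi) /=.
  by apply: contraNneq wv => <-; rewrite xc.
- exists (p x); split; last by rewrite last_cat.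
  rewrite cat_path P1 /= P2 andbT /step q1 fa eqxx qpx fc eqxx /=.
  rewrite -[in p x != _]fy (inj_eq fi) -[in _ != x]fx (inj_eq fi) eq_sym [c == x]eq_sym xnc andbT.
  by apply: contraNneq wv => <-; rewrite vac xc.
Qed.
End Spine.

(** * Lengthening the spine by IHX *)

Section Rotate.
Variables (n k : nat).
Local Notation hf := (half n.+1 k).

Section Facts.
Variables (u v : 'I_k * 'I_3).
Let x : hf := inr u.
Let y : hf := inr v.
Hypothesis xy : vert x != vert y.
Local Notation rot := (rotate x y).

Fact next_x : next x != x. Proof. by rewrite /x; case: u => a t; apply: next_neq. Qed.
Fact next_y : next y != y. Proof. by rewrite /y; case: v => a t; apply: next_neq. Qed.
Fact next2_x : next (next x) != x. Proof. by rewrite /x; case: u => a t; apply: next2_neq. Qed.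
Fact next21_x : next (next x) != next x.
Proof. by rewrite (inj_eq (@next_inj _ _)) next_x. Qed.
Fact vert_neq (a b : hf) : vert a = vert x -> vert b = vert y -> a != b.
Proof. by move=> ax bY; apply: contraNneq xy => e; rewrite -ax -bY e. Qed.

Lemma rotateE z :
  rot z = tperm (next (next x)) (next y) (tperm (next x) (next (next x)) z).
Proof. by []. Qed.

Fact x1_neq b : vert b = vert y -> next x != b.
Proof. by apply: vert_neq; rewrite vert_next. Qed.
Fact x2_neq b : vert b = vert y -> next (next x) != b.
Proof. by apply: vert_neq; rewrite !vert_next. Qed.
Fact y1_neq a : vert a = vert x -> next y != a.
Proof. by move=> ax; rewrite eq_sym vert_neq ?vert_next. Qed.

Lemma rotate_x : rot x = x.
Proof.
by rewrite rotateE (tpermD (next_x) (next2_x)) (tpermD next2_x) // y1_neq.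
Qed.
Lemma rotate_y : rot y = y.
Proof.
by rewrite rotateE (tpermD (x1_neq _) (x2_neq _)) // (tpermD (x2_neq _) next_y).
Qed.
Lemma rotate_x1 : rot (next x) = next y.
Proof. by rewrite rotateE tpermL tpermL. Qed.
Lemma rotate_x2 : rot (next (next x)) = next x.
Proof.
by rewrite rotateE tpermR (tpermD next21_x) // y1_neq ?vert_next.
Qed.
Lemma rotate_y1 : rot (next y) = next (next x).
Proof.
by rewrite rotateE (tpermD (x1_neq _) (x2_neq _)) ?vert_next // tpermR.
Qed.
Lemma rotate_y2 : rot (next (next y)) = next (next y).
Proof.
rewrite rotateE (tpermD (x1_neq _) (x2_neq _)) ?vert_next //.
rewrite tpermD ?x2_neq ?vert_next //.
by rewrite eq_sym (inj_eq (@next_inj _ _)) next_y.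
Qed.
Lemma rotate_other z : vert z != vert x -> vert z != vert y -> rot z = z.
Proof.
move=> zx zy; rewrite rotateE (tpermD (z := z)); last 2 first.
- by apply: contraNneq zx => <-; rewrite vert_next.
- by apply: contraNneq zx => <-; rewrite !vert_next.
rewrite tpermD //; first by apply: contraNneq zx => <-; rewrite !vert_next.
by apply: contraNneq zy => <-; rewrite vert_next.
Qed.
Lemma rotate_inj : injective rot.
Proof. by move=> a b; rewrite !rotateE => /perm_inj/perm_inj. Qed.

Definition rot_perm : {perm hf} := perm rotate_inj.

(** Vertices torn apart by [rotate] are joined by the edge of [x] and [y], as
    [conj_tree] requires. *)
Lemma rotate_vert z : vert (rot z) = vert z \/
  (vert z = vert x \/ vert z = vert y) /\ (vert (rot z) = vert x \/ vert (rot z) = vert y).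
Proof.
have [zx|zx] := eqVneq (vert z) (vert x).
  by case: (vertE (esym zx)) => ->; rewrite ?rotate_x ?rotate_x1 ?rotate_x2 ?vert_next; auto.
have [zy|zy] := eqVneq (vert z) (vert y); last by left; rewrite rotate_other.
right; split; first by right.
by case: (vertE (esym zy)) => ->; rewrite ?rotate_y ?rotate_y1 ?rotate_y2 ?vert_next; auto.
Qed.

Lemma rotate_tree p : is_tree p -> p x = y -> is_tree (conj rot_perm p).
Proof.
move=> tp pxy; apply: (@conj_tree _ _ _ _ id) => //; first by move=> w; exists w.
have rE z : rot_perm z = rot z by rewrite permE.
have qxy : conj rot_perm p x = y.
  by rewrite -{1}rotate_x -rE conjE pxy rE rotate_y.
have qK : involutive (conj rot_perm p).
  by case: tp => pK _ _ _ z; rewrite -[z](permKV rot_perm) !conjE pK.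
have cxy : connect (adj (conj rot_perm p)) (vert x) (vert y).
  by rewrite -qxy; apply/connect1/adj_edge.
have cyx : connect (adj (conj rot_perm p)) (vert y) (vert x).
  by rewrite connect_adj_sym.
move=> z; rewrite rE; case: (rotate_vert z) => [->|]; first exact: connect0.
by case=> [][]-> []->; rewrite ?connect0.
Qed.

End Facts.

Lemma IHX_trees (T : tree_on n.+1 k) u v : val T (inr u) = inr v ->
  exists T' T'' : tree_on n.+1 k,
    [/\ cls (mktree T) = - cls (mktree T') - cls (mktree T''),
        relabels (rotate (inr u) (inr v)) T T' &
        relabels (rotate (inr u) (inr v)) T' T''].
Proof.
move=> Tuv; have tT := tree_onP T.
have xy : vert (inr u : hf) != vert (inr v : hf).
  by rewrite -Tuv eq_sym tree_noloop.
have rE z : rot_perm u v z = rotate (inr u) (inr v) z by rewrite permE.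
have t' := rotate_tree xy tT Tuv.
pose T' : tree_on n.+1 k := Tree t'.
have T'uv : val T' (inr u) = inr v.
  by rewrite /= -{1}(rotate_x xy) -rE conjE Tuv rE rotate_y.
have t'' := rotate_tree xy t' T'uv.
pose T'' : tree_on n.+1 k := Tree t''.
have R' : relabels (rotate (inr u) (inr v)) T T'.
  by move=> z; rewrite -!rE /= conjE.
have R'' : relabels (rotate (inr u) (inr v)) T' T''.
  by move=> z; rewrite -!rE [val T'']/= conjE.
exists T', T''; split=> //; exact: cls_IHX Tuv R' R''.
Qed.

(** The rotation of IHX and its square each move exactly one of the two spine
    half-edges to the far vertex. *)
Lemma spine_step (T : tree_on n.+1 k) r l s : (0 < k)%N ->
    @spine n.+1 k (val T) r l s -> (size s < k)%N ->
  exists T' T'' s' s'', [/\ cls (mktree T) = - cls (mktree T') - cls (mktree T''),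
     @spine n.+1 k (val T') r l s', @spine n.+1 k (val T'') r l s'',
     size s' = (size s).+1 & size s'' = (size s).+1].
Proof.
move=> k0 sp sk; have tT := tree_onP T.
have [pK _ _ _] := tT.
have [x [v [xs pxv vn]]] := spine_grows tT k0 sp sk.
have [c cs xc] := mapP xs.
have [u0 cu] := walk_inner (proj1 sp) cs.
have [u xu] : exists u, x = inr u.
  by move: xc; rewrite cu; case: (u0) (x) => ? ? [i|w] //= _; exists w.
have [T' [T'' [e R' R'']]] := IHX_trees (etrans (congr1 _ (esym xu)) pxv).
have xy : vert (inr u : hf) != vert (inr v : hf).
  by rewrite -xu -pxv eq_sym tree_noloop.
case/splitPr: cs sp sk xs vn => s1 s2 sp sk xs vn.
have [ps sl] := sp; move: ps; rewrite cat_path /= => /and3P[p1 /andP[/eqP ac ca] p2].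
set a := val T (last (inl r) s1) in ac ca *.
have vn' : vert (val T x) \notin map (@vert _ _) (inl r :: s1 ++ c :: s2).
  by rewrite pxv map_cons inE negb_or vn; case: (v).
have xa : x != a.
  apply: contraNneq vn' => ->; rewrite /a pK; apply: map_f.
  by rewrite -cat_cons mem_cat mem_last.
have xnc : x != c.
  apply: contraNneq vn => xce; rewrite -pxv xce.
  move: p2 sl; rewrite last_cat /=; case: (s2) => [|z t] /=.
    by move=> _; rewrite -xce pxv.
  by case/andP=> /andP[/eqP -> _] _ _; rewrite map_f // mem_cat !inE eqxx !orbT.
(* The three half-edges at this vertex are a, c and x. *)
have acx : (a = next x /\ c = next (next x)) \/ (a = next (next x) /\ c = next x).
  have xa' : vert x = vert a by rewrite xc ac.
  case: (vertE xc) => [ce|ce|ce]; first by rewrite ce eqxx in xnc.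
    case: (vertE xa') => [ae|ae|ae]; [by rewrite ae eqxx in xa| |by right].
    by rewrite -/a ce ae eqxx in ca.
  case: (vertE xa') => [ae|ae|ae]; [by rewrite ae eqxx in xa|by left|].
  by rewrite -/a ce ae eqxx in ca.
subst x; have wl : vert (val T (inr u)) != inl l by rewrite pxv; case: (v).
have hu : exists w, vert (inr u : hf) = inr w by case: (u) => w t; exists w.
have rx := rotate_x xy; have ry := rotate_y xy.
have rx1 := rotate_x1 u v; have rx2 := rotate_x2 xy; have ry1 := rotate_y1 xy.
have [d' sp'] : exists d, @spine n.+1 k (val T') r l (s1 ++ d :: rotate (inr u) (inr v) c :: s2).
  apply: (spine_surgery (x := inr u) tT sp) => //.
  - exact: rotate_inj.
  - by move=> z zx; rewrite pxv => zy; apply: rotate_other.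
  - by rewrite pxv.
  rewrite pxv -/a; case: acx => -[-> ->]; rewrite rx1 rx2 !vert_next; by [left | right].
have [d'' sp''] : exists d, @spine n.+1 k (val T'') r l
    (s1 ++ d :: rotate (inr u) (inr v) (rotate (inr u) (inr v) c) :: s2).
  apply: (@spine_surgery _ _ (val T) _ (rotate (inr u) (inr v) \o rotate (inr u) (inr v))
    _ _ _ _ _ (inr u) tT sp) => //=.
  - by apply: inj_comp; apply: rotate_inj.
  - by move=> z; rewrite R'' R'.
  - by move=> z zx; rewrite pxv => zy; rewrite !rotate_other.
  - by rewrite !rx.
  - by rewrite pxv !ry.
  rewrite pxv -/a; case: acx => -[-> ->]; rewrite ?(rx1, rx2, ry1) !vert_next; by [left | right].
exists T', T''; eexists; eexists; split; [exact: e | exact: sp' | exact: sp'' | |];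
by rewrite !size_cat /= !addnS.
Qed.

End Rotate.

(** * Combs span *)

Section FullSpine.
Variables (k : nat) (T : tree_on k.+3 k.+1).
Local Notation hf := (half k.+3 k.+1).
Let p : {ffun hf -> hf} := val T.
Let l : 'I_k.+3 := ord_max.
Variable s : seq hf.
Hypotheses (sp : spine p ord0 l s) (ss : size s = k.+1).

Let tp : is_tree p := tree_onP T.
Let pK : involutive p. Proof. by case: tp. Qed.

Definition arrive (i : nat) : hf := p (nth (inl ord0) (inl ord0 :: s) i).
Definition leave (i : nat) : hf := nth (inl ord0) s i.
Definition third (a c : hf) : hf := if next a == c then next c else next a.

Lemma leave_mem i : (i < k.+1)%N -> leave i \in s.
Proof. by move=> ik; rewrite mem_nth ?ss. Qed.

Lemma leave_inr i : (i < k.+1)%N -> exists u, leave i = inr u.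
Proof. by move=> ik; apply: (walk_inner (proj1 sp)); apply: leave_mem. Qed.

Lemma arrive_leave i : (i < k.+1)%N -> vert (arrive i) = vert (leave i) /\ leave i != arrive i.
Proof.
move=> ik; have /(pathP (inl ord0))/(_ i) := proj1 sp.
by rewrite ss => /(_ ik) /andP[/eqP].
Qed.

Lemma arriveS i : (i < k.+1)%N -> p (leave i) = if i == k then inl l else arrive i.+1.
Proof.
move=> ik; case: eqP => [->|_ //]; rewrite -(proj2 sp); congr (p _).
by rewrite /leave (last_nth (inl ord0)) ss.
Qed.

Lemma thirdP i (a := arrive i) (c := leave i) : (i < k.+1)%N ->
  [/\ vert (third a c) = vert c, third a c != a & third a c != c].
Proof.
move=> ik; have [u cu] := leave_inr ik; have [ac ca] := arrive_leave ik.
rewrite -/a -/c in cu ac ca.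
have nc : next c != c by rewrite cu; case: (u) => v t; apply: next_neq.
have nnc : next (next c) != c by rewrite cu; case: (u) => v t; apply: next2_neq.
rewrite /third; case: (vertE (esym ac)) => ae; rewrite ae in ca *.
- by rewrite eqxx in ca.
- rewrite (negPf nnc) !vert_next; split=> //.
  by rewrite (inj_eq (@next_inj _ _)).
- by rewrite next3 eqxx vert_next eq_sym (inj_eq (@next_inj _ _)).
Qed.

(** The half-edges of the standard comb, found along the spine of [T]. *)
Definition unfold_spine (x : hf) : hf :=
  match x with
  | inl j => inl j
  | inr (i, t) => if t == o0 then arrive i else if t == o1 then
      third (arrive i) (leave i) else leave i
  end.
Local Notation g := unfold_spine.

Lemma vert_unfold i t : vert (g (inr (i, t))) = vert (leave i).
Proof.
have [ac _] := arrive_leave (ltn_ord i); have [tc _ _] := thirdP (ltn_ord i).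
by elim/ord3P: t => /=.
Qed.

Lemma unfold_inr i t : exists u, g (inr (i, t)) = inr u.
Proof.
have [u iu] := leave_inr (ltn_ord i); have:= vert_unfold i t; rewrite iu.
by case: (g _) => [j|w]; [case: u {iu} | exists w].
Qed.

Lemma unfold_inj : injective g.
Proof.
have us : uniq (map (@vert _ _) s) by have := spine_uniq tp sp => /= /andP[].
move=> [i|[i t]] [j|[j t']] //.
- by move=> e; have [u] := unfold_inr j t'; rewrite -e.
- by move=> e; have [u] := unfold_inr i t; rewrite e.
have vE (m : 'I_k.+1) : nth (inl ord0) (map (@vert _ _) s) m = vert (leave m).
  by rewrite (nth_map (inl ord0)) ?ss.
move=> e; have ij : i = j.
  apply/val_inj/eqP; rewrite -(nth_uniq (inl ord0) _ _ us) ?size_map ?ss ?ltn_ord //.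
  by rewrite !vE -(vert_unfold i t) -(vert_unfold j t') e.
subst j; congr (inr (_, _)).
have [_ ca] := arrive_leave (ltn_ord i); have [_ ta tc] := thirdP (ltn_ord i).
move: e (negP ca) (negP ta) (negP tc); elim/ord3P: t; elim/ord3P: t' => //= e ca' ta' tc'; exfalso;
by [apply: ca'; apply/eqP | apply: ta'; apply/eqP | apply: tc'; apply/eqP].
Qed.

(** All other half-edges at trivalent vertices belong to edges of the spine. *)
Lemma leaf_mid j : j != ord0 -> j != l -> exists i, p (inl j) = g (inr (i, o1)).
Proof.
move=> j0 jl; have [u pu] := leaf_inr j tp (ltn0Sn k).
have [x ux] : exists x, inr u = g x.
  have [g' gK g'K] := injF_bij unfold_inj; by exists (g' (inr u)).
case: x ux => [//|[i t]] ux; exists i; rewrite pu ux.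
elim/ord3P: t ux => //= ux; exfalso.
  have pj : inl j = nth (inl ord0) (inl ord0 :: s) i.
    by rewrite -[LHS]pK pu ux /arrive pK.
  case: i {ux} pj => [[|i] ik] /=; first by case=> e; rewrite e eqxx in j0.
  by have [w] := leave_inr (ltnW ik); rewrite /leave => -> .
have := arriveS (ltn_ord i); rewrite -ux -pu pK; case: eqP => [_ [e]|ik].
  by rewrite e eqxx in jl.
have ik' : (i.+1 < k.+1)%N by have := ltn_ord i; lia.
by have [w] := unfold_inr (Ordinal ik') o0 => /= ->.
Qed.

(** The order in which the middle leaves are attached to the spine, as a
    permutation. *)
Lemma leaf_position : exists sg : {perm 'I_k.+3},
  [/\ sg ord0 = ord0, sg l = l & forall j v, (sg^-1)%g j = v.+1 :> nat ->
    j != ord0 -> j != l -> exists2 w : 'I_k.+1, v = w & p (inl j) = g (inr (w, o1))].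
Proof.
have l0 : l != ord0 by [].
have /choice[f fP] : forall j, exists i : 'I_k.+3, [/\ (j = ord0 -> i = ord0), (j = l -> i = l) &
    j != ord0 -> j != l -> exists2 w : 'I_k.+1, i = w.+1 :> nat & p (inl j) = g (inr (w, o1))].
  move=> j; have [->|j0] := eqVneq j ord0.
    by exists ord0; split=> // e; move: l0; rewrite -e eqxx.
  have [->|jl] := eqVneq j l.
    by exists l; split=> // e; move: l0; rewrite e eqxx.
  have [w pw] := leaf_mid j0 jl.
  have wk : (w.+1 < k.+3)%N by have := ltn_ord w; lia.
  by exists (Ordinal wk); split=> [e|e|_ _]; [rewrite e eqxx in j0 | rewrite e eqxx in jl | exists w].
have f0 : f ord0 = ord0 by have [->] := fP ord0.
have fl : f l = l by have [_ ->] := fP l.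
have fmid j : j != ord0 -> j != l -> f j != ord0 /\ f j != l.
  move=> j0 jl; have [_ _ /(_ j0 jl)[w fj _]] := fP j.
  by rewrite -!(inj_eq val_inj) /= fj; split=> //; have := ltn_ord w; lia.
have f_inj : injective f.
  move=> i j; have [->|i0] := eqVneq i ord0.
    have [->//|j0] := eqVneq j ord0; have [->|jl] := eqVneq j l.
      by rewrite f0 fl => e; rewrite e eqxx in l0.
    by rewrite f0 => e; have [] := fmid _ j0 jl; rewrite -e eqxx.
  have [->|il] := eqVneq i l.
    have [->//|jl] := eqVneq j l; have [->|j0] := eqVneq j ord0.
      by rewrite f0 fl => e; rewrite e eqxx in l0.
    by rewrite fl => e; have [_] := fmid _ j0 jl; rewrite -e eqxx.
  have [->|j0] := eqVneq j ord0.
    by rewrite f0 => e; have [] := fmid _ i0 il; rewrite e eqxx.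
  have [->|jl] := eqVneq j l.
    by rewrite fl => e; have [_] := fmid _ i0 il; rewrite e eqxx.
  have [_ _ /(_ i0 il)[w fi pi]] := fP i; have [_ _ /(_ j0 jl)[w' fj pj]] := fP j.
  move=> e; have ww : w = w' by apply: val_inj; have := congr1 val e; rewrite /= fi fj => -[].
  have : p (inl i) = p (inl j) by rewrite pi pj ww.
  by move=> /(congr1 p); rewrite !pK => -[].
exists (perm f_inj)^-1%g; split.
- by apply: (canLR (permK _)); rewrite permE f0.
- by apply: (canLR (permK _)); rewrite permE fl.
move=> j v; rewrite invgK permE => fj j0 jl.
have [_ _ /(_ j0 jl)[w fw pw]] := fP j; exists w => //.
by have := etrans (esym fj) fw => -[].
Qed.

(** [unfold_spine] identifies the permuted comb with [T] up to cyclic orders. *)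
Lemma cls_full_spine : exists sg : {perm 'I_k.+3}, [/\ sg ord0 = ord0, sg l = l &
  cls (mktree T) = cls (mktree (relabel sg (comb k))) \/
  cls (mktree T) = - cls (mktree (relabel sg (comb k)))].
Proof.
have [sg [sg0 sgl sgP]] := leaf_position; exists sg; split=> //.
apply: (cls_fibre_preserving (s := g)) => //.
- exact: unfold_inj.
- by move=> [i|[i t]] [j|[j t']] // -[->]; rewrite !vert_unfold.
have [c0 cl cm cv] := comb_spec k.
have [cK _ _ _] := tree_onP (comb k).
set q := relabel sg (comb k).
pose qf : {ffun hf -> hf} := val q.
have qK : involutive qf by case: (tree_onP q).
pose lp := leaf_perm k.+1 sg.
have qE x : qf (lp x) = lp (val (comb k) x) by rewrite /qf /= conjE.
have lpl j : lp (inl j) = inl (sg j) by rewrite permE.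
have lpr u : lp (inr u) = inr u by rewrite permE.
suff A x : p (g x) = g (qf x) by move=> x; rewrite -/p A.
(* It suffices to treat one half-edge of each edge. *)
have Aq y : p (g y) = g (qf y) -> p (g (qf y)) = g (qf (qf y)).
  by move=> <-; rewrite qK pK.
have Al j : p (g (inl j)) = g (qf (inl j)).
  have [->|j0] := eqVneq j ord0.
    by rewrite -sg0 -lpl qE c0 lpr lpl sg0.
  have [->|jl] := eqVneq j l.
    rewrite -{2}sgl -lpl qE cl lpr /=.
    by rewrite -[LHS]/(p (inl l)) -(proj2 sp) pK (last_nth (inl ord0)) ss.
  have [i0 i0l] : (sg^-1)%g j != ord0 /\ (sg^-1)%g j != l.
    by split; rewrite -(inj_eq (@perm_inj _ sg)) permKV ?sg0 ?sgl.
  have [v jv] : exists v, (sg^-1)%g j = v.+1 :> nat.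
    move: i0; rewrite -(inj_eq val_inj) /=; case: (nat_of_ord _) => // v _; by exists v.
  have [w vw pw] := sgP j v jv j0 jl.
  rewrite [LHS]pw; congr g.
  rewrite -{1}(permKV sg j) -lpl qE (cm _ w) ?lpr //.
  by rewrite jv vw.
case: x => [j|[v]]; first exact: Al.
have q2 w : (w < k)%N -> forall (v w' : 'I_k.+1), v = w :> nat -> w' = w.+1 :> nat ->
    qf (inr (v, o2)) = inr (w', o0).
  by move=> wk {}v w' vw ww'; rewrite -lpr qE (cv v w') ?lpr // vw.
have A2 (w : 'I_k.+1) : p (g (inr (w, o2))) = g (qf (inr (w, o2))).
  have := arriveS (ltn_ord w); rewrite /=; case: eqP => [wk -> |wk ->].
    have -> : w = ord_max by apply: val_inj.
    by rewrite -lpr -[inr _ in RHS]cl qE cK lpl sgl.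
  have wk' : (w.+1 < k.+1)%N by have := ltn_ord w; lia.
  by rewrite (q2 w _ w (Ordinal wk')) //=; have := ltn_ord w; lia.
elim/ord3P.
- have [->|v0] := eqVneq v ord0.
    have <- : qf (inl ord0) = inr (ord0, o0) by rewrite -{1}sg0 -lpl qE c0 lpr.
    exact: Aq (Al _).
  have v0' : (0 < v)%N by rewrite lt0n; apply: contraNneq v0 => v0; apply/eqP/val_inj.
  have vk : (v.-1 < k.+1)%N by have := ltn_ord v; lia.
  have <- : qf (inr (Ordinal vk, o2)) = inr (v, o0).
    by apply: (q2 v.-1) => //=; have := ltn_ord v; lia.
  exact: Aq (A2 _).
- have vk : (v.+1 < k.+3)%N by have := ltn_ord v; lia.
  have <- : qf (inl (sg (Ordinal vk))) = inr (v, o1) by rewrite -lpl qE (cm _ v) ?lpr.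
  exact: Aq (Al _).
- exact: A2.
Qed.

End FullSpine.

Definition comb_class k (y : C k.+3) := exists sg : {perm 'I_k.+3},
  [/\ sg ord0 = ord0, sg ord_max = ord_max & y = cls (mktree (relabel sg (comb k)))].

(** Induction on the number of trivalent vertices off the spine. *)
Lemma spine_span k (T : tree_on k.+3 k.+1) s :
  @spine k.+3 k.+1 (val T) ord0 ord_max s -> span (@comb_class k) (cls (mktree T)).
Proof.
have [m] := ubnP (k.+1 - size s); elim: m T s => // m IH T s lem sp.
have us := spine_uniq (tree_onP T) sp.
have sk : (size s <= k.+1)%N.
  rewrite -(size_map (@vert _ _)) -[X in (_ <= X)%N]card_ord.
  rewrite -(card_imset _ (@inr_inj 'I_k.+3 'I_k.+1)) cardE.
  apply: uniq_leq_size; first by case/andP: us.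
  move=> _ /mapP[y ys ->]; have [[v i] ->] := walk_inner (proj1 sp) ys.
  by rewrite mem_enum; apply/imsetP; exists v.
have [e|ne] := eqVneq (size s) k.+1.
  have [sg [s0 sl [->|->]]] := cls_full_spine sp e.
    by apply: span_gen; exists sg.
  by apply/span_opp/span_gen; exists sg.
have [||T' [T'' [s' [s'' [-> sp' sp'' e' e'']]]]] := spine_step _ sp => //.
  by rewrite ltn_neqAle ne.
apply: span_sub; last by apply: IH sp''; lia.
by apply: span_opp; apply: IH sp'; lia.
Qed.

Lemma tree_vertices n (T : tree n.+2) : exists T' : tree_on n.+2 n, T = mktree T'.
Proof.
case: T => k T; have := tree_order (tree_onP T) isT.
rewrite addn2 => -[] e; subst k; by exists T.
Qed.

Theorem comb_span k (x : C k.+3) : span (@comb_class k) x.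
Proof.
apply: span_ind_closed (span_cls x); [exact: span0 | by move=> a u v; apply: spanZD |].
move=> _ [T ->]; have [{}T ->] := tree_vertices T.
have [||s sp] := @spine_exists k.+3 k.+1 (val T) ord0 ord_max => //.
  exact: tree_onP.
exact: spine_span sp.
Qed.

(** * Coordinates of tensors, insertion and contraction *)

Notation colouring := (nat -> sl2_basis).

Lemma set_at_same (xi : colouring) i w : set_at xi i w i = w.
Proof. by rewrite /set_at eqxx. Qed.

Section Evaluation.
Variable n : nat.
Implicit Types (t u : tens n) (xi : colouring).

(** Coordinates are indexed by colourings of all natural numbers, so that slots
    can be changed or added without changing types. *)
Definition ev t xi : rat := t [tuple xi i | i < n].

Lemma eq_ev t xi xi' : (forall i, (i < n)%N -> xi i = xi' i) -> ev t xi = ev t xi'.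
Proof.
by move=> e; rewrite /ev; congr (t _); apply/eq_from_tnth => i; rewrite !tnth_mktuple e.
Qed.

Lemma ev_nth t (x : n.-tuple sl2_basis) : ev t (nth Bh x) = t x.
Proof.
by rewrite /ev; congr (t _); apply/eq_from_tnth => i; rewrite tnth_mktuple (tnth_nth Bh).
Qed.

Lemma ev_inj t u : (forall xi, ev t xi = ev u xi) -> t = u.
Proof. by move=> e; apply/ffunP => x; rewrite -!ev_nth. Qed.

Definition tens_of (F : colouring -> rat) : tens n :=
  [ffun x : n.-tuple sl2_basis => F (nth Bh x)].

Lemma ev_of F xi :
    (forall xi xi', (forall i, (i < n)%N -> xi i = xi' i) -> F xi = F xi') ->
  ev (tens_of F) xi = F xi.
Proof.
move=> Fe; rewrite /ev ffunE; apply: Fe => i ni.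
by rewrite -(tnth_nth Bh _ (Ordinal ni)) tnth_mktuple.
Qed.

Lemma ev0 xi : ev 0 xi = 0. Proof. by rewrite /ev ffunE. Qed.
Lemma evD t u xi : ev (t + u) xi = ev t xi + ev u xi. Proof. by rewrite /ev ffunE. Qed.
Lemma evN t xi : ev (- t) xi = - ev t xi. Proof. by rewrite /ev ffunE. Qed.
Lemma evZ a t xi : ev (a *: t) xi = a * ev t xi. Proof. by rewrite /ev ffunE. Qed.
Definition evE := (ev0, evD, evN, evZ).
Lemma ev_sum (I : Type) (r : seq I) (P : pred I) (F : I -> tens n) xi :
  ev (\sum_(i <- r | P i) F i) xi = \sum_(i <- r | P i) ev (F i) xi.
Proof. by rewrite /ev sum_ffunE. Qed.

Lemma ev_act a t xi : ev (act a t) xi =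
  \sum_(j < n) \sum_z ev t (set_at xi j z) * bracket a z (xi j).
Proof.
rewrite /ev act_coord; apply: eq_bigr => j _; apply: eq_bigr => z _.
rewrite tnth_mktuple; congr (t _ * _); apply/eq_from_tnth => i.
by rewrite !tnth_mktuple /set_at.
Qed.

Lemma InvP t : reflect (forall a, act a t = 0) (t \in Inv n).
Proof.
rewrite mem_Inv; apply: (iffP forallP) => H a; apply/eqP; first exact: H.
by rewrite H.
Qed.

Definition permt (sg : {perm 'I_n}) t : tens n :=
  [ffun x => t [tuple tnth x (sg i) | i < n]].

Fact permt_linear sg : linear (permt sg).
Proof. by move=> a t u; apply/ffunP => x; rewrite !ffunE. Qed.
HB.instance Definition _ sg := GRing.isLinear.Build rat (tens n) (tens n) *:%R
  (permt sg) (permt_linear sg).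

Lemma permtM sg tau t : permt (tau * sg)%g t = permt sg (permt tau t).
Proof.
apply/ffunP => x; rewrite !ffunE; congr (t _); apply/eq_from_tnth => i.
by rewrite !tnth_mktuple permM.
Qed.

Lemma permt1 t : permt 1%g t = t.
Proof.
apply/ffunP => x; rewrite !ffunE; congr (t _); apply/eq_from_tnth => i.
by rewrite !tnth_mktuple perm1.
Qed.

Lemma ev_permt sg t xi :
  ev (permt sg t) xi = ev t (nth Bh [tuple xi (sg i) | i < n]).
Proof.
rewrite ev_nth /ev ffunE; congr (t _); apply/eq_from_tnth => i.
by rewrite !tnth_mktuple.
Qed.

Definition swap_at (xi : colouring) a b j := if j == a then xi b else if j == b then xi a else xi j.

Lemma ev_tperm (a b : 'I_n) t xi : ev (permt (tperm a b) t) xi = ev t (swap_at xi a b).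
Proof.
rewrite /ev ffunE; congr (t _); apply/eq_from_tnth => i; rewrite !tnth_mktuple /swap_at.
case: tpermP => [->|->|/eqP ia /eqP ib]; rewrite ?eqxx //.
  by case: eqP => // ->.
by rewrite !val_eqE (negPf ia) (negPf ib).
Qed.

Lemma act_permt sg a t : act a (permt sg t) = permt sg (act a t).
Proof.
apply/ffunP => x; rewrite ffunE !act_coord (reindex_inj (@perm_inj _ sg)).
apply: eq_bigr => j _; apply: eq_bigr => z _; rewrite ffunE tnth_mktuple.
congr (t _ * _); apply/eq_from_tnth => i; rewrite !tnth_mktuple.
by rewrite (inj_eq perm_inj).
Qed.

Lemma permt_Inv sg t : t \in Inv n -> permt sg t \in Inv n.
Proof. by move=> /InvP it; apply/InvP => a; rewrite act_permt it linear0. Qed.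

End Evaluation.

Definition b3 (x y z : sl2_basis) : rat := b_tens [tuple x; y; z].

Definition b3_val (x y z : sl2_basis) : rat :=
  match x, y, z with
  | Bh, Be, Bf | Be, Bf, Bh | Bf, Bh, Be => 1
  | Bh, Bf, Be | Bf, Be, Bh | Be, Bh, Bf => -1
  | _, _, _ => 0
  end.

Lemma b3E x y z : b3 x y z = b3_val x y z.
Proof.
by rewrite /b3 !ffunE !big_ord_recl !big_ord0 !(tnth_nth 0) !(tnth_nth Bh) /=
  !ffunE; case: x; case: y; case: z.
Qed.

Lemma b3C x y z : b3 y z x = b3 x y z.
Proof. by rewrite !b3E; case: x; case: y; case: z. Qed.
Lemma b3N x y z : b3 x z y = - b3 x y z.
Proof. by rewrite !b3E; case: x; case: y; case: z; rewrite ?opprK ?oppr0. Qed.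
Lemma kappaC x y : kappa x y = kappa y x.
Proof. by case: x; case: y. Qed.
Lemma b3_jacobi c1 c2 d1 d2 : \sum_a \sum_a' kappa a a' *
     (b3 a c1 c2 * b3 a' d1 d2 + b3 a c2 d1 * b3 a' c1 d2 + b3 a d1 c1 * b3 a' c2 d2)
     = 0.
Proof.
rewrite !big_sl2 !b3E /=.
by case: c1; case: c2; case: d1; case: d2; apply/eqP.
Qed.

(** The cobracket, that is, [b_tens] with its first index lowered by [kappa]. *)
Definition cobr (w y z : sl2_basis) : rat := \sum_v kappa v w * b3 v y z.

Definition cobr_val (w y z : sl2_basis) : rat :=
  match w, y, z with
  | Bh, Be, Bf => 2 | Bh, Bf, Be => -2
  | Be, Bh, Be | Bf, Bf, Bh => 1
  | Be, Be, Bh | Bf, Bh, Bf => -1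
  | _, _, _ => 0
  end.

Lemma cobrE w y z : cobr w y z = cobr_val w y z.
Proof. by rewrite /cobr big_sl2 !b3E; case: w; case: y; case: z; apply/eqP. Qed.

Lemma brE a x y : bracket a x y = match a, x, y with
  | Bh, Be, Be => 2 | Be, Bh, Be => -2
  | Bh, Bf, Bf => -2 | Bf, Bh, Bf => 2
  | Be, Bf, Bh => 1 | Bf, Be, Bh => -1
  | _, _, _ => 0 end.
Proof. by case: a; case: x; rewrite /= ?ffunE; case: y; rewrite ?ffunE /=; apply/eqP. Qed.

Section InsertContract.
Variable n : nat.

(** The cobracket applied to the last slot. *)
Definition Ins (u : tens n.+1) : tens n.+2 := tens_of n.+2
  (fun xi => \sum_w ev u (set_at xi n w) * cobr w (xi n) (xi n.+1)).

(** Half the bracket of the last two slots. *)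
Definition Con (t : tens n.+2) : tens n.+1 := tens_of n.+1
  (fun xi => \sum_y \sum_z ev t (set_at (set_at xi n y) n.+1 z) * (bracket y z (xi n) / 2)).

Lemma ev_Ins u xi : ev (Ins u) xi = \sum_w ev u (set_at xi n w) * cobr w (xi n) (xi n.+1).
Proof.
apply: ev_of => {}xi xi' e; apply: eq_bigr => w _; rewrite !e //; congr (_ * _).
by apply: eq_ev => i ni; rewrite /set_at; case: eqP => // _; apply: e; lia.
Qed.

Lemma ev_Con t xi : ev (Con t) xi =
  \sum_y \sum_z ev t (set_at (set_at xi n y) n.+1 z) * (bracket y z (xi n) / 2).
Proof.
apply: ev_of => {}xi xi' e; apply: eq_bigr => y _; apply: eq_bigr => z _.
rewrite !e //; congr (_ * _); apply: eq_ev => i ni; rewrite /set_at.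
case: eqP => // i1; case: eqP => // i2; apply: e; lia.
Qed.

Fact Ins_linear : linear Ins.
Proof.
move=> a u v; apply: ev_inj => xi; rewrite !(ev_Ins, evE) mulr_sumr -big_split /=.
by apply: eq_bigr => w _; rewrite !evE mulrDl mulrA.
Qed.
HB.instance Definition _ := GRing.isLinear.Build rat (tens n.+1) (tens n.+2) *:%R
  Ins Ins_linear.

Fact Con_linear : linear Con.
Proof.
move=> a u v; apply: ev_inj => xi; rewrite !(ev_Con, evE) mulr_sumr -big_split /=.
apply: eq_bigr => y _; rewrite mulr_sumr -big_split /=.
by apply: eq_bigr => z _; rewrite !evE mulrDl mulrA.
Qed.
HB.instance Definition _ := GRing.isLinear.Build rat (tens n.+2) (tens n.+1) *:%R
  Con Con_linear.

(** The cobracket is invariant; at the other slots there is nothing to show. *)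
Lemma act_Ins a u : act a (Ins u) = Ins (act a u).
Proof.
apply: ev_inj => xi; rewrite ev_act ev_Ins.
transitivity (\sum_w (\sum_(j < n.+1) \sum_v
    ev u (set_at (set_at xi n w) j v) * bracket a v (set_at xi n w j))
    * cobr w (xi n) (xi n.+1)); last by apply: eq_bigr => w _; rewrite ev_act.
under [RHS]eq_bigr => w _ do rewrite big_ord_recr mulrDl /=.
rewrite [RHS]big_split /= !big_ord_recr /= -addrA; congr (_ + _).
  under [RHS]eq_bigr => w _ do rewrite mulr_suml.
  rewrite [RHS]exchange_big /=; apply: eq_bigr => j _; have jn : (j : nat) != n by have := ltn_ord j; lia.
  have jn1 : (j : nat) != n.+1 by have := ltn_ord j; lia.
  under [RHS]eq_bigr => w _ do rewrite mulr_suml.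
  rewrite [RHS]exchange_big /=; apply: eq_bigr => v _; rewrite ev_Ins mulr_suml.
  apply: eq_bigr => w _; rewrite mulrAC /set_at ![n == _]eq_sym ![n.+1 == _]eq_sym (negPf jn) (negPf jn1).
  congr (_ * _ * _); apply: eq_ev => i _; case: eqP => // ->; by rewrite eq_sym (negPf jn).
pose U w := ev u (set_at xi n w).
under eq_bigr => v _ do rewrite ev_Ins.
under [X in _ + X]eq_bigr => v _ do rewrite ev_Ins.
transitivity (\sum_v (\sum_w U w * cobr w v (xi n.+1)) * bracket a v (xi n)
   + \sum_v (\sum_w U w * cobr w (xi n) v) * bracket a v (xi n.+1)).
  congr (_ + _); apply: eq_bigr => v _; congr (_ * _); apply: eq_bigr => w _.
    rewrite /set_at eqxx (_ : (n.+1 == n) = false); last by lia.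
    by congr (_ * _); apply: eq_ev => i _; rewrite /set_at; case: eqP.
  rewrite /set_at eqxx (_ : (n == n.+1) = false); last by lia.
  by congr (_ * _); apply: eq_ev => i ni; rewrite /set_at; case: eqP => // _; case: eqP => // e; lia.
transitivity (\sum_w (\sum_v U v * bracket a v w) * cobr w (xi n) (xi n.+1)); last first.
  apply: eq_bigr => w _; congr (_ * _); apply: eq_bigr => v _.
  by rewrite set_at_same; congr (_ * _); apply: eq_ev => i _; rewrite /set_at; case: eqP.
rewrite !big_sl2 !cobrE /cobr_val !brE.
by case: a; case: (xi n); case: (xi n.+1); ring.
Qed.

(** The bracket is invariant by the Jacobi identity. *)
Lemma act_Con a t : act a (Con t) = Con (act a t).
Proof.
apply: ev_inj => xi; rewrite ev_act ev_Con big_ord_recr /=.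
under [RHS]eq_bigr => y _ do under eq_bigr => z _ do
  rewrite ev_act !big_ord_recr /= -addrA mulrDl.
under [RHS]eq_bigr => y _ do rewrite big_split /=.
rewrite [RHS]big_split /=; congr (_ + _).
  under [RHS]eq_bigr => y _ do under eq_bigr => z _ do rewrite mulr_suml.
  under [RHS]eq_bigr => y _ do rewrite exchange_big /=.
  rewrite [RHS]exchange_big /=; apply: eq_bigr => j _.
  have jn : (j : nat) != n by have := ltn_ord j; lia.
  have jn1 : (j : nat) != n.+1 by have := ltn_ord j; lia.
  under [RHS]eq_bigr => y _ do under eq_bigr => z _ do rewrite mulr_suml.
  under [RHS]eq_bigr => y _ do rewrite exchange_big /=.
  rewrite [RHS]exchange_big /=; apply: eq_bigr => v _; rewrite ev_Con mulr_suml.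
  apply: eq_bigr => y _; rewrite mulr_suml; apply: eq_bigr => z _.
  rewrite mulrAC /set_at ![n == _]eq_sym (negPf jn) (negPf jn1).
  congr (_ * _ * _); apply: eq_ev => i _.
  case: eqP => [->|_]; first by rewrite eq_sym (negPf jn1).
  by case: eqP => [->|_] //; rewrite eq_sym (negPf jn).
pose U y z := ev t (set_at (set_at xi n y) n.+1 z).
transitivity (\sum_v (\sum_y \sum_z U y z * (bracket y z v / 2)) * bracket a v (xi n)).
  apply: eq_bigr => v _; rewrite ev_Con; congr (_ * _); apply: eq_bigr => y _.
  apply: eq_bigr => z _; rewrite set_at_same; congr (_ * _).
  by apply: eq_ev => i _; rewrite /set_at; case: eqP => // _; case: eqP.
transitivity (\sum_y \sum_z (\sum_v U v z * bracket a v y + \sum_v U y v * bracket a v z)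
    * (bracket y z (xi n) / 2)); last first.
  apply: eq_bigr => y _; apply: eq_bigr => z _; congr (_ * _); congr (_ + _); apply: eq_bigr => v _.
    rewrite /set_at eqxx (_ : (n == n.+1) = false); last by lia.
    congr (_ * _); apply: eq_ev => i ni; rewrite /set_at; case: eqP => [->|]; last by case: eqP.
    by rewrite (_ : (n.+1 == n) = false) //; lia.
  rewrite set_at_same; congr (_ * _); apply: eq_ev => i ni; by rewrite /set_at; case: eqP.
rewrite !big_sl2 !brE.
by case: a; case: (xi n); field.
Qed.

Lemma Ins_Inv u : u \in Inv n.+1 -> Ins u \in Inv n.+2.
Proof. by move=> /InvP iu; apply/InvP => a; rewrite act_Ins iu linear0. Qed.

Lemma Con_Inv t : t \in Inv n.+2 -> Con t \in Inv n.+1.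
Proof. by move=> /InvP it; apply/InvP => a; rewrite act_Con it linear0. Qed.

Definition last_swap : {perm 'I_n.+2} := tperm (newleaf1 n) (newleaf2 n).

Lemma ev_last_swap t xi : ev (permt last_swap t) xi =
  ev t (set_at (set_at xi n (xi n.+1)) n.+1 (xi n)).
Proof.
rewrite ev_tperm; apply: eq_ev => i ni; rewrite /swap_at /set_at /= /bump.
rewrite ltnn add0n; case: eqP => [->|_]; last by [].
by rewrite (_ : (n == n.+1) = false) //; lia.
Qed.

(** The alternating tensors in two slots form a copy of the adjoint
    representation, and cobracket after half the bracket is twice the projection
    onto them. *)
Lemma Ins_Con t : Ins (Con t) = t - permt last_swap t.
Proof.
apply: ev_inj => xi; rewrite ev_Ins !evE ev_last_swap.
pose U y z := ev t (set_at (set_at xi n y) n.+1 z).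
transitivity (\sum_w (\sum_y \sum_z U y z * (bracket y z w / 2)) * cobr w (xi n) (xi n.+1)).
  apply: eq_bigr => w _; rewrite ev_Con; congr (_ * _); apply: eq_bigr => y _.
  apply: eq_bigr => z _; rewrite set_at_same; congr (_ * _).
  by apply: eq_ev => i _; rewrite /set_at; case: eqP => // _; case: eqP.
have -> : ev t xi = U (xi n) (xi n.+1).
  apply: eq_ev => i _; rewrite /set_at; case: eqP => [->//|_]; by case: eqP => [->|].
rewrite -/(U _ _) !big_sl2 !brE !cobrE /cobr_val.
by case: (xi n); case: (xi n.+1); field.
Qed.

Lemma Ins_antisym u : permt last_swap (Ins u) = - Ins u.
Proof.
apply: ev_inj => xi; rewrite ev_last_swap evN !ev_Ins -sumrN; apply: eq_bigr => w _.
rewrite -mulrN; congr (_ * _).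
  by apply: eq_ev => i ni; rewrite /set_at; case: eqP => // _; case: eqP => // e; lia.
rewrite /set_at !eqxx (_ : (n == n.+1) = false); last by lia.
by rewrite !cobrE; case: w; case: (xi n); case: (xi n.+1); rewrite ?opprK ?oppr0.
Qed.

End InsertContract.

(** * Symmetric invariants *)

Section SymmetricInvariants.
Variable n : nat.
Implicit Types (x y : n.-tuple sl2_basis).

Definition cnt a x : nat := \sum_(i < n) (tnth x i == a : nat).

Lemma cnt_count a x : cnt a x = count_mem a x.
Proof. by rewrite -sum1_count big_tuple [RHS]big_mkcond; apply: eq_bigr => i _; rewrite /=; case: eqP. Qed.

Lemma cnt_subst a x j z : (cnt a (subst x j z) + (tnth x j == a) = cnt a x + (z == a))%N.
Proof.
rewrite /cnt (bigD1 j) //= [in RHS](bigD1 j) //= tnth_mktuple eqxx.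
have -> : (\sum_(i < n | i != j) (tnth (subst x j z) i == a) = \sum_(i < n | i != j) (tnth x i == a))%N.
  by apply: eq_bigr => i ij; rewrite tnth_mktuple (negPf ij).
set S := (\sum_(i < n | _) _)%N; ring.
Qed.

Lemma cnt_total x : (cnt Bh x + cnt Be x + cnt Bf x = n)%N.
Proof.
rewrite -!big_split /= -[RHS]card_ord -sum1_card; apply: eq_bigr => i _.
by case: (tnth x i).
Qed.

Lemma cnt_perm x y : cnt Be x = cnt Be y -> cnt Bf x = cnt Bf y -> perm_eq x y.
Proof.
move=> ee ef; have eh : cnt Bh x = cnt Bh y by have := cnt_total x; have := cnt_total y; lia.
by apply/allP => -[] _; rewrite /= -!cnt_count ?ee ?ef ?eh.
Qed.

Lemma cnt_gt0 a x : (0 < cnt a x)%N -> exists j, tnth x j = a.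
Proof.
move=> c0; have /existsP[j /eqP] : [exists j, tnth x j == a]; last by exists j.
apply: contraTT c0; rewrite negb_exists => /forallP H.
by rewrite -leqNgt leqn0; apply/eqP/big1 => i _; rewrite (negPf (H i)).
Qed.

Variable s : tens n.
Hypotheses (s_inv : s \in Inv n) (s_sym : forall sg, permt sg s = s).

Lemma sym_cnt x y : cnt Be x = cnt Be y -> cnt Bf x = cnt Bf y -> s x = s y.
Proof.
move=> ee ef; have /tuple_permP[sg xy] := cnt_perm ee ef.
by rewrite -[in RHS](s_sym sg) ffunE; congr (s _); apply: val_inj.
Qed.

(** [h] acts on a basis tensor by its weight. *)
Lemma sym_weight x : cnt Be x != cnt Bf x -> s x = 0.
Proof.
move=> ne; have /InvP/(_ Bh)/(congr1 (fun t : tens n => t x)) := s_inv.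
rewrite act_coord ffunE.
have -> : \sum_(j < n) \sum_z s (subst x j z) * bracket Bh z (tnth x j) =
    s x * (2 * (cnt Be x)%:R - 2 * (cnt Bf x)%:R).
  rewrite /cnt !natr_sum !mulr_sumr -sumrB mulr_sumr; apply: eq_bigr => j _.
  have sj : subst x j (tnth x j) = x.
    by apply/eq_from_tnth => i; rewrite tnth_mktuple; case: eqP => [->|].
  by rewrite big_sl2 !brE; case xj : (tnth x j) sj => sj /=; rewrite ?sj; ring.
move/eqP; rewrite mulf_eq0 => /orP[/eqP//|].
by rewrite -mulrBr mulf_eq0 /= subr_eq0 eqr_nat (negPf ne).
Qed.

(** This is the coordinate at [y] of the action of [e].  By symmetry it is a
    recursion between coefficients that differ by one pair [e], [f]. *)
Lemma sym_raise y : \sum_(j < n | tnth y j == Bh) s (subst y j Bf) =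
  2 * \sum_(j < n | tnth y j == Be) s (subst y j Bh).
Proof.
have /InvP/(_ Be)/(congr1 (fun t : tens n => t y)) := s_inv.
rewrite act_coord ffunE => H; apply/eqP; rewrite -subr_eq0; apply/eqP; rewrite -[RHS]H {H}.
rewrite mulr_sumr big_mkcond [X in _ - X]big_mkcond -sumrB; apply: eq_bigr => j _.
by rewrite big_sl2 !brE; case: (tnth y j) => /=; ring.
Qed.

(** Each coefficient is a multiple of the one with a pair [e], [f] less, down to
    that of h, ..., h. *)
Lemma sym_even : s [tuple Bh | i < n] = 0 -> s = 0.
Proof.
move=> s0; apply/ffunP => x; rewrite ffunE.
have [ef|] := eqVneq (cnt Be x) (cnt Bf x); last exact: sym_weight.
have [a ae] : exists a, cnt Be x = a by exists (cnt Be x).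
have af : cnt Bf x = a by rewrite -ef.
elim: a x {ef} ae af => [|a IH] x ae af.
  rewrite -s0; apply: sym_cnt; rewrite ?ae ?af /cnt big1 // => i _; by rewrite tnth_mktuple.
have [j0 xj0] : exists j, tnth x j = Bf by apply: cnt_gt0; rewrite af.
pose y := subst x j0 Bh.
have ye := cnt_subst Be x j0 Bh; have yf := cnt_subst Bf x j0 Bh.
rewrite xj0 /= ae af -/y in ye yf.
have := sym_raise y; rewrite [X in 2 * X]big1 ?mulr0 => [|j /eqP yj]; last first.
  have := cnt_subst Be y j Bh; have := cnt_subst Bf y j Bh; rewrite yj /= => ? ?.
  by apply: IH; lia.
have -> : \sum_(j < n | tnth y j == Bh) s (subst y j Bf) = \sum_(j < n | tnth y j == Bh) s x.
  apply: eq_bigr => j /eqP yj.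
  have := cnt_subst Be y j Bf; have := cnt_subst Bf y j Bf; rewrite yj /= => ? ?.
  by apply: sym_cnt; lia.
rewrite sumr_const => /eqP; rewrite mulrn_eq0 => /orP[|/eqP//].
rewrite -leqn0 leqNgt; case/negP; apply/card_gt0P; exists j0.
by rewrite unfold_in /= tnth_mktuple eqxx.
Qed.

(** If [n] is odd, a coefficient of weight zero has some [h], and it is a
    multiple of the coefficient with a pair [e], [f] more; when no two [h]'s are
    left to be replaced, the recursion says that it is zero. *)
Lemma sym_odd : odd n -> s = 0.
Proof.
move=> on; apply/ffunP => x; rewrite ffunE.
have [ef|] := eqVneq (cnt Be x) (cnt Bf x); last exact: sym_weight.
have [m] := ubnP (cnt Bh x); elim: m x ef => // m IH x ef lem.
have tot := cnt_total x.
have h0 : (0 < cnt Bh x)%N.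
  by rewrite lt0n; apply: contraTneq on => h0; rewrite -tot h0 ef add0n addnn odd_double.
have [j0 xj0] := cnt_gt0 h0.
pose y := subst x j0 Be.
have yh := cnt_subst Bh x j0 Be; have ye := cnt_subst Be x j0 Be; have yf := cnt_subst Bf x j0 Be.
rewrite xj0 /= -/y in yh ye yf.
have := sym_raise y; rewrite big1 => [|j /eqP yj]; last first.
  have := cnt_subst Be y j Bf; have := cnt_subst Bf y j Bf; have := cnt_subst Bh y j Bf.
  by rewrite yj /= => ? ? ?; apply: IH; lia.
have -> : \sum_(j < n | tnth y j == Be) s (subst y j Bh) = \sum_(j < n | tnth y j == Be) s x.
  apply: eq_bigr => j /eqP yj.
  have := cnt_subst Be y j Bh; have := cnt_subst Bf y j Bh; rewrite yj /= => ? ?.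
  by apply: sym_cnt; lia.
rewrite sumr_const => /esym/eqP; rewrite mulf_eq0 /= mulrn_eq0 => /orP[|/eqP//].
rewrite -leqn0 leqNgt; case/negP; apply/card_gt0P; exists j0.
by rewrite unfold_in /= tnth_mktuple eqxx.
Qed.

End SymmetricInvariants.

(** * Tensors of trees *)

(** From three leaves on [W_contract] is the weight system; with fewer slots
    the span is zero, which starts the inductions. *)
Definition tree_tensor n (t : tens n) := (3 <= n)%N /\ exists T : tree n, t = W_contract T.
Notation J n := (span (@tree_tensor n)).

Section TreeTensors.

Lemma W_contractE n k (T : tree_on n k) xi :
  ev (W_contract (mktree T)) xi = state kappa (val T) (verts b3) (fun i => xi i).
Proof.
case: T => p tp; rewrite /ev /W_contract /= ffunE /state; apply: eq_big => [col|col _].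
  by apply: eq_forallb => j; rewrite tnth_mktuple.
congr (_ * _); apply: eq_bigr => v _; rewrite /b3; congr (b_tens _).
apply/eq_from_tnth => t; rewrite tnth_mktuple.
by elim/ord3P: t; rewrite (tnth_nth Bh).
Qed.

Lemma W_relabel n k (T : tree_on n.+1 k) sg :
  W_contract (mktree (relabel sg T)) = permt sg (W_contract (mktree T)).
Proof.
apply: ev_inj => xi; rewrite ev_permt !W_contractE (state_relabel _ kappaC).
rewrite /state; apply: eq_bigl => col; apply: eq_forallb => j.
have e : nth Bh [tuple xi (sg i) | i < n.+1] j = xi (sg j).
  by rewrite -tnth_nth tnth_mktuple.
by rewrite e.
Qed.

Lemma leaf_inr_last n k (T : tree_on n.+1 k) : (3 <= n.+1)%N ->
  if val T (inl ord_max) is inr _ then true else false.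
Proof.
move=> n3; have tT := tree_onP T.
have k0 : (0 < k)%N by have := tree_order tT isT; lia.
by have [u ->] := leaf_inr ord_max tT k0.
Qed.

Lemma W_graft n k (T : tree_on n.+1 k) : (3 <= n.+1)%N ->
  W_contract (mktree (graft T)) = Ins (W_contract (mktree T)).
Proof.
move=> n3; have [pK pN _ _] := tree_onP T; apply: ev_inj => xi.
rewrite ev_Ins W_contractE /= (state_graft _ kappaC) //; last exact: leaf_inr_last.
apply: eq_bigr => w' _; rewrite W_contractE; congr (_ * _).
  rewrite /state; apply: eq_bigl => col; apply: eq_forallb => j.
  have -> : old_colours (fun i : 'I_n.+2 => xi i) w' j = set_at xi n w' j.
    by rewrite /old_colours /set_at -(inj_eq val_inj) lift_max.
  by [].
by apply: eq_bigr => w _; rewrite /= /bump ltnn.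
Qed.

Lemma J_permt n sg (t : tens n) : J n t -> J n (permt sg t).
Proof.
move: t; apply: span_ind_closed => [|a u v Ju Jv|_ [n3 [[k T] ->]]].
- by rewrite linear0; apply: span0.
- by rewrite linearP; apply: spanZD.
case: n sg n3 T => // n sg n3 T; rewrite -[existT _ _ _]/(mktree T) -W_relabel.
by apply: span_gen; split=> //; eexists.
Qed.

Lemma J_Ins n (t : tens n.+1) : J n.+1 t -> J n.+2 (Ins t).
Proof.
move: t; apply: span_ind_closed => [|a u v Ju Jv|_ [n3 [[k T] ->]]].
- by rewrite linear0; apply: span0.
- by rewrite linearP; apply: spanZD.
rewrite -[existT _ _ _]/(mktree T) -W_graft //.
by apply: span_gen; split; [lia | eexists].
Qed.

Lemma ev_cpow n xi : ev (cpow n) xi = \prod_(i < n./2) c_tens [tuple xi i.*2; xi i.*2.+1].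
Proof.
rewrite /ev ffunE; apply: eq_bigr => i _; congr (c_tens _).
have i2 : (i.*2.+1 < n)%N by have := ltn_ord i; lia.
have e m : (m < n)%N -> nth Bh [tuple xi i | i < n] m = xi m.
  by move=> mn; rewrite -(tnth_nth Bh _ (Ordinal mn)) tnth_mktuple.
by apply: val_inj; rewrite /= !e //; lia.
Qed.

Lemma Ins_cpow2 : Ins (cpow 2) = W_contract (mktree tripod).
Proof.
apply: ev_inj => xi; rewrite ev_Ins W_contractE (@state_comb _ b3 _ kappaC 0 _ xi) //=.
under eq_bigr => w _ do rewrite ev_cpow big_ord1 c_tensE /set_at /= cobrE.
rewrite big_sl2 b3E.
by case: (xi 0); case: (xi 1); case: (xi 2); apply/eqP.
Qed.

End TreeTensors.

(** * Invariants are symmetric modulo trees *)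

Definition all_h : colouring := fun=> Bh.

Lemma ev_permt_all_h n sg (t : tens n) : ev (permt sg t) all_h = ev t all_h.
Proof.
by rewrite ev_permt; apply: eq_ev => i ni; rewrite -(tnth_nth Bh _ (Ordinal ni)) tnth_mktuple.
Qed.

(** The average of [t] is a symmetric invariant with the same coordinate at
    h, ..., h, so it vanishes. *)
Lemma average n (t : tens n) :
    (forall t, t \in Inv n -> forall sg, J n (t - permt sg t)) ->
  t \in Inv n -> odd n \/ ev t all_h = 0 -> J n t.
Proof.
move=> symJ it t0; pose S := \sum_(sg : {perm 'I_n}) permt sg t.
have S_sym tau : permt tau S = S.
  rewrite /S linear_sum /= [RHS](reindex_inj (mulIg tau)) /=.
  by apply: eq_bigr => sg _; rewrite permtM.
have S_inv : S \in Inv n by apply: rpred_sum => sg _; apply: permt_Inv.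
have S0 : S = 0.
  case: t0 => [n_odd|t0]; first exact: (sym_odd S_inv S_sym n_odd).
  apply: (sym_even S_inv S_sym); rewrite -[LHS]/(ev S all_h) ev_sum big1 // => sg _.
  by rewrite ev_permt_all_h.
have : J n (\sum_(sg : {perm 'I_n}) (t - permt sg t)) by apply: span_sum => sg _; apply: symJ.
rewrite sumrB -/S S0 subr0 sumr_const => Jt.
have c0 : #|{perm 'I_n}|%:R != 0 :> rat.
  by rewrite pnatr_eq0 -lt0n; apply/card_gt0P; exists 1%g.
by rewrite -[t](scalerK c0) scaler_nat; apply: span_scale.
Qed.

Lemma perm_two (T : finType) (a b i j : T) : a != b -> i != j ->
  exists s : {perm T}, s a = i /\ s b = j.
Proof.
move=> ab ij; exists (tperm a i * tperm (tperm a i b) j)%g; rewrite !permM tpermL tpermL.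
split=> //; rewrite tpermD // 1?eq_sym // -{1}(tpermL a i) (inj_eq perm_inj) //.
Qed.

(** All transpositions are conjugate to the exchange of the last two slots, and
    both [Inv] and the span of trees are stable under permutations. *)
Lemma sym_of_last_swap n :
    (forall t, t \in Inv n.+2 -> J n.+2 (t - permt (last_swap n) t)) ->
  forall t, t \in Inv n.+2 -> forall sg, J n.+2 (t - permt sg t).
Proof.
move=> H t it sg; have [ts -> dts] := prod_tpermP sg.
elim: ts dts t it => [_|[i j] ts IH /= /andP[ij dts]] t it.
  by rewrite big_nil permt1 subrr; apply: span0.
rewrite big_cons permtM /=.
set r := (\prod_(_ <- _) _)%g.
have -> : t - permt r (permt (tperm i j) t)
  = (t - permt (tperm i j) t) + (permt (tperm i j) t - permt r (permt (tperm i j) t)).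
  by rewrite addrA subrK.
apply: span_add; last by apply: IH => //; apply: permt_Inv.
have [|s [sa sb]] := @perm_two _ (newleaf1 n) (newleaf2 n) i j _ ij.
  by rewrite eq_sym; apply: neq_lift.
have -> : tperm i j = (s^-1 * last_swap n * s)%g.
  by rewrite -sa -sb -tpermJ /conjg mulgA.
rewrite !permtM; have -> : t - permt s (permt (last_swap n) (permt s^-1%g t))
  = permt s (permt s^-1%g t - permt (last_swap n) (permt s^-1%g t)).
  by rewrite linearB /= -[permt s (permt s^-1%g t)]permtM mulVg permt1.
by apply/J_permt/H/permt_Inv.
Qed.

Lemma ev_cpow_h n : ev (cpow n) all_h = 2^-1 ^+ n./2.
Proof.
rewrite ev_cpow (eq_bigr (fun=> 2^-1)) => [|i _]; last by rewrite c_tensE.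
by rewrite prodr_const card_ord.
Qed.

Lemma ev_cpow_eq0 n q xi : ~~ odd q -> (q.+1 < n)%N ->
  xi q = Bh -> xi q.+1 != Bh -> ev (cpow n) xi = 0.
Proof.
move=> oq qn xq xq1; have q2 : (q./2 < n./2)%N by lia.
have qe : q = q./2.*2 by lia.
rewrite ev_cpow (bigD1 (Ordinal q2)) //= -qe c_tensE xq.
by case: (xi q.+1) xq1 => // _; rewrite mul0r.
Qed.

(** The multiple of [cpow n] is chosen to cancel the coordinate at h, ..., h. *)
Lemma cpow_coker n (t : tens n) :
    (forall t, t \in Inv n -> forall sg, J n (t - permt sg t)) ->
  ~~ odd n -> t \in Inv n -> exists a, J n (t - a *: cpow n).
Proof.
move=> symJ en it; exists (ev t all_h / (2^-1 ^+ n./2)).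
apply: average => //; first by rewrite rpredB // rpredZ // cpow_Inv.
right; rewrite !evE ev_cpow_h divfK ?subrr // expf_neq0 //.
Qed.

(** The tensor [D] below is a product of copies of [c] and one [b_tens] in the
    last three slots.  Exchange the slot [s] of the last factor [c] with one of
    the last two slots of [D]: contracting the last two slots then gives an
    invariant that vanishes at h, ..., h, because the factor [c] pairs [h] with
    [e] or [f].  This contraction is therefore a combination of trees, and so is
    the difference made by exchanging the last two slots.  Undoing the first
    exchange, [D] is unchanged modulo trees by the two transpositions of [s]
    with a last slot.  These generate the exchange of the last two slots, which
    negates [D]. *)
Lemma Ins_cpow_J q : ~~ odd q ->
    (forall t, t \in Inv q.+4 -> ev t all_h = 0 -> J q.+4 t) ->
  J q.+4.+1 (Ins (cpow q.+4)).
Proof.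
move=> eq_ HJ; set D := Ins (cpow q.+4).
have e4 : ~~ odd q.+4 by rewrite /= !negbK.
have iD : D \in Inv q.+4.+1 by apply/Ins_Inv/cpow_Inv.
pose s : 'I_q.+4.+1 := inord q.+1.
pose a := newleaf1 q.+3; pose b := newleaf2 q.+3.
have sE : s = q.+1 :> nat by rewrite inordK //; lia.
have aE : a = q.+3 :> nat by rewrite /a /newleaf1 /= /bump; lia.
have bE : b = q.+4 :> nat by [].
have sa : s != a by rewrite -(inj_eq val_inj) [val s]sE [val a]aE; lia.
have sb : s != b by rewrite -(inj_eq val_inj) [val s]sE [val b]bE; lia.
have ab : a != b by rewrite -(inj_eq val_inj) [val a]aE [val b]bE; lia.
pose xi y z := set_at (set_at all_h q.+3 y) q.+4 z.
have D0 s' y z : (s' = a /\ y != Bh) \/ (s' = b /\ z != Bh) ->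
    ev (permt (tperm s s') D) (xi y z) = 0.
  move=> H; rewrite ev_tperm ev_Ins big1 // => w _.
  have q14 : (q.+1 < q.+4)%N by lia.
  rewrite (ev_cpow_eq0 (q := q)) ?mul0r //; rewrite /set_at /swap_at sE.
    rewrite (_ : (q == q.+3) = false); last by lia.
    rewrite (_ : (q == q.+1) = false); last by lia.
    have -> : (q == s') = false by case: H => -[-> _]; rewrite ?aE ?bE; lia.
    rewrite /xi /set_at (_ : (q == q.+3) = false); last by lia.
    by rewrite (_ : (q == q.+4) = false) //; lia.
  rewrite (_ : (q.+1 == q.+3) = false); last by lia.
  rewrite eqxx /xi /set_at; case: H => -[-> ny]; rewrite ?aE ?bE ?eqxx //.
  by rewrite (_ : (q.+3 == q.+4) = false) //; lia.
have Con0 s' : s' = a \/ s' = b -> ev (Con (permt (tperm s s') D)) all_h = 0.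
  move=> H; rewrite ev_Con big1 // => y _; rewrite big1 // => z _; rewrite brE.
  have [yz|] := boolP ((y != Bh) && (z != Bh)).
    case/andP: yz => ny nz; rewrite -/(xi y z) D0 ?mul0r //.
    by case: H; [left | right].
  by case: (y); case: (z) => //= _; rewrite mul0r mulr0.
have swapD s' : s' = a \/ s' = b ->
    J q.+4.+1 (D - permt (tperm s s' * last_swap q.+3 * tperm s s')%g D).
  move=> H; have := J_Ins (HJ _ (Con_Inv (permt_Inv (tperm s s') iD)) (Con0 s' H)).
  rewrite Ins_Con => /(J_permt (tperm s s')); rewrite linearB /= -permtM tperm2 permt1.
  by rewrite !permtM.
have conj_tperm (u : {perm 'I_q.+4.+1}) c :
    (tperm s c * u * tperm s c = u ^ tperm s c)%g by rewrite /conjg tpermV mulgA.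
have J1 : J q.+4.+1 (D - permt (tperm s b) D).
  have := swapD a (or_introl erefl).
  by rewrite conj_tperm tpermJ tpermR tpermD // eq_sym.
have J2 : J q.+4.+1 (D - permt (tperm s a) D).
  have := swapD b (or_intror erefl).
  by rewrite conj_tperm tpermJ tpermR tpermD // 1?eq_sym // tpermC.
have tau : last_swap q.+3 = (tperm s b * tperm s a * tperm s b)%g.
  by rewrite conj_tperm tpermJ tpermL tpermD // 1?eq_sym // tpermC.
have J3 : J q.+4.+1 (D - permt (last_swap q.+3) D).
  rewrite tau !permtM.
  have -> : D - permt (tperm s b) (permt (tperm s a) (permt (tperm s b) D))
    = (D - permt (tperm s b) D) + (permt (tperm s b) (D - permt (tperm s a) D)
      + permt (tperm s b) (permt (tperm s a) (D - permt (tperm s b) D))).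
    by rewrite !linearB /= !addrA !subrK.
  by apply: span_add => //; apply: span_add; do ?apply: J_permt.
move: J3; rewrite Ins_antisym opprK -mulr2n -scaler_nat => /(span_scale (2^-1)).
by rewrite scalerA mulVf // scale1r.
Qed.

(** By [Ins_Con] the difference made by exchanging the last two slots is inserted
    from an invariant of lower degree, which by induction is a combination of
    trees and a power of [c]. *)
Theorem Inv_sym_mod_trees n (t : tens n.+1) : t \in Inv n.+1 ->
  forall sg, J n.+1 (t - permt sg t).
Proof.
elim: n t => [|n IH] t it.
  move=> sg; suff -> : permt sg t = t by rewrite subrr; apply: span0.
  apply: ev_inj => xi; rewrite ev_permt; apply: eq_ev => -[|//] _.
  by rewrite -(tnth_nth Bh _ ord0) tnth_mktuple [sg _]ord1.
move: t it; apply: sym_of_last_swap => t it; rewrite -Ins_Con.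
have iu := Con_Inv it; move: (Con t) iu => u iu {t it}.
have [odn|evn] := boolP (odd n.+1).
  by apply/J_Ins/average => //; left.
have [a Ja] := cpow_coker IH evn iu.
have -> : u = (u - a *: cpow n.+1) + a *: cpow n.+1 by rewrite subrK.
rewrite linearD /=; apply: span_add; first exact: J_Ins.
rewrite linearZ /=; apply: span_scale; case: n IH u iu evn a Ja => [|[|[|q]]] // IH u iu evn a Ja.
  by rewrite Ins_cpow2; apply: span_gen; split=> //; eexists.
apply: Ins_cpow_J; first by move: evn; rewrite /= !negbK.
by move=> v iv v0; apply: average => //; right.
Qed.

(** * The weight system of matrix units *)

Section MatrixUnits.
Variable N : nat.
Local Notation X := ('I_N * 'I_N)%type.
Implicit Types x y z w : X.

(** A pair stands for a matrix unit; [glue x y] tells whether the product of the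
    two is nonzero.  Then [gl_b] is the trace of [x (y z - z y)] and [gl_kap]
    the trace form. *)
Definition glue x y : rat := (x.2 == y.1)%:R.
Definition gl_b x y z := glue x y * glue y z * glue z x - glue x z * glue z y * glue y x.
Definition gl_kap x y := glue x y * glue y x.

Lemma gl_kapC x y : gl_kap x y = gl_kap y x. Proof. exact: mulrC. Qed.
Lemma gl_bC x y z : gl_b y z x = gl_b x y z. Proof. by rewrite /gl_b; ring. Qed.
Lemma gl_bN x y z : gl_b x z y = - gl_b x y z. Proof. by rewrite /gl_b; ring. Qed.

Definition flip x : X := (x.2, x.1).

Lemma gl_kapE x y : gl_kap x y = (y == flip x)%:R.
Proof.
case: x y => x1 x2 [y1 y2]; rewrite /gl_kap /glue /flip /= xpair_eqE.
by rewrite -natrM mulnb [x2 == _]eq_sym.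
Qed.

Lemma sum_delta (F : X -> rat) y : \sum_x (x == y)%:R * F x = F y.
Proof.
rewrite (bigD1 y) //= eqxx mul1r big1 ?addr0 // => x /negPf ->.
by rewrite mul0r.
Qed.

Lemma gl_contract c c' d d' :
  \sum_a (glue a c * glue c' a) * (glue (flip a) d * glue d' (flip a)) = glue c' d * glue d' c.
Proof.
rewrite -(sum_delta (fun a => glue (flip a) d * glue d' (flip a)) (c'.2, c.1)).
apply: eq_bigr => -[a1 a2] _; congr (_ * _); rewrite /glue /= xpair_eqE -natrM mulnb.
by rewrite andbC [c'.2 == _]eq_sym.
Qed.

(** The trace of the product of two commutators. *)
Lemma gl_edge c1 c2 d1 d2 :
  \sum_a \sum_a' gl_kap a a' * (gl_b a c1 c2 * gl_b a' d1 d2) =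
    glue c1 c2 * glue c2 d1 * glue d1 d2 * glue d2 c1
  - glue c1 c2 * glue c2 d2 * glue d2 d1 * glue d1 c1
  - glue c2 c1 * glue c1 d1 * glue d1 d2 * glue d2 c2
  + glue c2 c1 * glue c1 d2 * glue d2 d1 * glue d1 c2.
Proof.
pose S c c' d d' a := (glue a c * glue c' a) * (glue (flip a) d * glue d' (flip a)).
transitivity (\sum_a (glue c1 c2 * glue d1 d2 * S c1 c2 d1 d2 a
   - glue c1 c2 * glue d2 d1 * S c1 c2 d2 d1 a
   - glue c2 c1 * glue d1 d2 * S c2 c1 d1 d2 a
   + glue c2 c1 * glue d2 d1 * S c2 c1 d2 d1 a)).
  apply: eq_bigr => a _; under eq_bigr => a' _ do rewrite gl_kapE.
  by rewrite sum_delta /gl_b /S; ring.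
rewrite !big_split /= !sumrN -!mulr_sumr !gl_contract; ring.
Qed.

Lemma gl_jacobi c1 c2 d1 d2 : \sum_a \sum_a' gl_kap a a' *
     (gl_b a c1 c2 * gl_b a' d1 d2 + gl_b a c2 d1 * gl_b a' c1 d2 + gl_b a d1 c1 * gl_b a' c2 d2)
     = 0.
Proof.
pose S c1 c2 d1 d2 := \sum_a \sum_a' gl_kap a a' * (gl_b a c1 c2 * gl_b a' d1 d2).
transitivity (S c1 c2 d1 d2 + S c2 d1 c1 d2 + S d1 c1 c2 d2).
  rewrite /S -!big_split /=; apply: eq_bigr => a _.
  by rewrite -!big_split /=; apply: eq_bigr => a' _; rewrite 2!mulrDr.
by rewrite /S !gl_edge; ring.
Qed.

(** The first unit is E_(0,1) and no unit before the last ends at 0, so in the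
    iterated commutators only the products from left to right survive, and they
    do so only if the units are in consecutive order. *)
Lemma gl_comb_value k (xi : nat -> X) : (k.+2 < N)%N -> (xi 0%N).1 = 0%N :> nat ->
    (forall i, (i < k.+2)%N -> (xi i).2 = (xi i).1.+1 :> nat) ->
  comb_value gl_b gl_kap k xi =
    (all (fun i => (xi i).1 == i :> nat) (iota 0 k.+2) &&
     ((xi k.+2).1 == k.+2 :> nat) && ((xi k.+2).2 == 0%N :> nat))%:R.
Proof.
elim: k xi => [|k IH] xi kN x0 x1.
  have x1' i : (i < 2)%N -> ((xi i).2 == (xi 0).1) = false.
    by move=> i2; rewrite -(inj_eq val_inj) /= x0 (x1 i i2).
  rewrite /= /gl_b [glue (xi 1) (xi 0)]/glue x1' // mulr0 subr0 /glue -!natrM !mulnb.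
  congr (nat_of_bool _)%:R; rewrite -!(inj_eq val_inj) /= (x1 0) // (x1 1) // x0 /=.
  by rewrite andbT [1%N == _]eq_sym; case: eqP => //= ->; rewrite eq_sym.
have N0 : (0 < N)%N by lia.
have kN' : (k.+2 < N)%N by lia.
pose w0 : X := (Ordinal kN', Ordinal N0).
pose A := all (fun i => (xi i).1 == i :> nat) (iota 0 k.+2).
have cv w' : comb_value gl_b gl_kap k (set_at xi k.+2 w') = (w' == w0)%:R * A%:R.
  rewrite IH //; last by move=> i ik; rewrite /set_at (ltn_eqF ik) x1 //; lia.
  rewrite /set_at eqxx -natrM mulnb; congr (nat_of_bool _)%:R.
  have -> : (w' == w0) = ((w'.1 == k.+2 :> nat) && (w'.2 == 0%N :> nat)).
    by rewrite [w']surjective_pairing.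
  rewrite -andbA [RHS]andbC; congr andb.
  apply: eq_in_all => i; rewrite mem_iota => /andP[_ ik].
  by rewrite (ltn_eqF ik).
have -> : all (fun i => (xi i).1 == i :> nat) (iota 0 k.+3) =
    A && ((xi k.+2).1 == k.+2 :> nat).
  by rewrite -[k.+3]addn1 iotaD all_cat /= andbT.
rewrite [LHS]/=; under eq_bigr => w' _ do rewrite cv -mulrA.
rewrite sum_delta.
under eq_bigr => w _ do rewrite gl_kapC gl_kapE.
rewrite sum_delta /gl_b.
set y := xi k.+2; set z := xi k.+3.
have y1 : y.2 = y.1.+1 :> nat by apply: x1.
have -> : glue y (flip w0) = 0.
  by rewrite /glue -(inj_eq val_inj) /= y1.
rewrite mulr0 subr0 /glue -!natrM !mulnb; congr (nat_of_bool _)%:R.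
rewrite -!(inj_eq val_inj) /= y1 [k.+2 == _]eq_sym.
case: (A); rewrite ?andbT ?andbF //=.
by case: eqP => //= ->; rewrite [k.+3 == _]eq_sym.
Qed.

End MatrixUnits.

(** * The weight system on combs *)

(** Trees with two leaves have no trivalent vertex, hence neither AS nor IHX
    relations; this is why the strut may be sent to [c_tens]. *)
Lemma W_lift n : (2 <= n)%N -> exists L : {linear C n -> tens n}, forall T, L (cls T) = W T.
Proof.
case: n => [|[|[|k]]] // _; apply: C_lift => [m p q s si re|m p q v re|m p q r u v puv pq qr].
- by [].
- by have := tree_order (tree_onP p) isT; case: v {re} => v _; have := ltn_ord v; lia.
- by have := tree_order (tree_onP p) isT; case: u {puv pq qr} => u _; have := ltn_ord u; lia.
- by apply: ev_inj => xi; rewrite !W_contractE; apply: (state_rel_iso b3C kappaC _ si re).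
- by apply: ev_inj => xi; rewrite !evE !W_contractE; apply: (state_rel_AS b3C b3N kappaC _ re).
- apply: ev_inj => xi; rewrite !evE !W_contractE.
  exact: (state_rel_IHX b3C kappaC b3_jacobi _ puv pq qr).
Qed.

Definition comb_tensor k : tens k.+3 := W_contract (mktree (comb k)).

Lemma comb_tensor0 : comb_tensor 0 = Ins (cpow 2).
Proof. by rewrite Ins_cpow2. Qed.

Lemma comb_tensorS k : comb_tensor k.+1 = Ins (comb_tensor k).
Proof. exact: W_graft. Qed.

Lemma ev_comb_tensor k xi : ev (comb_tensor k) xi = comb_value b3 kappa k xi.
Proof. by rewrite W_contractE (@state_comb _ _ _ kappaC k _ xi). Qed.

Lemma comb_tensor_Inv k : comb_tensor k \in Inv k.+3.
Proof.
elim: k => [|k IH]; last by rewrite comb_tensorS Ins_Inv.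
by rewrite comb_tensor0; apply/Ins_Inv/cpow_Inv.
Qed.

Lemma comb_value_h k : comb_value b3 kappa k all_h = 0.
Proof.
rewrite -ev_comb_tensor; case: k => [|k].
  by rewrite ev_comb_tensor /= b3E.
rewrite comb_tensorS ev_Ins big1 // => w _; rewrite cobrE.
by case: w; rewrite mulr0.
Qed.

Lemma c_tens_cpow : c_tens = cpow 2.
Proof.
apply: ev_inj => xi; rewrite ev_cpow big_ord1 /ev; congr (c_tens _).
by apply/eq_from_tnth => -[[|[|//]] i2]; rewrite tnth_mktuple !(tnth_nth Bh).
Qed.

Section LinearExtension.
Variables (k : nat) (L : {linear C k.+3 -> tens k.+3}).
Hypothesis LE : forall T, L (cls T) = W_contract T.

Lemma L_Inv x : L x \in Inv k.+3.
Proof.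
move: x (comb_span x); apply: span_ind_closed => [|a u v Iu Iv|_ [sg [_ _ ->]]].
- by rewrite linear0 mem0v.
- by rewrite linearP memvD ?memvZ.
by rewrite LE W_relabel permt_Inv ?comb_tensor_Inv.
Qed.

Lemma L_all_h x : ev (L x) all_h = 0.
Proof.
move: x (comb_span x); apply: span_ind_closed => [|a u v Iu Iv|_ [sg [_ _ ->]]].
- by rewrite linear0 ev0.
- by rewrite linearP evD evZ Iu Iv mulr0 addr0.
by rewrite LE W_relabel ev_permt_all_h ev_comb_tensor comb_value_h.
Qed.

Lemma L_surj_J t : span (@tree_tensor k.+3) t -> exists x, L x = t.
Proof.
move: t; apply: span_ind_closed => [|a _ _ [x <-] [y <-]|_ [_ [T ->]]].
- by exists 0; rewrite linear0.
- by exists (a *: x + y); rewrite linearP.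
by exists (cls T); rewrite LE.
Qed.

Definition fixes_ends (sg : {perm 'I_k.+3}) := (sg ord0 == ord0) && (sg ord_max == ord_max).

Lemma comb_coordinates x : exists a : {perm 'I_k.+3} -> rat,
  x = \sum_(sg | fixes_ends sg) a sg *: cls (mktree (relabel sg (comb k))).
Proof.
move: x (comb_span x); apply: span_ind_closed => [|c _ _ [a ->] [b ->]|_ [sg [s0 sl ->]]].
- by exists (fun=> 0); rewrite big1 // => sg _; rewrite scale0r.
- exists (fun sg => c * a sg + b sg); rewrite scaler_sumr -big_split /=.
  by apply: eq_bigr => sg _; rewrite scalerA scalerDl.
exists (fun tau => (tau == sg)%:R).
rewrite (bigD1 sg) /=; last by rewrite /fixes_ends s0 sl !eqxx.
by rewrite eqxx scale1r big1 ?addr0 // => tau /andP[_ /negPf ->]; rewrite scale0r.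
Qed.

(** Permuting the slots before applying [F] picks out any one coefficient of a
    combination of permuted combs. *)
Lemma L_inj_of_probe (F : {linear tens k.+3 -> rat^o}) :
    (forall sg, fixes_ends sg -> F (permt sg (comb_tensor k)) = (sg == 1%g)%:R) ->
  injective L.
Proof.
move=> FE; apply: raddf_inj => x; have [a ->] := comb_coordinates x => Lx0.
rewrite big1 // => tau ft; suff -> : a tau = 0 by rewrite scale0r.
have E : F (permt tau^-1%g (L (\sum_(sg | fixes_ends sg) a sg *: cls (mktree (relabel sg (comb k))))))
    = \sum_(sg | fixes_ends sg) a sg * (sg == tau)%:R.
  rewrite linear_sum /= linear_sum /= linear_sum /=; apply: eq_bigr => sg fs.
  rewrite linearZ /= LE W_relabel linearZ /= linearZ /= -permtM FE; last first.
    case/andP: ft fs => /eqP t0 /eqP tl /andP[/eqP s0 /eqP sl].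
    by rewrite /fixes_ends !permM s0 sl -{1}t0 -{1}tl !permK !eqxx.
  by rewrite -eq_mulgV1.
move: E; rewrite Lx0 !linear0 (bigD1 tau) //= eqxx mulr1 big1 ?addr0 => [|sg /andP[_ /negPf ->]].
  by move=> <-.
by rewrite mulr0.
Qed.

End LinearExtension.

Definition probe n (l : seq (rat * seq sl2_basis)) (t : tens n) : rat^o :=
  \sum_(p <- l) p.1 * ev t (nth Bh p.2).

Fact probe_linear n l : linear (@probe n l).
Proof.
move=> a t u; rewrite /probe scaler_sumr -big_split /=; apply: eq_bigr => p _.
by rewrite !evE mulrDr mulrCA.
Qed.
HB.instance Definition _ n l := GRing.isLinear.Build rat (tens n) rat^o *:%R
  (@probe n l) (@probe_linear n l).

Lemma comb_valueS k xi : comb_value b3 kappa k.+1 xi =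
  \sum_w comb_value b3 kappa k (set_at xi k.+2 w) * cobr w (xi k.+2) (xi k.+3).
Proof.
by [].
Qed.

(** [comb_value] in a form that computes. *)
Fixpoint comb_eval k xi : rat :=
  if k is k'.+1 then
    let v w := comb_eval k' (set_at xi k.+1 w) * cobr_val w (xi k.+1) (xi k.+2) in
    v Bh + v Be + v Bf
  else b3_val (xi 0) (xi 1) (xi 2).

Lemma comb_evalE k xi : comb_value b3 kappa k xi = comb_eval k xi.
Proof.
elim: k xi => [|k IH] xi; first exact: b3E.
by rewrite comb_valueS big_sl2 !IH !cobrE.
Qed.

Lemma ev_permt_comb k (sg : {perm 'I_k.+3}) (s : seq sl2_basis) (l : seq nat) :
    (forall i : 'I_k.+3, nth 0%N l i = sg i) ->
  ev (permt sg (comb_tensor k)) (nth Bh s) = comb_eval k (nth Bh s \o nth 0%N l).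
Proof.
move=> lE; rewrite ev_permt ev_comb_tensor -comb_evalE; apply: eq_comb_value => i ik.
by rewrite -(tnth_nth Bh _ (Ordinal ik)) tnth_mktuple /= -lE.
Qed.

(** The coordinates and coefficients of the probe solve the linear system that
    makes it dual to the 1, 2 or 6 permuted combs. *)
Lemma inj_le5 k (L : {linear C k.+3 -> tens k.+3}) :
  (forall T, L (cls T) = W_contract T) -> (k <= 2)%N -> injective L.
Proof.
move=> LE k2.
pose l : seq (rat * seq sl2_basis) := nth [::] [::
  [:: (1, [:: Bh; Be; Bf])];
  [:: (-1, [:: Bh; Be; Bh; Bf])];
  [:: (- 2^-1, [:: Bh; Bh; Be; Bh; Bf]); (- 2^-1, [:: Bh; Be; Bh; Bf; Bh]);
      (4^-1, [:: Bh; Be; Bf; Be; Bf])]] k.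
apply: (L_inj_of_probe LE (F := @probe k.+3 l)) => sg /andP[/eqP s0 /eqP sl].
pose r := [seq nat_of_ord (sg i) | i <- enum 'I_k.+3].
have rE (i : 'I_k.+3) : nth 0%N r i = sg i.
  by rewrite (nth_map ord0) ?size_enum_ord // nth_ord_enum.
have sgE : (sg == 1%g) = (r == iota 0 k.+3).
  rewrite -val_enum_ord; apply/eqP/eqP => [e|e].
    by rewrite /r e; apply: eq_map => i; rewrite perm1.
  apply/perm.permP => i; apply: val_inj; rewrite perm1 -[LHS]rE e.
  by rewrite (nth_map ord0) ?size_enum_ord // nth_ord_enum.
transitivity (\sum_(p <- l) p.1 * comb_eval k (nth Bh p.2 \o nth 0%N r)).
  by apply: eq_bigr => p _; rewrite (ev_permt_comb _ rE).
have r0 : nth 0%N r 0 = 0%N by rewrite (rE ord0) s0.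
have rl : nth 0%N r k.+2 = k.+2 by rewrite (rE ord_max) sl.
have ru : uniq r by rewrite map_inj_uniq ?enum_uniq // => i j /val_inj/perm_inj.
have rn : all (fun i => i < k.+3)%N r by apply/allP => _ /mapP[i _ ->].
have rs : size r = k.+3 by rewrite size_map size_enum_ord.
rewrite {}sgE; clear rE; subst l; clearbody r; clear L LE sg s0 sl.
case: k k2 r0 rl ru rn rs => [|[|[|//]]] _; case: r => // i0 [|i1 [|i2 [|i3 [|i4 [|//]]]]] //=.
- move=> -> -> /=; case: i1 => [|[|[|]]] //= _ _ _; by rewrite big_seq1; apply/eqP.
- move=> -> ->; case: i1 => [|[|[|[|]]]] //=; case: i2 => [|[|[|[|]]]] //= _ _ _;
  by rewrite big_seq1; apply/eqP; vm_compute.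
move=> -> ->; case: i1 => [|[|[|[|[|]]]]] //=; case: i2 => [|[|[|[|[|]]]]] //=;
  case: i3 => [|[|[|[|[|]]]]] //= _ _ _;
  by rewrite !big_cons big_nil; apply/eqP; vm_compute.
Qed.

(** * Failure of injectivity from six leaves on *)

Section WordFunctional.
Variable k : nat.
Local Notation N := k.+3.

(** Leaf [i] is coloured by E_(i,i+1), cyclically, so that the product of all
    colours in the order of the comb has trace 1. *)
Definition word (i : 'I_N) : 'I_N * 'I_N := (i, ordS i).

Lemma word_functional : exists F : {linear C N -> rat^o}, forall sg,
  fixes_ends sg -> F (cls (mktree (relabel sg (comb k)))) = (sg == 1%g)%:R.
Proof.
pose f (T : tree N) : rat^o :=
  let: existT m p := T in state (@gl_kap N) (val p) (verts (@gl_b N)) word.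
have [|||F FE] := @C_lift N rat^o f.
- by move=> m p q s si re; apply: (state_rel_iso (@gl_bC N) (@gl_kapC N) _ si re).
- by move=> m p q v re; apply: (state_rel_AS (@gl_bC N) (@gl_bN N) (@gl_kapC N) _ re).
- move=> m p q r u v puv pq qr.
  exact: (state_rel_IHX (@gl_bC N) (@gl_kapC N) (@gl_jacobi N) _ puv pq qr).
exists F => sg /andP[/eqP s0 /eqP sl]; rewrite FE /f /= (state_relabel _ (@gl_kapC N)).
pose xi (i : nat) := word (sg (inord i)).
have xiE (i : 'I_N) : (word \o sg) i = xi i by rewrite /xi inord_val.
rewrite (state_comb (@gl_b N) (@gl_kapC N) xiE).
have inord0 : inord 0 = ord0 :> 'I_N by apply: val_inj; rewrite /= inordK.
have inordm : inord k.+2 = ord_max :> 'I_N by apply: val_inj; rewrite /= inordK.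
rewrite gl_comb_value //; first last.
- move=> i ik; rewrite /xi /= modn_small // ltnS.
  have : sg (inord i) != ord_max.
    rewrite -sl (inj_eq perm_inj) -(inj_eq val_inj) /= inordK; lia.
  by rewrite -(inj_eq val_inj) /=; have := ltn_ord (sg (inord i)); lia.
- by rewrite /xi inord0 s0.
rewrite /xi inordm sl; set P := all _ _.
rewrite /= modnn !eqxx !andbT /P; congr (nat_of_bool _)%:R.
apply/idP/eqP => [/allP H|->]; last first.
  by apply/allP => i; rewrite mem_iota perm1 => /andP[_ ik]; rewrite inordK //; lia.
apply/perm.permP => i; apply: val_inj; rewrite perm1 /=.
have [ik|ik] := ltnP i k.+2.
  by have := H i; rewrite mem_iota ik inord_val => /(_ isT)/eqP.
have -> : i = ord_max by apply: val_inj; have := ltn_ord i; rewrite /=; lia.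
by rewrite sl.
Qed.

End WordFunctional.

(** The comb antisymmetrized in its middle leaves is the nonzero element of the
    kernel. *)
Lemma not_inj_ge6 k (L : {linear C k.+3 -> tens k.+3}) :
  (forall T, L (cls T) = W_contract T) -> (3 <= k)%N -> ~ injective L.
Proof.
move=> LE k3 injL.
pose A : C k.+3 := \sum_(sg | @fixes_ends k sg)
  (-1) ^+ (odd_perm sg) *: cls (mktree (relabel sg (comb k))).
have [F FE] := word_functional k.
have FA : F A = 1.
  transitivity (\sum_(sg | @fixes_ends k sg) (-1) ^+ odd_perm sg * (sg == 1%g)%:R : rat).
    by rewrite /A linear_sum; apply: eq_bigr => sg fs; rewrite linearZ FE.
  have f1 : fixes_ends (1%g : {perm 'I_k.+3}) by rewrite /fixes_ends !perm1 !eqxx.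
  rewrite (bigD1 1%g f1) odd_perm1 expr0 mul1r eqxx big1 ?addr0 // => sg /andP[_ /negPf ->].
  by rewrite mulr0.
suff LA : L A = 0.
  have A0 : A = 0 by apply: injL; rewrite LA linear0.
  by have := FA; rewrite A0 linear0 => /esym/eqP; rewrite oner_eq0.
have LAE : L A = \sum_(sg | @fixes_ends k sg) (-1) ^+ (odd_perm sg) *: permt sg (comb_tensor k).
  by rewrite /A linear_sum /=; apply: eq_bigr => sg _; rewrite linearZ /= LE W_relabel.
apply: ev_inj => xi; rewrite ev0 LAE ev_sum.
(* Two of the first four middle leaves carry the same colour; exchanging them
   negates the sum and leaves its value unchanged. *)
have [i [j [ij i0 il j0 [jl xij]]]] : exists i j : 'I_k.+3,
    [/\ i != j, i != ord0, i != ord_max, j != ord0 & j != ord_max /\ xi i = xi j].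
  pose mid (m : 'I_4) : 'I_k.+3 := inord m.+1.
  have midE m : mid m = m.+1 :> nat by rewrite inordK //; have := ltn_ord m; lia.
  have /injectivePn[m [m' mm e]] : ~~ injectiveb (fun m : 'I_4 => xi (mid m)).
    apply/negP => /injectiveP /leq_card.
    rewrite card_ord; have -> // : #|{: sl2_basis}| = 3.
    by rewrite -sum1_card (bigD1 Bh) // (bigD1 Be) // (bigD1 Bf) //= big1 // => -[].
  have := ltn_ord m; have := ltn_ord m' => m4 m4'.
  have mm' : m != m' :> nat by [].
  exists (mid m), (mid m'); rewrite -!(inj_eq val_inj) /= !midE eqSS; split=> //; try lia.
  by split; [lia | move: e; rewrite !midE].
pose tau := tperm i j.
have tau_fixes sg : fixes_ends (sg * tau)%g = fixes_ends sg.
  rewrite /fixes_ends !permM.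
  have t0 : tau ord0 = ord0 by rewrite tpermD.
  have tl : tau ord_max = ord_max by rewrite tpermD.
  by rewrite -{2}t0 -{2}tl !(inj_eq perm_inj).
set S := \sum_(sg | _) _; suff SN : S = - S by move: SN; lra.
rewrite {1}/S (reindex_inj (mulIg tau)) /= -sumrN; apply: eq_big => [sg|sg fs]; first exact: tau_fixes.
rewrite !evZ permtM ev_tperm odd_permM odd_tperm ij signr_addb mulrN1 mulNr.
congr (- (_ * _)); apply: eq_ev => m mk; rewrite /swap_at.
by case: eqP => [->|_]; last case: eqP => [->|].
Qed.

Lemma image_J2 (t : tens 2) : span (@tree_tensor 2) t -> t = 0.
Proof. by elim=> // a g v [/=]. Qed.

(** * Two leaves, and the theorem *)
Definition strut_fun : {ffun half 2 0 -> half 2 0} :=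
  [ffun x : half 2 0 => if x is inl i then inl (rev_ord i) else x].

Lemma strut_tree : is_tree strut_fun.
Proof.
have pK : involutive strut_fun by move=> [i|[[]//]]; rewrite !ffunE rev_ordK.
apply: connected_tree => // [[[[|[|//]] i2]|[[]//]]|]; rewrite ?ffunE //.
have e (i : 'I_2) : connect (adj strut_fun) (inl i) (inl (rev_ord i)).
  by have := adj_edge strut_fun (inl i); rewrite ffunE => /connect1.
move=> [i|[]//] [j|[]//]; have [->|ij] := eqVneq j i; first exact: connect0.
suff -> : j = rev_ord i by apply: e.
by apply: val_inj; rewrite /= subSS; move: i j ij => [[|[|//]] ?] [[|[|//]] ?].
Qed.

Lemma strut_unique (p q : tree_on 2 0) : cls (mktree p) = cls (mktree q).
Proof.
apply: (@cls_iso _ _ p q id); first by split=> //; exists id.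
have other (p' : tree_on 2 0) i : val p' (inl i) = inl (rev_ord i).
  have [pK pN _ _] := tree_onP p'; have := pN (inl i).
  case: (val p' (inl i)) => [j|[[]//]] ji; congr inl; apply: val_inj.
  by rewrite /= subSS; move: i j ji => [[|[|//]] ?] [[|[|//]] ?].
by move=> [i|[[]//]]; rewrite !other.
Qed.

Lemma C2_line (x : C 2) : exists a, x = a *: cls (mktree (Tree strut_tree)).
Proof.
move: x (span_cls x); apply: span_ind_closed => [|a _ _ [b ->] [c ->]|_ [T ->]].
- by exists 0; rewrite scale0r.
- by exists (a * b + c); rewrite scalerA scalerDl.
have [p ->] := tree_vertices T; exists 1; rewrite scale1r; exact: strut_unique.
Qed.

Theorem theorem1p2 (n : nat) (n_ge2 : (2 <= n)%N) :
  exists Wh : {linear C n -> subvs_of (Inv n)},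
    [/\ forall T : tree n, vsval (Wh (cls T)) = W T,
        injective Wh <-> (n <= 5)%N,
        odd n \/ n = 2%N -> forall t, exists x, Wh x = t
      & forall (n_ge4 : (4 <= n)%N) (n_even : ~~ odd n),
          let coker := quotmod (fun t => exists x, Wh x = t) in
          let w : coker := quotmod_pi _ (Subvs (cpow_Inv n_even)) in
          w <> 0 /\ forall y : coker, exists a : rat, y = a *: w].
Proof.
have [L LW] := W_lift n_ge2.
have L_in x : L x \in Inv n.
  case: n n_ge2 L LW x => [|[|[|k]]] // _ L LW x; last exact: (L_Inv LW).
  move: x (span_cls x); apply: span_ind_closed => [|a u v Iu Iv|_ [T ->]].
  - by rewrite linear0 mem0v.
  - by rewrite linearP memvD ?memvZ.
  by rewrite LW /= c_tens_cpow cpow_Inv.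
pose Wh : {linear C n -> subvs_of (Inv n)} := vsproj (Inv n) \o L.
have WhE x : vsval (Wh x) = L x by rewrite /= vsprojK.
have L_h : (3 <= n)%N -> forall x, ev (L x) all_h = 0.
  case: n L LW {n_ge2 L_in Wh WhE} => [|[|[|k]]] // L LW _; exact: (L_all_h LW).
have symJ t : t \in Inv n -> forall sg, span (@tree_tensor n) (t - permt sg t).
  by case: n n_ge2 {L LW L_in Wh WhE L_h} t => // m _ t; apply: Inv_sym_mod_trees.
have J_image : (3 <= n)%N -> forall t, span (@tree_tensor n) t -> exists x, L x = t.
  by case: n {n_ge2 L_h L_in Wh WhE symJ} L LW => [|[|[|k]]] // L LW _; apply: L_surj_J.
have WhI x t : L x = vsval t -> Wh x = t by move=> e; apply: subvs_inj; rewrite WhE.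
exists Wh; split.
- by move=> T; rewrite WhE LW.
- split=> [injW|n5].
    rewrite leqNgt; apply/negP => n6.
    case: n n_ge2 n6 L LW L_in Wh WhE injW {symJ J_image WhI L_h} => [|[|[|k]]] // _ n6 L LW L_in Wh WhE injW.
    apply: (not_inj_ge6 LW) => // x y e; apply: injW; apply: subvs_inj.
    by rewrite !WhE e.
  suff injL : injective L by move=> x y /(congr1 vsval); rewrite !WhE => /injL.
  case: n n_ge2 n5 L LW {L_h L_in Wh WhE symJ J_image WhI} => [|[|[|k]]] // _ n5 L LW; last exact: (inj_le5 LW).
  move=> x y; have [a ->] := C2_line x; have [c ->] := C2_line y.
  rewrite !linearZ !LW /= c_tens_cpow => /(congr1 (fun t => ev t all_h)).
  by rewrite !evZ ev_cpow_h => /mulIf ->.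
- move=> n_odd t; have [n3|n2] := leqP 3 n.
    have on : odd n by case: n_odd => // n2; rewrite n2 in n3.
    have [x xt] := J_image n3 _ (average symJ (subvsP t) (or_introl on)).
    by exists x; apply: WhI.
  have {n_odd n2} n2 : n = 2%N by lia.
  subst n; have [a] := cpow_coker symJ isT (subvsP t).
  move=> /image_J2/eqP; rewrite subr_eq0 => /eqP ta.
  exists (a *: cls (mktree (Tree strut_tree))); apply: WhI.
  by rewrite linearZ LW /= c_tens_cpow ta.
move=> n4 n_even coker w.
have n3 : (3 <= n)%N by apply: leq_trans n4.
split=> [w0|y].
  have : span (fun t => exists x, Wh x = t) (Subvs (cpow_Inv n_even) - 0).
    by apply/quotmod_eq; rewrite -/w w0 raddf0.
  rewrite subr0; suff im t : span (fun t => exists x, Wh x = t) t -> exists x, Wh x = t.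
    move=> /im[x /(congr1 vsval)]; rewrite WhE /= => Lx.
    have := ev_cpow_h n; rewrite -Lx.
    rewrite L_h //.
    by move/esym/eqP; rewrite expf_eq0 invr_eq0 /= andbF.
  elim=> [|a g v [x <-] _ [x' <-]]; first by exists 0; rewrite linear0.
  by exists (a *: x + x'); rewrite linearP.
have [t <-] : exists t, quotmod_pi _ t = y by eexists; apply: quotmod_repr.
have [a Ja] := cpow_coker symJ n_even (subvsP t).
have [x xt] := J_image n3 _ Ja.
exists a; rewrite /w -linearZ; apply/quotmod_eq/span_gen; exists x.
by apply: WhI; rewrite xt.
Qed.
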